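(* Let $s\in(0,1)$ and $2<p<2/(1-s)$, let $\Omega\subset\mathbb{R}^d$ be a bounded smooth domain and $t_1<t_2$. Let $u$ be a viscosity supersolution and $v$ a viscosity subsolution of $\partial_t w+(-\Delta_p)^s w=0$ in $\Omega\times(t_1,t_2]$. Assume, in addition, that $$-u,\,v\in \mathrm{USC}(\overline\Omega\times[t_1,t_2]).$$ If $$u\ge v\ \text{ on }\ \partial\Omega\times(t_1,t_2]\ \text{ and on }\ \Omega\times\{t_1\},$$ and $$u\ge v\quad\text{a.e. in }(\mathbb{R}^d\setminus\Omega)\times(t_1,t_2],$$ then $$u\ge v\quad\text{in }\Omega\times(t_1,t_2].$$
   Context: The fractional $p$-Laplacian is $$(-\Delta_p)^s u(x,t)=\mathrm{P.V.}\int_{\mathbb{R}^d}\frac{|u(x,t)-u(y,t)|^{p-2}(u(x,t)-u(y,t))}{|x-y|^{d+sp}}\,dy .$$ The tail space $L^{p-1}_{sp}(\mathbb{R}^d)$ consists of all $w:\mathbb{R}^d\to\mathbb{R}$ with $\|w\|_{L^{p-1}_{sp}(\mathbb{R}^d)}:=\bigl(\int_{\mathbb{R}^d}\frac{|w(x)|^{p-1}}{1+|x|^{d+sp}}\,dx\bigr)^{1/(p-1)}<\infty$. In $C_{\mathrm{loc}}(t_1,t_2;X)$, ''loc'' refers to compact sub-intervals of $(t_1,t_2]$. $\mathrm{USC}$/$\mathrm{LSC}$ denote upper/lower semicontinuous functions. $Q_r(x_0,t_0):=B_r(x_0)\times(t_0-r^2,t_0]$, and $C^2(Q_r(x_0,t_0))$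 denotes functions that are $C^2$ in space and $C^1$ in time. A function $u$ is a viscosity subsolution of $\partial_tu+(-\Delta_p)^su=0$ in $\Omega\times(t_1,t_2]$ if $u\in\mathrm{USC}(\Omega\times(t_1,t_2])\cap C_{\mathrm{loc}}(t_1,t_2;L^{p-1}_{sp}(\mathbb{R}^d))$ and, whenever $\phi\in C^2(Q_r(x_0,t_0))$ for some $Q_r(x_0,t_0)\subset\Omega\times(t_1,t_2]$ touches $u$ from above at $(x_0,t_0)$ in $Q_r(x_0,t_0)$ (i.e. $\phi(x_0,t_0)=u(x_0,t_0)$ and $\phi\ge u$ in $Q_r(x_0,t_0)$), one has $$\partial_t\phi(x_0,t_0)+(-\Delta_p)^s\phi_r(x_0,t_0)\le 0,\qquad \phi_r:=\begin{cases}\phi&\text{in }Q_r(x_0,t_0),\\ u&\text{otherwise.}\end{cases}$$ A viscosity supersolution is defined in the same way with $\mathrm{LSC}$, touching from below, and $\ge 0$. *)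

(* Defs.v *)
From HB Require Import structures.
From mathcomp Require Import all_boot all_order all_algebra.
From mathcomp Require Import all_classical all_reals all_analysis.

Set Implicit Arguments.
Unset Strict Implicit.
Unset Printing Implicit Defensive.
Import Order.TTheory GRing.Theory Num.Theory.
Import numFieldNormedType.Exports.

Local Open Scope classical_set_scope.
Local Open Scope ring_scope.

(* The Borel sigma-algebra of R^d, as the one generated by the coordinates. *)
Definition rV_coord (R : realType) (d : nat) (i : 'I_d) (x : 'rV[R]_d) :
  measurableTypeR R := x ord0 i.

Definition rV_display : measure_display. Proof. exact: default_measure_display. Qed.

Section measurable_rV.
Variables (R : realType) (d : nat).

Let rV_set0 : g_sigma_preimage (@rV_coord R d) set0.
Proof. exact: sigma_algebra0. Qed.

Let rV_setC A : g_sigma_preimage (@rV_coord R d) A ->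
  g_sigma_preimage (@rV_coord R d) (~` A).
Proof. exact: sigma_algebraC. Qed.

Let rV_bigcup (F : (set 'rV[R]_d)^nat) :
  (forall i, g_sigma_preimage (@rV_coord R d) (F i)) ->
  g_sigma_preimage (@rV_coord R d) (\bigcup_i (F i)).
Proof. exact: sigma_algebra_bigcup. Qed.

HB.instance Definition _ := @isMeasurable.Build rV_display
  'rV[R]_d (g_sigma_preimage (@rV_coord R d)) rV_set0 rV_setC rV_bigcup.

End measurable_rV.

Lemma measurable_rV_coord (R : realType) (d : nat) (i : 'I_d) :
  measurable_fun setT (@rV_coord R d i).
Proof.
move=> _ Y mY; rewrite setTI; apply: sub_sigma_algebra => /=.
rewrite -bigcup_seq/=; exists i => /=; first by rewrite mem_index_enum.
by exists Y => //; rewrite setTI.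
Qed.

Lemma measurable_fun_rVP (R : realType) (d : nat) d1 (T : measurableType d1)
    (f : T -> 'rV[R]_d) :
  (forall i, measurable_fun setT (@rV_coord R d i \o f)) ->
  measurable_fun setT f.
Proof.
move=> mf _ Y mY; rewrite setTI.
suff : g_sigma_preimage (@rV_coord R d) `<=`
    [set A : set 'rV[R]_d | measurable (f @^-1` A)] by apply.
apply: smallest_sub; first split => /=.
- by rewrite preimage_set0.
- by move=> A mA; rewrite setTD preimage_setC; exact: measurableC.
- by move=> F mF; rewrite preimage_bigcup; exact: bigcup_measurable.
- rewrite -bigcup_seq => A [i _ [B mB <-]] /=.
  by rewrite setTI -comp_preimage -[X in measurable X]setTI; exact: mf.
Qed.

Definition rV_cons (R : realType) (d : nat)
  (z : measurableTypeR R * 'rV[R]_d) : 'rV[R]_d.+1 :=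
  row_mx (const_mx z.1 : 'rV[R]_1) z.2.

Lemma measurable_rV_cons (R : realType) (d : nat) :
  measurable_fun setT (@rV_cons R d).
Proof.
apply: measurable_fun_rVP => i; case: (unliftP ord0 i) => [j ->|->].
- rewrite (_ : _ \o _ = @rV_coord R d j \o snd).
    exact: (measurableT_comp (@measurable_rV_coord R d j)).
  apply/funext => z /=; rewrite /rV_coord /rV_cons.
  have -> : lift ord0 j = rshift 1 j by exact/val_inj.
  exact: (row_mxEr (const_mx z.1 : 'rV[R]_1) z.2).
- rewrite (_ : _ \o _ = fst) //.
  apply/funext => z /=; rewrite /rV_coord /rV_cons.
  have -> : (ord0 : 'I_d.+1) = lshift d (ord0 : 'I_1) by exact/val_inj.
  by rewrite (row_mxEl (const_mx z.1 : 'rV[R]_1) z.2) mxE.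
Qed.

Section lebesgue_rV_step.
Variables (R : realType) (d : nat) (mu : {measure set 'rV[R]_d -> \bar R}).

Definition lebesgue_rV_cons : set 'rV[R]_d.+1 -> \bar R :=
  pushforward (@lebesgue_measure R \x^ mu)%E (@rV_cons R d).

HB.instance Definition _ := Measure.copy lebesgue_rV_cons
  (measure_function_pushforward__canonical__measure_function_Measure
     (@lebesgue_measure R \x^ mu)%E (@measurable_rV_cons R d)).

End lebesgue_rV_step.

Fixpoint lebesgue_rV (R : realType) (d : nat) :
    {measure set 'rV[R]_d -> \bar R} :=
  match d with
  | 0 => dirac (0 : 'rV[R]_0)
  | n.+1 => lebesgue_rV_cons (lebesgue_rV R n)
  end.

Lemma lebesgue_rV_box (R : realType) (d : nat)
    (A : 'I_d -> set (measurableTypeR R)) : (forall i, measurable (A i)) ->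
  lebesgue_rV R d [set x | forall i, A i (x ord0 i)] =
  (\prod_(i < d) lebesgue_measure (A i))%E.
Proof.
elim: d A => [A _|d IH A mA].
  by rewrite big_ord0 /= diracE mem_set//= => -[].
pose B := [set x : 'rV[R]_d | forall i, A (lift ord0 i) (x ord0 i)].
have mB : measurable B.
  rewrite (_ : B = \bigcap_(i in [set: 'I_d])
      (@rV_coord R d i @^-1` A (lift ord0 i))); last first.
    apply/seteqP; split=> [x Bx i _|x Bx i]; first exact: Bx.
    exact: (Bx i).
  apply: fin_bigcap_measurable => // i _; rewrite -[X in measurable X]setTI.
  exact: measurable_rV_coord.
rewrite /= /lebesgue_rV_cons /pushforward.
rewrite (_ : _ @^-1` _ = A ord0 `*` B); last first.
  have E (z : measurableTypeR R * 'rV[R]_d) :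
      rV_cons z ord0 ord0 = z.1 /\
      forall j, rV_cons z ord0 (lift ord0 j) = z.2 ord0 j.
    rewrite /rV_cons; split=> [|j].
      have -> : (ord0 : 'I_d.+1) = lshift d (ord0 : 'I_1) by exact/val_inj.
      by rewrite (row_mxEl (const_mx z.1 : 'rV[R]_1) z.2) mxE.
    have -> : lift ord0 j = rshift 1 j by exact/val_inj.
    exact: (row_mxEr (const_mx z.1 : 'rV[R]_1) z.2).
  apply/seteqP; split=> z; have [E0 ES] := E z.
    move=> H; split; first by rewrite /= -E0; exact: H.
    by move=> i; rewrite -ES; exact: H.
  move=> [/= H0 H1] i; case: (unliftP ord0 i) => [j ->|->].
    by rewrite ES; exact: H1.
  by rewrite E0.
rewrite product_measure2E// big_ord_recl; congr (_ * _)%E.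
by apply: IH => i; exact: mA.
Qed.

(* Measurability with respect to the completion of [lebesgue_rV], i.e. in the
   sense of Lebesgue. The library integral is a supremum over Borel simple
   functions, hence agrees with the Lebesgue integral on these functions. *)
Definition lebesgue_measurable_fun (R : realType) (d : nat)
    (w : 'rV[R]_d -> R) : Prop :=
  exists2 g : 'rV[R]_d -> measurableTypeR R,
    measurable_fun setT g & {ae lebesgue_rV R d, forall x, w x = g x}.

(* The library norm [`|x|] on 'rV[R]_d is the sup norm, with the same topology. *)
Definition enorm (R : realType) (d : nat) (x : 'rV[R]_d) : R :=
  Num.sqrt (\sum_i x ord0 i ^+ 2).

Definition eball (R : realType) (d : nat) (x0 : 'rV[R]_d) (r : R) :
  set 'rV[R]_d := [set x | enorm (x - x0) < r].

Definition cylinder (R : realType) (d : nat) (x0 : 'rV[R]_d) (t0 r : R) :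
  set ('rV[R]_d * R) := eball x0 r `*` `]t0 - r ^+ 2, t0]%classic.

Definition boundary (T : topologicalType) (A : set T) : set T :=
  closure A `\` interior A.

Definition evec (R : realType) (d : nat) (i : 'I_d) : 'rV[R]_d :=
  delta_mx ord0 i.

Fixpoint Ck (R : realType) (m k : nat) (f : 'rV[R]_m -> R) : Prop :=
  match k with
  | 0 => continuous f
  | k'.+1 => continuous f /\ forall i : 'I_m,
      (forall x, derivable f x (evec R i)) /\
      Ck k' (fun x => 'D_(evec R i) f x)
  end.

Definition smooth (R : realType) (m : nat) (f : 'rV[R]_m -> R) : Prop :=
  forall k, Ck k f.

(* Near each boundary point, after choosing a coordinate axis [i] and a sign,
   the set is the strict epigraph of a smooth function of the other
   coordinates [col' i x]. *)
Definition smooth_boundary (R : realType) (d : nat) (Omega : set 'rV[R]_d) :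
  Prop :=
  forall x0, boundary Omega x0 ->
  exists (r : R) (i : 'I_d) (b : bool) (gamma : 'rV[R]_d.-1 -> R),
    [/\ 0 < r, smooth gamma &
      forall x, eball x0 r x ->
        (Omega x <-> gamma (col' i x) < (-1) ^+ b * x ord0 i)].

Definition bounded_smooth_domain (R : realType) (d : nat)
    (Omega : set 'rV[R]_d) : Prop :=
  [/\ Omega !=set0, open Omega, connected Omega, bounded_set Omega &
      smooth_boundary Omega].

Definition LSC (R : realType) (T : topologicalType) (A : set T) (f : T -> R) :
  Prop := lower_semicontinuous (fun z : subspace A => (f z)%:E).

Definition USC (R : realType) (T : topologicalType) (A : set T) (f : T -> R) :
  Prop := LSC A (fun z => - f z).

Definition tail_norm (R : realType) (d : nat) (s p : R) (w : 'rV[R]_d -> R) :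
  \bar R :=
  ((\int[lebesgue_rV R d]_x
     (`|w x| `^ (p - 1) / (1 + enorm x `^ (d%:R + s * p)))%:E)
   `^ (p - 1)^-1)%E.

Definition tail_space (R : realType) (d : nat) (s p : R) (w : 'rV[R]_d -> R) :
  Prop := lebesgue_measurable_fun w /\ (tail_norm s p w < +oo)%E.

Definition C_tail (R : realType) (d : nat) (s p : R) (I : set R)
    (u : 'rV[R]_d * R -> R) : Prop :=
  forall t, I t ->
    tail_space s p (fun x => u (x, t)) /\
    tail_norm s p (fun x => u (x, tau) - u (x, t))
      @[tau --> within I (nbhs t)] --> 0%E.

Definition Cloc_tail (R : realType) (d : nat) (s p t1 t2 : R)
    (u : 'rV[R]_d * R -> R) : Prop :=
  forall a b, t1 < a -> a <= b -> b <= t2 -> C_tail s p `[a, b]%classic u.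

(* Time derivative from within [tau <= T]: two-sided for t < T, and the left
   derivative at t = T, the top of a cylinder. *)
Definition time_quotient (R : realType) (d : nat) (phi : 'rV[R]_d * R -> R)
  (z : 'rV[R]_d * R) (tau : R) : R :=
  (phi (z.1, tau) - phi z) / (tau - z.2).

Definition time_filter (R : realType) (T t : R) :=
  within [set tau : R | tau <= T] (t^').

Definition Dt (R : realType) (d : nat) (T : R) (phi : 'rV[R]_d * R -> R)
  (z : 'rV[R]_d * R) : R :=
  lim (time_quotient phi z @ time_filter T z.2).

Definition Dx (R : realType) (d : nat) (i : 'I_d) (phi : 'rV[R]_d * R -> R)
  (z : 'rV[R]_d * R) : R :=
  'D_(evec R i) (fun x => phi (x, z.2)) z.1.

Definition x_derivable (R : realType) (d : nat) (i : 'I_d)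
  (phi : 'rV[R]_d * R -> R) (z : 'rV[R]_d * R) : Prop :=
  derivable (fun x => phi (x, z.2)) z.1 (evec R i).

(* C^2 in space and C^1 in time, the derivatives being jointly continuous on the
   cylinder; only the values of [phi] on the cylinder matter. *)
Definition C2_cylinder (R : realType) (d : nat) (x0 : 'rV[R]_d) (t0 r : R)
    (phi : 'rV[R]_d * R -> R) : Prop :=
  let Q := cylinder x0 t0 r in
  [/\ {within Q, continuous phi},
      (forall z, Q z -> cvg (time_quotient phi z @ time_filter t0 z.2)) /\
        {within Q, continuous (Dt t0 phi)},
      forall i, (forall z, Q z -> x_derivable i phi z) /\
        {within Q, continuous (Dx i phi)} &
      forall i j, (forall z, Q z -> x_derivable j (Dx i phi) z) /\
        {within Q, continuous (Dx j (Dx i phi))}].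

(* The principal value is the limit of the integrals outside the balls
   B_eps(x), as an extended real: it is infinite when the integral diverges
   away from x, which happens for test functions that are unbounded near the
   lateral boundary of their cylinder. *)
Definition frac_pLaplacian (R : realType) (d : nat) (s p : R)
    (w : 'rV[R]_d -> R) (x : 'rV[R]_d) : \bar R :=
  lim ((\int[lebesgue_rV R d]_(y in ~` eball x eps)
         (`|w x - w y| `^ (p - 2) * (w x - w y) /
          enorm (x - y) `^ (d%:R + s * p))%:E)%E @[eps --> 0^'+]).

Definition glued (R : realType) (d : nat) (x0 : 'rV[R]_d) (t0 r : R)
    (phi u : 'rV[R]_d * R -> R) : 'rV[R]_d * R -> R :=
  patch u (cylinder x0 t0 r) phi.

Definition test_operator (R : realType) (d : nat) (s p : R)
    (x0 : 'rV[R]_d) (t0 r : R) (phi u : 'rV[R]_d * R -> R) : \bar R :=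
  ((Dt t0 phi (x0, t0))%:E +
   frac_pLaplacian s p (fun x => glued x0 t0 r phi u (x, t0)) x0)%E.

Definition viscosity_subsolution (R : realType) (d : nat) (s p : R)
    (Omega : set 'rV[R]_d) (t1 t2 : R) (u : 'rV[R]_d * R -> R) : Prop :=
  let D := Omega `*` `]t1, t2]%classic in
  [/\ USC D u,
      Cloc_tail s p t1 t2 u &
      forall (x0 : 'rV[R]_d) (t0 r : R) (phi : 'rV[R]_d * R -> R),
        0 < r -> cylinder x0 t0 r `<=` D -> C2_cylinder x0 t0 r phi ->
        phi (x0, t0) = u (x0, t0) ->
        (forall z, cylinder x0 t0 r z -> u z <= phi z) ->
        (test_operator s p x0 t0 r phi u <= 0)%E].

Definition viscosity_supersolution (R : realType) (d : nat) (s p : R)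
    (Omega : set 'rV[R]_d) (t1 t2 : R) (u : 'rV[R]_d * R -> R) : Prop :=
  let D := Omega `*` `]t1, t2]%classic in
  [/\ LSC D u,
      Cloc_tail s p t1 t2 u &
      forall (x0 : 'rV[R]_d) (t0 r : R) (phi : 'rV[R]_d * R -> R),
        0 < r -> cylinder x0 t0 r `<=` D -> C2_cylinder x0 t0 r phi ->
        phi (x0, t0) = u (x0, t0) ->
        (forall z, cylinder x0 t0 r z -> phi z <= u z) ->
        (0 <= test_operator s p x0 t0 r phi u)%E].

(* Main.v *)
From HB Require Import structures.
Require Import Defs.
From mathcomp Require Import all_boot all_order all_algebra.
From mathcomp Require Import all_classical all_reals all_analysis.
From mathcomp Require Import measurable_realfun.
From mathcomp Require Import ring lra.
Import Order.TTheory GRing.Theory Num.Theory.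
Import numFieldNormedType.Exports.
Local Open Scope classical_set_scope.
Local Open Scope ring_scope.
Set Implicit Arguments.
Unset Strict Implicit.

(** Doubling the variables at a maximum of [v - u] fails here: nothing orders
    [v] and [u] on the corner [boundary Omega] times [t1], and the maximum may
    sit there.  The corner is however negligible in measure, so the order is
    first propagated in L1, and then turned into a pointwise one.

    Let [V] and [U] be the sup-convolutions of [v] and [- u] in space and time,
    with penalization [N], and [w = V + U], so that [v - u <= w].  At every
    point [(x, t)], and not only at maxima of [w], the points [z1] and [z2] where
    the two suprema are attained carry paraboloids that touch [v] from above and
    [u] from below.  Where [w] is at least [kappa > 0] and [t] stays away from
    [t1], the lateral order and compactness keep [z1] and [z2] close to [(x, t)]
    and at a fixed distance from the complement of [Omega] ([localize]).
    Subtracting the two viscosity inequalities gives, up to an error [e],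
    an upper bound for the slopes in time of [V] and [U] plus the nonlocal
    difference of [V] and [- U] at [(x, t)] ([doubled_inequality]).  The errors
    have three sources: the paraboloids inside their cylinder contribute little
    because the cylinder is small ([test_paraboloid]); the exterior values are
    ordered at almost every time and continuous in time in the tail space
    ([exterior]); and [Omega] seen from [z1] and from [z2] differs by a
    thin strip ([inner_compare]).

    Integrate this inequality over the set where [w > kappa].  The nonlocal terms
    between its points are antisymmetric and cancel ([antisym_integral]), those
    towards the outside have a sign, and no differentiability in time is needed,
    since a sup-convolution bounds its own backward increments
    ([supconv_step]).  Hence the integral of the positive part of [w - kappa]
    grows at most by a multiple of [e] ([mass_bound]); it is small at a time close
    to [t1] because [w > kappa] then only happens in a thin strip along the
    boundary ([mass_initial]).  So [w > 2 kappa] has small measure at all later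
    times.

    Finally compare [w] with a level that is affine in time.  At a maximum of the
    difference, [w] drops by [kappa] on most of a small ball of radius [r1], so the
    nonlocal difference is at least a multiple of [r1 ^ (- s p)] ([gain]), which
    exceeds the slope of the level when [r1] is small ([gain_radius]). *)

(** * The odd power nonlinearity *)

Definition spow (R : realType) (p a : R) : R := `|a| `^ (p - 2) * a.

Section SignedPower.
Variables (R : realType) (p : R).
Hypothesis p_gt2 : 2 < p.

Lemma powR_pred (a : R) : 0 <= a -> a `^ (p - 2) * a = a `^ (p - 1).
Proof.
move=> a0; rewrite mulrC -(@mulr_powRB1 _ a (p - 1)) //; last by have := p_gt2; lra.
by congr (a * a `^ _); lra.
Qed.

Lemma normr_spow (a : R) : `|spow p a| = `|a| `^ (p - 1).
Proof. by rewrite /spow normrM (ger0_norm (powR_ge0 _ _)) powR_pred. Qed.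

Lemma spowN (a : R) : spow p (- a) = - spow p a.
Proof. by rewrite /spow normrN mulrN. Qed.

Lemma spow_ge0 (a : R) : 0 <= a -> 0 <= spow p a.
Proof. by move=> a0; rewrite mulr_ge0 // powR_ge0. Qed.

Lemma spow_pos (a : R) : 0 <= a -> spow p a = a `^ (p - 1).
Proof. by move=> a0; rewrite /spow ger0_norm // powR_pred. Qed.

Lemma spow_neg (a : R) : a <= 0 -> spow p a = - (- a) `^ (p - 1).
Proof. by move=> a0; rewrite -{1}[a]opprK spowN spow_pos // oppr_ge0. Qed.

Let pm1 : 0 <= p - 1. Proof. by have := p_gt2; lra. Qed.
Let pm2 : 0 <= p - 2. Proof. by have := p_gt2; lra. Qed.

Lemma powR_superadd (a b : R) : 0 <= a -> 0 <= b ->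
  a `^ (p - 1) + b `^ (p - 1) <= (a + b) `^ (p - 1).
Proof.
move=> a0 b0; rewrite -!powR_pred ?addr_ge0 // mulrDr lerD //.
  by rewrite ler_wpM2r // ge0_ler_powR // ?nnegrE ?addr_ge0 // lerDl.
by rewrite ler_wpM2r // ge0_ler_powR // ?nnegrE ?addr_ge0 // lerDr.
Qed.

Lemma powR_add_le (a b : R) : 0 <= a -> 0 <= b ->
  (a + b) `^ (p - 1) <= 2 `^ (p - 1) * (a `^ (p - 1) + b `^ (p - 1)).
Proof.
move=> a0 b0; wlog ab : a b a0 b0 / a <= b.
  move=> H; have [/H|/ltW /H] := leP a b; first exact.
  by rewrite (addrC b) (addrC (b `^ _)); exact.
apply: (@le_trans _ _ ((2 * b) `^ (p - 1))).
  by rewrite ge0_ler_powR // ?nnegrE ?addr_ge0 // ?mulr_ge0 //; lra.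
by rewrite powRM // ler_wpM2l ?powR_ge0 // lerDr powR_ge0.
Qed.

(** The worst case is [a = - k / 2], where the two halves of the jump
    contribute equally; for [a] of constant sign superadditivity is enough. *)
Lemma spow_gain (a k : R) : 0 <= k ->
  spow p a + 2^-1 `^ (p - 1) * k `^ (p - 1) <= spow p (a + k).
Proof.
move=> k0.
have h0 : 0 <= (2^-1 : R) by lra.
have hk : 2^-1 `^ (p - 1) * k `^ (p - 1) = (k / 2) `^ (p - 1).
  by rewrite -powRM // mulrC.
have hk1 : (k / 2) `^ (p - 1) <= k `^ (p - 1).
  by rewrite ge0_ler_powR // ?nnegrE //; lra.
have [a0|a0] := leP 0 a.
  rewrite hk !spow_pos ?addr_ge0 //.
  by apply: le_trans (powR_superadd a0 k0); rewrite lerD2l.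
have [ak|ak] := leP (a + k) 0.
  rewrite hk (spow_neg ak) (spow_neg (ltW a0)).
  have := @powR_superadd (- (a + k)) k _ k0; rewrite oppr_ge0 => /(_ ak).
  rewrite (_ : - (a + k) + k = - a); [|ring]; lra.
rewrite hk (spow_neg (ltW a0)) (spow_pos (ltW ak)).
have [h|h] := leP (k / 2) (a + k).
  have : (k / 2) `^ (p - 1) <= (a + k) `^ (p - 1).
    by rewrite ge0_ler_powR // ?nnegrE //; lra.
  have := powR_ge0 (- a) (p - 1); lra.
have : (k / 2) `^ (p - 1) <= (- a) `^ (p - 1).
  by rewrite ge0_ler_powR // ?nnegrE //; lra.
have := powR_ge0 (a + k) (p - 1); lra.
Qed.

Lemma spow_le (a b : R) : a <= b -> spow p a <= spow p b.
Proof.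
move=> ab; have := @spow_gain a (b - a); rewrite subr_ge0 => /(_ ab).
rewrite subrKC; apply: le_trans.
by rewrite lerDl mulr_ge0 ?powR_ge0.
Qed.

Lemma bernoulli_le (r : R) (n : nat) : 0 <= r <= 1 -> 1 - r ^+ n <= n%:R * (1 - r).
Proof.
move=> /andP[r0 r1]; elim: n => [|n IH]; first by rewrite expr0 mul0r subrr.
have rn : 0 <= r ^+ n <= 1 by rewrite exprn_ge0 // exprn_ile1.
rewrite exprS -natr1; nra.
Qed.

(** Comparing the real exponent with a larger integer reduces the claim to
    Bernoulli's inequality. *)
Lemma spow_lip : exists2 N : R, 0 <= N &
  forall a b, `|spow p a - spow p b| <= N * (`|a| + `|b|) `^ (p - 2) * `|a - b|.
Proof.
have [n pn] : exists n : nat, p - 1 <= n%:R.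
  by exists (Num.truncn (p - 1)).+1; exact/ltW/truncnS_gt.
have n1 : 1 <= n%:R :> R by apply: le_trans pn; have := p_gt2; lra.
exists n%:R; first exact: ler0n.
move=> a b; wlog ba : a b / `|b| <= `|a|.
  move=> H; have [/H//|/ltW /H] := leP `|b| `|a|.
  by rewrite (distrC (spow p b)) (addrC `|b|) (distrC b).
wlog a0 : a b ba / 0 <= a.
  move=> H; have [/H|a0] := leP 0 a; first exact.
  have := H (- a) (- b); rewrite !normrN => /(_ ba); rewrite oppr_ge0.
  move=> /(_ (ltW a0)); rewrite !spowN -!opprD !normrN.
  exact.
have [b0|b0] := leP 0 b; last first.
  have nb : 0 <= - b by lra.
  have sb : 0 <= (- b) `^ (p - 1) by exact: powR_ge0.
  rewrite (spow_neg (ltW b0)) (spow_pos a0) opprK (ger0_norm a0) (ltr0_norm b0).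
  rewrite !ger0_norm ?addr_ge0 ?powR_ge0 //.
  apply: (le_trans (powR_superadd a0 nb)).
  rewrite -(powR_pred (addr_ge0 a0 nb)) -mulrA ler_peMl // mulr_ge0 ?powR_ge0 //.
  exact: addr_ge0.
rewrite (ger0_norm a0) (ger0_norm b0) in ba *.
have [an0|an0] := eqVneq a 0.
  have -> : b = 0 by apply/eqP; rewrite eq_le b0 andbT -an0.
  by rewrite an0 !subrr !normr0 mulr0.
have ap : 0 < a by rewrite lt_neqAle eq_sym an0.
have r01 : 0 <= b / a <= 1 by rewrite divr_ge0 // ler_pdivrMr // mul1r.
have be : (b / a) ^+ n * a `^ (p - 1) <= b `^ (p - 1).
  have {2}-> : b = b / a * a by rewrite divfK.
  rewrite powRM //; last by case/andP: r01.
  rewrite ler_wpM2r ?powR_ge0 // -powR_mulrn; last by case/andP: r01.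
  have [->|r0] := eqVneq (b / a) 0; first by rewrite !powR0 //; rewrite gt_eqF //; have := p_gt2; lra.
  by apply: ger_powR => //; case/andP: r01 => h1 ->; rewrite lt_neqAle eq_sym r0 h1.
rewrite !spow_pos // !ger0_norm ?subr_ge0 //; last first.
  by rewrite ge0_ler_powR.
apply: (@le_trans _ _ (n%:R * a `^ (p - 2) * (a - b))); last first.
  rewrite ler_wpM2r ?subr_ge0 // ler_wpM2l // ge0_ler_powR // ?nnegrE ?addr_ge0 //.
  by rewrite lerDl.
have := bernoulli_le n r01; rewrite -(ler_pM2r (powR_gt0 (p - 1) ap)).
have -> : n%:R * (1 - b / a) * a `^ (p - 1) = n%:R * a `^ (p - 2) * (a - b).
  by rewrite -powR_pred //; field.
by move: be; lra.
Qed.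

(** If [|a - b|] is small compared with [|b|] the Lipschitz bound gives the first
    term, otherwise [|a|] and [|b|] are both controlled by [|a - b|]. *)
Lemma spow_split (dl : R) : 0 < dl -> exists2 C : R, 0 <= C &
  forall a b, `|spow p a - spow p b| <= dl * `|b| `^ (p - 1) + C * `|a - b| `^ (p - 1).
Proof.
move=> dl0; have [N N0 HN] := spow_lip.
pose M := N * 3 `^ (p - 2).
have M0 : 0 <= M by rewrite mulr_ge0 ?powR_ge0.
pose th := Num.min 1 (dl / (M + 1)).
have th0 : 0 < th by rewrite lt_min ltr01 divr_gt0 //; lra.
have th1 : th <= 1 by rewrite ge_min lexx.
have thM : M * th <= dl.
  apply: (@le_trans _ _ ((M + 1) * (dl / (M + 1)))).
    by apply: ler_pM => //; [exact: ltW|lra|rewrite ge_min lexx orbT].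
  by rewrite mulrC divfK // gt_eqF //; lra.
pose C := N * (1 + 2 / th) `^ (p - 2).
exists C; first by rewrite mulr_ge0 ?powR_ge0.
move=> a b; apply: (le_trans (HN a b)).
have [ab|ab] := leP `|a - b| (th * `|b|).
  apply: (@le_trans _ _ (dl * `|b| `^ (p - 1))); last first.
    by rewrite lerDl mulr_ge0 ?powR_ge0 // mulr_ge0 ?powR_ge0.
  have hab : `|a| + `|b| <= 3 * `|b|.
    have := ler_normD (a - b) b; rewrite subrK.
    have : th * `|b| <= `|b| by rewrite ler_piMl.
    by lra.
  apply: (@le_trans _ _ (N * (3 * `|b|) `^ (p - 2) * (th * `|b|))).
    apply: ler_pM => //; first by rewrite mulr_ge0 ?powR_ge0.
    by rewrite ler_wpM2l // ge0_ler_powR // ?nnegrE ?addr_ge0 ?mulr_ge0.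
  rewrite powRM // -[in X in _ <= X](@powR_pred `|b|) //.
  rewrite (_ : _ * _ = M * th * (`|b| `^ (p - 2) * `|b|)); last by rewrite /M; ring.
  by rewrite ler_wpM2r // mulr_ge0 ?powR_ge0.
apply: (@le_trans _ _ (C * `|a - b| `^ (p - 1))); last first.
  by rewrite lerDr mulr_ge0 ?powR_ge0 // ltW.
have hab : `|a| + `|b| <= (1 + 2 / th) * `|a - b|.
  have := ler_normD (a - b) b; rewrite subrK.
  have : `|b| <= `|a - b| / th by rewrite ler_pdivlMr // mulrC ltW.
  by rewrite mulrDl mul1r mulrAC -mulrA; lra.
have t0 : 0 <= 1 + 2 / th by rewrite addr_ge0 // divr_ge0 // ltW.
apply: (@le_trans _ _ (N * ((1 + 2 / th) * `|a - b|) `^ (p - 2) * `|a - b|)).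
  by rewrite ler_wpM2r // ler_wpM2l // ge0_ler_powR // ?nnegrE ?addr_ge0 ?mulr_ge0.
by rewrite powRM // -(@powR_pred `|a - b|) // /C !mulrA.
Qed.

End SignedPower.

(** * The Euclidean norm *)

Definition dotp (R : realType) (d : nat) (x y : 'rV[R]_d) : R :=
  \sum_i x ord0 i * y ord0 i.

Section EuclideanNorm.
Variables (R : realType) (d : nat).
Implicit Types x y z : 'rV[R]_d.

Lemma enorm_ge0 x : 0 <= enorm x.
Proof. exact: sqrtr_ge0. Qed.

Lemma sqr_enorm x : enorm x ^+ 2 = \sum_i x ord0 i ^+ 2.
Proof. by rewrite sqr_sqrtr // sumr_ge0 // => i _; rewrite sqr_ge0. Qed.

Lemma enorm0 : enorm (0 : 'rV[R]_d) = 0.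
Proof.
rewrite /enorm big1 ?sqrtr0 // => i _; by rewrite mxE expr0n.
Qed.

Lemma enormN x : enorm (- x) = enorm x.
Proof. by congr Num.sqrt; apply: eq_bigr => i _; rewrite mxE sqrrN. Qed.

Lemma enormB x y : enorm (x - y) = enorm (y - x).
Proof. by rewrite -enormN opprB. Qed.

Lemma sqr_enormD x y :
  enorm (x + y) ^+ 2 = enorm x ^+ 2 + 2 * dotp x y + enorm y ^+ 2.
Proof.
rewrite !sqr_enorm /dotp mulr_sumr -!big_split /=; apply: eq_bigr => i _.
by rewrite mxE sqrrD mulr_natl.
Qed.

Lemma dotpNr x y : dotp x (- y) = - dotp x y.
Proof. by rewrite /dotp -sumrN; apply: eq_bigr => i _; rewrite mxE mulrN. Qed.

Lemma cauchy_schwarz x y : `|dotp x y| <= enorm x * enorm y.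
Proof.
suff H : dotp x y ^+ 2 <= (enorm x * enorm y) ^+ 2.
  rewrite -(ler_pXn2r (n := 2)) // ?nnegrE ?normr_ge0 ?mulr_ge0 ?enorm_ge0 //.
  by rewrite -normrX ger0_norm // sqr_ge0.
rewrite exprMn !sqr_enorm.
have := @sumr_ge0 R 'I_d (index_enum _) predT (fun i => \sum_j
   (x ord0 i * y ord0 j - x ord0 j * y ord0 i) ^+ 2).
have S0 i : true -> 0 <= \sum_j (x ord0 i * y ord0 j - x ord0 j * y ord0 i) ^+ 2.
  by move=> _; apply: sumr_ge0 => j _; exact: sqr_ge0.
move=> /(_ (fun i => S0 i)).
suff -> : \sum_i \sum_j (x ord0 i * y ord0 j - x ord0 j * y ord0 i) ^+ 2 =
  2 * ((\sum_i x ord0 i ^+ 2) * (\sum_i y ord0 i ^+ 2) - dotp x y ^+ 2).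
  by rewrite pmulr_rge0 // subr_ge0.
pose P i j := x ord0 i ^+ 2 * y ord0 j ^+ 2.
pose Q i j := (x ord0 i * y ord0 i) * (x ord0 j * y ord0 j).
have -> : \sum_i \sum_j (x ord0 i * y ord0 j - x ord0 j * y ord0 i) ^+ 2 =
  \sum_i \sum_j P i j + \sum_i \sum_j P j i - 2 * \sum_i \sum_j Q i j.
  rewrite mulr_sumr -big_split -sumrB /=; apply: eq_bigr => i _.
  rewrite mulr_sumr -big_split -sumrB /=; apply: eq_bigr => j _.
  by rewrite /P /Q; ring.
have -> : \sum_i \sum_j P j i = \sum_i \sum_j P i j by rewrite exchange_big.
have -> : \sum_i \sum_j P i j = (\sum_i x ord0 i ^+ 2) * (\sum_i y ord0 i ^+ 2).
  by rewrite mulr_suml; apply: eq_bigr => i _; rewrite mulr_sumr.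
have -> : \sum_i \sum_j Q i j = dotp x y ^+ 2.
  by rewrite expr2 /dotp mulr_suml; apply: eq_bigr => i _; rewrite mulr_sumr.
ring.
Qed.

Lemma enorm_triangle x y : enorm (x + y) <= enorm x + enorm y.
Proof.
rewrite -(ler_pXn2r (n := 2)) // ?nnegrE ?addr_ge0 ?enorm_ge0 //.
have := cauchy_schwarz x y; have := ler_norm (dotp x y).
by rewrite sqr_enormD sqrrD mulr2n; lra.
Qed.

Lemma enorm_dist x y : `|enorm x - enorm y| <= enorm (x - y).
Proof.
rewrite ler_norml; apply/andP; split.
  have := enorm_triangle (y - x) x; rewrite subrK enormB; lra.
by have := enorm_triangle (x - y) y; rewrite subrK; lra.
Qed.

Lemma coord_le_enorm x i : `|x ord0 i| <= enorm x.
Proof.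
rewrite -(ler_pXn2r (n := 2)) // ?nnegrE ?enorm_ge0 //.
rewrite sqr_enorm -normrX ger0_norm ?sqr_ge0 // (bigD1 i) //= lerDl.
by apply: sumr_ge0 => j _; exact: sqr_ge0.
Qed.

Lemma enorm_le_sum x : enorm x <= \sum_i `|x ord0 i|.
Proof.
have s0 : 0 <= \sum_i `|x ord0 i| by exact: sumr_ge0.
rewrite -(ler_pXn2r (n := 2)) // ?nnegrE ?enorm_ge0 //.
rewrite sqr_enorm expr2 mulr_suml ler_sum // => i _.
rewrite -[x ord0 i ^+ 2]ger0_norm ?sqr_ge0 // expr2 normrM ler_wpM2l //.
by rewrite (bigD1 i) //= lerDl sumr_ge0.
Qed.

Lemma norm_le_enorm x : `|x| <= enorm x.
Proof.
rewrite [`|x|]mx_normrE; apply: bigmax_le; first exact: enorm_ge0.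
by move=> [i j] _ /=; rewrite (ord1 i); exact: coord_le_enorm.
Qed.

Lemma enorm_le_norm x : enorm x <= d%:R * `|x|.
Proof.
apply: (le_trans (enorm_le_sum x)).
rewrite -[d in d%:R]card_ord -sum1_card natr_sum mulr_suml ler_sum // => i _.
rewrite mul1r [`|x|]mx_normrE.
exact: (le_bigmax _ (fun k : 'I_1 * 'I_d => `|x k.1 k.2|) (ord0, i)).
Qed.

Lemma nbhs_eball x (r : R) : 0 < r -> nbhs x (eball x r).
Proof.
move=> r0; have d0 : 0 < d%:R + 1 :> R by rewrite ltr_wpDl.
have: nbhs x (ball x (r / (d%:R + 1))) by apply: nbhsx_ballx; rewrite divr_gt0.
apply: filterS => y; rewrite -ball_normE /= /eball /= => xy.
apply: (le_lt_trans (enorm_le_norm _)).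
apply: (@le_lt_trans _ _ ((d%:R + 1) * `|y - x|)); first by rewrite ler_wpM2r // lerDl.
by rewrite mulrC -ltr_pdivlMr // distrC.
Qed.

Lemma enorm_continuous : continuous (@enorm R d).
Proof.
move=> x; apply/(@cvgrPdist_lt _ _ _ _ (nbhs_filter x)) => e e0.
apply: filterS (nbhs_eball x e0) => y; rewrite /eball /= => xy.
by apply: le_lt_trans xy; rewrite distrC enorm_dist.
Qed.

Lemma nbhs_eballP x (A : set 'rV[R]_d) : nbhs x A ->
  exists2 r : R, 0 < r & eball x r `<=` A.
Proof.
move=> /nbhs_ballP[r r0 rA]; exists r => // y; rewrite /eball /= => xy.
apply: rA; rewrite -ball_normE /= distrC; exact: le_lt_trans (norm_le_enorm _) xy.
Qed.

Lemma open_eball x (r : R) : open (eball x r).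
Proof.
rewrite openE => y; rewrite /eball /= => yr; rewrite /interior.
have : nbhs y (eball y (r - enorm (y - x))) by apply: nbhs_eball; rewrite subr_gt0.
apply: filterS => z; rewrite /eball /= => zy.
by have := enorm_triangle (z - y) (y - x); rewrite addrA subrK; lra.
Qed.

End EuclideanNorm.

(** * Lebesgue measure on row vectors *)

Section LebesgueRV.
Variables (R : realType) (d : nat).
Local Notation mu := (lebesgue_rV R d).
Local Notation T := 'rV[R]_d.

Lemma measurable_coord (i : 'I_d) : measurable_fun setT (fun x : T => x ord0 i).
Proof. exact: measurable_rV_coord. Qed.

Definition boxes : set (set T) :=
  [set A | exists2 B : 'I_d -> set (measurableTypeR R),
    forall i, measurable (B i) & A = [set x : T | forall i, B i (x ord0 i)]].

Lemma measurable_boxes A : boxes A -> measurable A.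
Proof.
move=> [B mB ->]; rewrite (_ : mkset _ = \bigcap_(i in [set: 'I_d])
    (@rV_coord R d i @^-1` B i)); last first.
  by apply/seteqP; split=> [x Bx i _|x Bx i]; [exact: Bx|exact: (Bx i)].
apply: fin_bigcap_measurable => // i _; rewrite -[X in measurable X]setTI.
exact: measurable_rV_coord.
Qed.

Lemma setI_closed_boxes : setI_closed boxes.
Proof.
move=> _ _ [B mB ->] [C mC ->]; exists (fun i => B i `&` C i).
  by move=> i; exact: measurableI.
by apply/seteqP; split=> x /= => [[xB xC] i|H]; [split|split=> i; case: (H i)].
Qed.

Lemma measurable_gen_boxes : measurable = <<s boxes >>.
Proof.
apply/seteqP; split=> A; last first.
  have : <<s boxes >> `<=` (measurable : set (set T)) by
    apply: smallest_sub; [exact: sigma_algebra_measurable|exact: measurable_boxes].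
  exact.
rewrite /measurable /=; apply: smallest_sub; first exact: smallest_sigma_algebra.
rewrite -bigcup_seq => B [i _ [C mC <-]]; apply: sub_sigma_algebra.
exists (fun j => if j == i then C else setT).
  by move=> j; case: ifP.
rewrite setTI; apply/seteqP; split=> x /=.
  by move=> Cx j; case: ifPn => // /eqP ->.
by move=> /(_ i); rewrite eqxx.
Qed.

Definition cube (r : R) : set T := [set x | forall i, `](- r), r[%classic (x ord0 i)].

Lemma cube_boxes r : boxes (cube r).
Proof. by exists (fun=> `](- r), r[%classic). Qed.

Lemma measurable_cube r : measurable (cube r).
Proof. exact: (measurable_boxes (cube_boxes r)). Qed.

Lemma lebesgue_cube (r : R) : 0 < r -> mu (cube r) = ((2 * r) ^+ d)%:E.
Proof.
move=> r0; rewrite (@lebesgue_rV_box R d (fun=> `](- r), r[%classic)) //.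
rewrite (eq_bigr (fun=> (2 * r)%:E)); last first.
  move=> i _; rewrite lebesgue_measure_itv /= lte_fin gtrN // -EFinB.
  by congr (_%:E); ring.
by rewrite prodEFin prodr_const card_ord.
Qed.

Lemma eball_cube (r : R) : eball 0 r `<=` cube r.
Proof.
move=> x; rewrite /eball /= subr0 => xr i; rewrite /= in_itv /= -ltr_norml.
exact: le_lt_trans (coord_le_enorm _ _) xr.
Qed.

Lemma cube_cover : \bigcup_k (cube k.+1%:R) = setT.
Proof.
apply/seteqP; split=> // x _; exists (Num.truncn (enorm x)) => //.
by apply: eball_cube; rewrite /eball /= subr0 truncnS_gt.
Qed.

Lemma lebesgue_rV_sigma_finite : sigma_finite setT mu.
Proof.
exists (fun k => cube k.+1%:R); first by rewrite cube_cover.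
by move=> k; split; [exact: measurable_cube|rewrite lebesgue_cube ?ltry].
Qed.

Lemma lebesgue_translation1 (a : R) (A : set (measurableTypeR R)) :
  measurable A -> lebesgue_measure ((fun y => a + y) @^-1` A) = lebesgue_measure A.
Proof.
have mf : measurable_fun setT ((fun y => a + y) : measurableTypeR R -> measurableTypeR R).
  exact: measurable_funD.
pose m := measure_function_pushforward__canonical__measure_function_Measure
  (@lebesgue_measure R) mf.
move=> mA; apply/esym.
apply: (@lebesgue_measure_unique R m _ _ mA) => _ [[x y] /= _ <-].
rewrite /m /= /pushforward (_ : _ @^-1` _ = `](x - a), (y - a)]%classic).
  rewrite !lebesgue_measure_itv /= !lte_fin ltrD2r; case: ifP => // _.
  by rewrite -!EFinB; congr (_%:E); ring.
by apply/seteqP; split => z /=; rewrite !in_itv /= ltrBlDl lerBrDl.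
Qed.

Lemma lebesgue_affine1 (b : bool) (a : R) (A : set (measurableTypeR R)) :
  measurable A ->
  lebesgue_measure ((fun y => a + (-1) ^+ b * y) @^-1` A) = lebesgue_measure A.
Proof.
move=> mA; rewrite -[RHS](lebesgue_translation1 a mA).
case: b; last by congr lebesgue_measure; apply/funext => y /=; rewrite mul1r.
have mf : measurable_fun setT ((fun y => a + y) : measurableTypeR R -> measurableTypeR R).
  exact: measurable_funD.
rewrite -[RHS]lebesgue_measureN; last by rewrite -[X in measurable X]setTI; exact: mf.
by congr lebesgue_measure; apply/funext => y /=; rewrite mulN1r.
Qed.

(** Translations, and for [b = true] also the reflections. *)
Definition affine (b : bool) (a y : T) : T := a + (-1) ^+ b *: y.

Lemma measurable_affine b a : measurable_fun setT (affine b a).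
Proof.
apply: measurable_fun_rVP => i.
rewrite (_ : _ \o _ = fun y : T => a ord0 i + (-1) ^+ b * y ord0 i).
  apply: measurable_funD => //; apply: measurable_funM => //.
  exact: measurable_coord.
by apply/funext => y; rewrite /rV_coord /affine /= !mxE.
Qed.

Lemma lebesgue_affine b a (A : set T) : measurable A ->
  mu (affine b a @^-1` A) = mu A.
Proof.
pose m := measure_function_pushforward__canonical__measure_function_Measure
  mu (measurable_affine b a).
move=> mA; suff : m A = mu A by [].
apply: (measure_unique boxes (fun k => cube k.+1%:R)) => //.
- exact: measurable_gen_boxes.
- exact: setI_closed_boxes.
- by move=> i; exact: cube_boxes.
- exact: cube_cover.
- move=> _ [B mB ->]; rewrite /m /= /pushforward.
  rewrite (_ : _ @^-1` _ = [set x : T | forall i,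
      ((fun y => a ord0 i + (-1) ^+ b * y) @^-1` B i) (x ord0 i)]); last first.
    by apply/seteqP; split=> x /= H i; have := H i; rewrite /affine !mxE.
  rewrite (@lebesgue_rV_box R d B) //.
  rewrite (@lebesgue_rV_box R d (fun i => (fun y => a ord0 i + (-1) ^+ b * y) @^-1` B i)).
    by apply: eq_bigr => i _; rewrite lebesgue_affine1.
  move=> i; rewrite -[X in measurable X]setTI.
  have mf : measurable_fun setT ((fun y => a ord0 i + (-1) ^+ b * y)
      : measurableTypeR R -> measurableTypeR R).
    by apply: measurable_funD => //; apply: measurable_funM.
  exact: mf.
- move=> k; rewrite /m /= /pushforward.
  pose K : R := k.+1%:R + enorm a.
  have K0 : 0 < K by rewrite ltr_pwDl // ?enorm_ge0.
  apply: (@le_lt_trans _ _ (mu (cube K))); last by rewrite lebesgue_cube ?ltry.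
  apply: le_measure; rewrite ?inE; [|exact: measurable_cube|].
    by rewrite -[X in measurable X]setTI; apply: measurable_affine => //; exact: measurable_cube.
  move=> x /= xk i; have := xk i; rewrite /affine /= !in_itv /= -!ltr_norml !mxE => h.
  have := ler_normB (a ord0 i + (-1) ^+ b * x ord0 i) (a ord0 i).
  rewrite addrC addKr normrM normrX normrN1 expr1n mul1r.
  by have := coord_le_enorm a i; rewrite /K; lra.
Qed.

End LebesgueRV.

(** * Integrals of real functions *)

Notation integ mu f := (integrable mu setT (EFin \o f)).

Lemma indic_in (R : numDomainType) (X : Type) (B : set X) x : B x -> \1_B x = 1 :> R.
Proof. by move=> Bx; rewrite indicE mem_set. Qed.

Lemma indic_notin (R : numDomainType) (X : Type) (B : set X) x : ~ B x -> \1_B x = 0 :> R.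
Proof. by move=> Bx; rewrite indicE memNset. Qed.

Section RealIntegrals.
Context d (T : measurableType d) (R : realType).
Variable mu : {measure set T -> \bar R}.
Implicit Types f g : T -> R.

Lemma integ_meas f : integ mu f -> measurable_fun setT f.
Proof. by move=> /integrableP[/measurable_EFinP]. Qed.

Lemma integ_le f g : measurable_fun setT f -> integ mu g ->
  (forall x, `|f x| <= g x) -> integ mu f.
Proof.
move=> mf ig fg; apply: (le_integrable _ _ _ ig) => //; first exact/measurable_EFinP.
by move=> x _ /=; rewrite lee_fin (le_trans (fg x)) // ler_norm.
Qed.

Lemma integD f g : integ mu f -> integ mu g -> integ mu (fun x => f x + g x).
Proof. by move=> /integrableD H /H{}H; apply: eq_integrable (H measurableT). Qed.

Lemma integN f : integ mu f -> integ mu (fun x => - f x).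
Proof. by move=> /integrableN H; apply: eq_integrable H. Qed.

Lemma integB f g : integ mu f -> integ mu g -> integ mu (fun x => f x - g x).
Proof. by move=> If Ig; apply: integD => //; exact: integN. Qed.

Lemma integZ (k : R) f : integ mu f -> integ mu (fun x => k * f x).
Proof. by move=> /(@integrableZl _ _ _ _ _ measurableT k) H; apply: eq_integrable H. Qed.

Lemma integ_norm f : integ mu f -> integ mu (fun x => `|f x|).
Proof. by move=> /integrable_norm H; apply: eq_integrable H. Qed.

Lemma integ_indic f (A : set T) : measurable A -> integ mu f ->
  integ mu (fun x => \1_A x * f x).
Proof.
move=> mA If; apply: (@integ_le _ (fun x => `|f x|)).
- by apply: measurable_funM; [exact: measurable_indic|exact: integ_meas If].
- exact: integ_norm.
- by move=> x; rewrite normrM indicE; case: (_ \in _); rewrite ?normr1 ?mul1r ?normr0 ?mul0r.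
Qed.

Lemma integ_indicM (k : R) (A : set T) : measurable A -> (mu A < +oo)%E ->
  integ mu (fun x => k * \1_A x).
Proof.
move=> mA Afin; apply: integZ.
apply/integrableP; split; first by apply/measurable_EFinP; exact: measurable_indic.
rewrite (eq_integral (fun x => (\1_A x)%:E)); last first.
  by move=> x _ /=; rewrite ger0_norm.
by rewrite integral_indic // setIT.
Qed.

Lemma Rint_le f g : integ mu f -> integ mu g -> (forall x, f x <= g x) ->
  \int[mu]_x f x <= \int[mu]_x g x.
Proof. by move=> If Ig fg; apply: le_Rintegral. Qed.

Lemma RintD f g : integ mu f -> integ mu g ->
  \int[mu]_x (f x + g x) = \int[mu]_x f x + \int[mu]_x g x.
Proof. by move=> If Ig; rewrite RintegralD. Qed.

Lemma RintB f g : integ mu f -> integ mu g ->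
  \int[mu]_x (f x - g x) = \int[mu]_x f x - \int[mu]_x g x.
Proof. by move=> If Ig; rewrite RintegralB. Qed.

Lemma RintZ (k : R) f : integ mu f ->
  \int[mu]_x (k * f x) = k * \int[mu]_x f x.
Proof. by move=> If; rewrite RintegralZl. Qed.

Lemma RintN f : integ mu f -> \int[mu]_x (- f x) = - \int[mu]_x f x.
Proof.
move=> If; rewrite -mulN1r -RintZ //; apply: eq_Rintegral => x _.
by rewrite mulN1r.
Qed.

Lemma Rint_norm f : integ mu f -> `|\int[mu]_x f x| <= \int[mu]_x `|f x|.
Proof. by move=> If; apply: le_normr_Rintegral. Qed.

Lemma Rint_normB f g : integ mu f -> integ mu g ->
  `|\int[mu]_x f x - \int[mu]_x g x| <= \int[mu]_x `|f x - g x|.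
Proof. by move=> If Ig; rewrite -RintB //; exact/Rint_norm/integB. Qed.

Lemma Rint_indic (A : set T) : measurable A -> \int[mu]_x \1_A x = fine (mu A).
Proof. by move=> mA; rewrite /Rintegral integral_indic // setIT. Qed.

Lemma EFin_Rint f : integ mu f -> (\int[mu]_x f x)%:E = (\int[mu]_x (f x)%:E)%E.
Proof. by move=> If; rewrite fineK //; apply: integrable_fin_num. Qed.

(** Every point of the support of [f] lies in one of the sets [B k], on which
    [f] is bounded by [c k]; thus [f] is dominated by the sum of the [c k 1_(B k)]. *)
Lemma integral_geometric_cover f (B : nat -> set T) (c : nat -> R) (M rho : R) :
  measurable_fun setT f -> (forall x, 0 <= f x) ->
  (forall k, measurable (B k)) -> (forall k, 0 <= c k) ->
  0 <= M -> 0 <= rho < 1 ->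
  (forall k, ((c k)%:E * mu (B k) <= (M * rho ^+ k)%:E)%E) ->
  (forall x, 0 < f x -> exists2 k, B k x & f x <= c k) ->
  (\int[mu]_x (f x)%:E <= (M / (1 - rho))%:E)%E.
Proof.
move=> mf f0 mB c0 M0 /andP[r0 r1] HM Hf.
pose F k x := (c k * \1_(B k) x)%:E.
have mF k : measurable_fun setT (F k).
  by apply/measurable_EFinP; apply: measurable_funM => //; exact: measurable_indic.
have F0 k x : setT x -> (0 <= F k x)%E by move=> _; rewrite lee_fin mulr_ge0.
apply: (@le_trans _ _ (\int[mu]_x \sum_(k <oo) F k x)%E).
  apply: ge0_le_integral => //.
  - by move=> x _; rewrite lee_fin.
  - exact/measurable_EFinP.
  - by apply: ge0_emeasurable_sum => // k x _ _; exact: F0.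
  move=> x _; have [fx|fx] := leP (f x) 0.
    apply: (@le_trans _ _ 0%E); first by rewrite lee_fin.
    by apply: nneseries_ge0 => n _ _; exact: F0.
  have [k Bk fk] := Hf x fx.
  apply: (@le_trans _ _ (F k x)); first by rewrite lee_fin indicE mem_set // mulr1.
  rewrite (nneseriesD1 (n := k)) //; last by move=> n _; exact: F0.
  by rewrite leeDl // nneseries_ge0 // => n _ _; exact: F0.
rewrite integral_nneseries //.
apply: (@le_trans _ _ (\sum_(k <oo) (M * rho ^+ k)%:E)%E).
  apply: lee_nneseries => [k _ _|k _]; first by apply: integral_ge0 => x _; exact: F0.
  rewrite /F; under eq_integral do rewrite EFinM.
  rewrite ge0_integralZl_EFin ?integral_indic ?setIT //.
  by apply/measurable_EFinP; exact: measurable_indic.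
apply: lime_le; first by apply: is_cvg_nneseries => n _ _; rewrite lee_fin mulr_ge0 ?exprn_ge0.
apply: nearW => n; rewrite sumEFin lee_fin ler_pdivlMr ?subr_gt0 //.
apply: (@le_trans _ _ (M * (1 - rho ^+ n))); last first.
  by rewrite ler_piMr // gerBl exprn_ge0.
rewrite le_eqVlt; apply/orP; left; apply/eqP.
elim: n => [|n IH]; first by rewrite big_geq // mul0r expr0 subrr mulr0.
by rewrite big_nat_recr //= mulrDl IH exprS; ring.
Qed.

End RealIntegrals.

(** * Borel sets, balls and radial kernels *)

Section BorelRV.
Variables (R : realType) (d : nat).
Local Notation mu := (lebesgue_rV R d).
Local Notation T := 'rV[R]_d.

(** An open set is the union of the countably many rational boxes inside it. *)
Lemma open_measurable_rV (U : set T) : open U -> measurable U.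
Proof.
move=> oU.
pose Q (z : 'rV[rat]_d * nat) : set T := [set x : T | forall i,
  `](ratr (z.1 ord0 i) - z.2.+1%:R^-1), (ratr (z.1 ord0 i) + z.2.+1%:R^-1)[%classic
  (x ord0 i)].
have mQ z : measurable (Q z).
  apply: measurable_boxes; exists (fun i => `](ratr (z.1 ord0 i) - z.2.+1%:R^-1),
    (ratr (z.1 ord0 i) + z.2.+1%:R^-1)[%classic) => //.
have -> : U = \bigcup_(z in [set z | Q z `<=` U]) Q z.
  apply/seteqP; split=> [x Ux|x [z zU Qx]]; last exact: zU.
  have /nbhs_ballP[e /= e0 eU] : nbhs x U by move: oU; rewrite openE; exact.
  pose k := Num.truncn (2 / e).
  have k0 : 0 < k.+1%:R :> R by [].
  have ke : 2 * k.+1%:R^-1 < e.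
    by rewrite ltr_pdivrMr // mulrC -ltr_pdivrMr //; exact: truncnS_gt.
  have /choice[q Hq] : forall i, exists r : rat, x ord0 i - k.+1%:R^-1 < ratr r < x ord0 i + k.+1%:R^-1.
    move=> i; have : x ord0 i - k.+1%:R^-1 < x ord0 i + k.+1%:R^-1 :> R.
      by rewrite ltrD2l gtrN // invr_gt0.
    by move=> /rat_in_itvoo[r]; rewrite in_itv /= => rI; exists r.
  exists (\row_i q i, k) => /=; last first.
    move=> i; rewrite /= mxE in_itv /=; have /andP[] := Hq i.
    by set kk := k.+1%:R^-1 => h1 h2; apply/andP; split; lra.
  move=> y Qy; apply: eU; rewrite -ball_normE /= [`|_|]mx_normrE.
  apply: bigmax_lt => // -[i j] _ /=; rewrite (ord1 i) !mxE.
  have := Qy j; rewrite /= mxE in_itv /= => /andP[]; have /andP[] := Hq j.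
  have : 2 * k.+1%:R^-1 < e by [].
  set kk := k.+1%:R^-1 => he h1 h2 h3 h4; rewrite ltr_norml; apply/andP; split; lra.
rewrite bigcup_mkcond; apply: countable_bigcupT_measurable => //.
by move=> z; case: ifP.
Qed.

Lemma closed_measurable_rV (U : set T) : closed U -> measurable U.
Proof. by move=> cU; rewrite -[U]setCK; apply: measurableC; apply: open_measurable_rV; exact: closed_openC. Qed.

(** Semicontinuity is enough: the superlevel sets are open. *)
Lemma measurable_open_superlevel (f : T -> R) :
  (forall c, open [set x | c < f x]) -> measurable_fun setT f.
Proof.
move=> Hf mD; apply: (measurability _ (RGenOInfty.measurableE R)) => //.
move=> _ [_ [c ->] <-]; rewrite setTI preimage_itvoy.
exact: open_measurable_rV.
Qed.

Lemma measurable_enorm : measurable_fun setT (@enorm R d).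
Proof.
apply: measurable_open_superlevel => c; apply: (@open_comp _ _ (@enorm R d) [set y : R | c < y]).
  by move=> x _; exact: enorm_continuous.
exact: open_gt.
Qed.

Lemma measurable_eball x r : measurable (eball x r : set T).
Proof. by apply: open_measurable_rV; exact: open_eball. Qed.

Section Affine.
Variables (b : bool) (a : T).

Lemma integral_affine (f : T -> \bar R) : measurable_fun setT f ->
  (forall x, 0 <= f x)%E -> (\int[mu]_x f (affine b a x) = \int[mu]_x f x)%E.
Proof.
move=> mf f0.
have := @ge0_integral_pushforward _ _ _ _ R _ (measurable_affine b a) mu setT f
  measurableT mf (fun x _ => f0 x).
rewrite preimage_setT => <-.
apply: eq_measure_integral => [|m A mA _]; first exact: measurable_affine.
exact: lebesgue_affine.
Qed.

Lemma integ_affine (f : T -> R) : integ mu f -> integ mu (fun x => f (affine b a x)).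
Proof.
move=> /integrableP[mf fi]; have {}mf : measurable_fun setT f by exact/measurable_EFinP.
apply/integrableP; split.
  by apply/measurable_EFinP; apply: (measurableT_comp mf); exact: measurable_affine.
rewrite /= (@integral_affine (fun x => `|(f x)%:E|%E)) //.
by apply: measurableT_comp => //; exact/measurable_EFinP.
Qed.

Lemma Rint_affine (f : T -> R) : integ mu f ->
  \int[mu]_x f (affine b a x) = \int[mu]_x f x.
Proof.
move=> If; congr fine.
have mf := integ_meas If.
have := @integral_pushforward _ _ _ _ R _ (measurable_affine b a) mu setT (EFin \o f)
  ((measurable_EFinP _ _).2 mf).
rewrite preimage_setT => /(_ (integ_affine If) measurableT) <-.
apply: eq_measure_integral => [|m A mA _]; first exact: measurable_affine.
exact: lebesgue_affine.
Qed.

End Affine.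

Lemma integ_shift (a : T) (f : T -> R) : integ mu f -> integ mu (fun x => f (a + x)).
Proof.
move=> /(integ_affine false a); apply: eq_integrable => // x _ /=.
by rewrite /affine scale1r.
Qed.

Lemma Rint_shift (a : T) (f : T -> R) : integ mu f ->
  \int[mu]_x f (a + x) = \int[mu]_x f x.
Proof.
move=> If; rewrite -(Rint_affine false a If); apply: eq_Rintegral => x _.
by rewrite /affine scale1r.
Qed.

Lemma integ_opp (f : T -> R) : integ mu f -> integ mu (fun x => f (- x)).
Proof.
move=> /(integ_affine true 0); apply: eq_integrable => // x _ /=.
by rewrite /affine expr1 add0r scaleN1r.
Qed.

Lemma Rint_opp (f : T -> R) : integ mu f -> \int[mu]_x f (- x) = \int[mu]_x f x.
Proof.
move=> If; rewrite -(Rint_affine true 0 If); apply: eq_Rintegral => x _.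
by rewrite /affine expr1 add0r scaleN1r.
Qed.

Lemma lebesgue_eball_center x r : mu (eball x r) = mu (eball 0 r).
Proof.
rewrite -(lebesgue_affine false (- x) (measurable_eball 0 r)).
congr (mu _); apply/seteqP; split=> y; rewrite /eball /affine /= scale1r subr0 addrC //.
Qed.

Lemma lebesgue_eball_le x (r : R) : 0 < r -> (mu (eball x r) <= ((2 * r) ^+ d)%:E)%E.
Proof.
move=> r0; rewrite lebesgue_eball_center -lebesgue_cube //.
by apply: le_measure; rewrite ?inE; [exact: measurable_eball|exact: measurable_cube|exact: eball_cube].
Qed.

Lemma lebesgue_eball_ge x (r : R) : 0 < r ->
  (((2 * (r / d.+1%:R)) ^+ d)%:E <= mu (eball x r))%E.
Proof.
move=> r0; have c0 : 0 < r / d.+1%:R by rewrite divr_gt0.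
rewrite lebesgue_eball_center -lebesgue_cube //.
apply: le_measure; rewrite ?inE; [exact: measurable_cube|exact: measurable_eball|].
move=> y Qy; rewrite /eball /= subr0; apply: (le_lt_trans (enorm_le_sum _)).
apply: (@le_lt_trans _ _ (\sum_(i < d) r / d.+1%:R)).
  by apply: ler_sum => i _; have := Qy i; rewrite /= in_itv /= -ltr_norml => /ltW.
rewrite sumr_const card_ord -[X in X < _]mulr_natl mulrA ltr_pdivrMr // mulrC.
by rewrite ltr_pM2l // ltr_nat.
Qed.

Lemma lebesgue_eball_fin x r : (mu (eball x r) < +oo)%E.
Proof.
have [r0|r0] := ltP 0 r; first by apply: (le_lt_trans (lebesgue_eball_le x r0)); rewrite ltry.
rewrite (_ : eball x r = set0) ?measure0 //; apply/seteqP; split => // y.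
by rewrite /eball /=; have := enorm_ge0 (y - x); lra.
Qed.

Lemma enorm_eq0 (x : T) : enorm x = 0 -> x = 0.
Proof.
move=> x0; apply/rowP => i; rewrite mxE; apply/eqP.
by rewrite -normr_le0 -x0 coord_le_enorm.
Qed.

End BorelRV.

Section RadialKernels.
Variables (R : realType) (d : nat).
Local Notation mu := (lebesgue_rV R d).
Local Notation T := 'rV[R]_d.

Definition kern (q : R) (z : T) : R := (enorm z `^ q)^-1.

Lemma kern_ge0 q z : 0 <= kern q z.
Proof. by rewrite invr_ge0 powR_ge0. Qed.

Lemma kernN q z : kern q (- z) = kern q z.
Proof. by rewrite /kern enormN. Qed.

Lemma kernB q x y : kern q (x - y) = kern q (y - x).
Proof. by rewrite /kern enormB. Qed.

Lemma measurable_enorm_powR q : measurable_fun setT (fun z : T => enorm z `^ q).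
Proof. exact: (measurableT_comp (@measurable_powR R q) (@measurable_enorm R d)). Qed.

Lemma measurable_invr : measurable_fun setT (@GRing.inv R).
Proof.
rewrite (_ : @GRing.inv R = fun x => if x < 0 then - powR (- x) (-1) else powR x (-1)).
  apply: measurable_fun_ifT.
  - exact: measurable_fun_ltr.
  - apply: measurable_funN; apply: (measurableT_comp (@measurable_powR R (-1))).
    exact: measurable_funN.
  - exact: measurable_powR.
apply/funext => x; case: ltP => x0.
  by rewrite powR_inv1 ?oppr_ge0 ?(ltW x0) // invrN opprK.
by rewrite powR_inv1.
Qed.

Lemma measurable_kern q : measurable_fun setT (kern q).
Proof. exact: (measurableT_comp measurable_invr (measurable_enorm_powR q)). Qed.

Lemma powR_exprn (a b : R) (k : nat) : 0 <= a -> (a ^+ k) `^ b = (a `^ b) ^+ k.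
Proof. by move=> a0; rewrite -(powR_mulrn k a0) -(powR_mulrn k (powR_ge0 a b)) powRAC. Qed.

Lemma powRV (a b : R) : 0 <= a -> (a^-1) `^ b = (a `^ b)^-1.
Proof. by move=> a0; rewrite -powR_inv1 // powRAC powR_inv1 // powR_ge0. Qed.

Lemma dyadic_scale (y : R) : 1 <= y -> exists k : nat, 2 ^+ k <= y < 2 ^+ k.+1.
Proof.
move=> y1; have y0 : 0 <= y by apply: le_trans y1.
have n1 : (0 < Num.truncn y)%N by rewrite truncn_gt0.
have /andP[h1 h2] := @trunc_log_bounds 2 _ isT n1.
exists (trunc_log 2 (Num.truncn y)); apply/andP; split.
  by rewrite -natrX -truncn_ge_nat.
by rewrite -natrX -truncn_lt_nat.
Qed.

Lemma geometric_ratio (b : R) : 0 < b -> 0 <= (2 `^ b)^-1 < 1.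
Proof.
move=> b0; rewrite invr_ge0 powR_ge0 /= invf_lt1 ?powR_gt0 //.
have : 1 `^ b < 2 `^ b :> R by apply: gt0_ltr_powR; rewrite ?nnegrE // ltr1n.
by rewrite powR1.
Qed.

(** Splitting the ball into dyadic annuli gives a geometric series. *)
Lemma integral_near (b r : R) : 0 < b -> 0 < r ->
  (\int[mu]_z (\1_(eball 0 r) z * (enorm z `^ b / enorm z ^+ d))%:E <=
   (8 ^+ d * r `^ b / (1 - (2 `^ b)^-1))%:E)%E.
Proof.
move=> b0 r0.
pose c k := (r / 2 ^+ k) `^ b / (r / 2 ^+ k.+1) ^+ d.
apply: (@integral_geometric_cover _ _ _ _ _ (fun k => eball 0 (2 * (r / 2 ^+ k))) c).
- apply: measurable_funM; first (by apply: measurable_indic; exact: measurable_eball).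
  apply: measurable_funM; first exact: measurable_enorm_powR.
  apply: (measurableT_comp measurable_invr); apply: measurable_funX.
  exact: measurable_enorm.
- by move=> x; rewrite !mulr_ge0 ?powR_ge0 ?invr_ge0 ?exprn_ge0 ?enorm_ge0.
- by move=> k; exact: measurable_eball.
- by move=> k; rewrite mulr_ge0 ?powR_ge0 // invr_ge0 exprn_ge0 // divr_ge0 // ltW.
- by rewrite mulr_ge0 ?powR_ge0 // exprn_ge0.
- exact: geometric_ratio.
- move=> k.
  have ck : 0 <= c k by rewrite mulr_ge0 ?powR_ge0 // invr_ge0 exprn_ge0 // divr_ge0 // ltW.
  have rk : 0 < r / 2 ^+ k by rewrite divr_gt0 // exprn_gt0.
  apply: (@le_trans _ _ ((c k)%:E * ((2 * (2 * (r / 2 ^+ k))) ^+ d)%:E)%E).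
    by apply: lee_wpmul2l; [rewrite lee_fin|apply: lebesgue_eball_le; rewrite mulr_gt0].
  rewrite -EFinM lee_fin le_eqVlt; apply/orP; left; apply/eqP.
  have -> : 8 ^+ d * r `^ b * (2 `^ b)^-1 ^+ k = 8 ^+ d * (r / 2 ^+ k) `^ b.
    rewrite powRM ?powRV ?invr_ge0 ?exprn_ge0 ?(ltW r0) // powR_exprn // exprVn.
    by rewrite mulrA.
  rewrite /c exprS invfM mulrCA; set A := r / 2 ^+ k in rk *.
  have A0 : A != 0 by rewrite gt_eqF.
  rewrite mulrAC -mulrA -expr_div_n [LHS]mulrC; congr (_ ^+ d * _) => //.
  by field.
move=> x; rewrite indicE; case: (boolP (x \in _)) => [|_]; last by rewrite mul0r ltxx.
rewrite inE /eball /= subr0 mul1r => xr fx.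
have x0 : 0 < enorm x.
  rewrite lt_neqAle enorm_ge0 andbT eq_sym; apply: contraTneq fx => ->.
  by rewrite powR0 ?mul0r ?ltxx // gt_eqF.
have [k /andP[k1 k2]] : exists k : nat, 2 ^+ k <= r / enorm x < 2 ^+ k.+1.
  by apply: dyadic_scale; rewrite ler_pdivlMr // mul1r ltW.
have xk : enorm x <= r / 2 ^+ k by rewrite ler_pdivlMr ?exprn_gt0 // mulrC -ler_pdivlMr.
have kx : r / 2 ^+ k.+1 <= enorm x.
  by rewrite ler_pdivrMr ?exprn_gt0 // mulrC -ler_pdivrMr // ltW.
exists k.
  apply: (le_lt_trans xk); rewrite ltr_pMl ?divr_gt0 ?exprn_gt0 //.
  by rewrite ltr1n.
rewrite /c ler_pM ?powR_ge0 ?invr_ge0 ?exprn_ge0 ?enorm_ge0 //.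
  by rewrite ge0_ler_powR ?nnegrE ?enorm_ge0 ?divr_ge0 ?exprn_ge0 // ltW.
have rk : 0 < r / 2 ^+ k.+1 by rewrite divr_gt0 // exprn_gt0.
by rewrite lef_pV2 ?posrE ?exprn_gt0 // lerXn2r // nnegrE ?enorm_ge0 // ltW.
Qed.

Lemma kern_split (b : R) (z : T) : 0 < b ->
  kern (d%:R + b) z = (enorm z ^+ d)^-1 * (enorm z `^ b)^-1.
Proof.
move=> b0; rewrite /kern.
have [z0|z0] := eqVneq (enorm z) 0.
  by rewrite z0 !powR0 ?invr0 ?mulr0 // gt_eqF // ltr_wpDl.
rewrite powRD ?z0 ?implybT // powR_mulrn ?enorm_ge0 // invfM.
by [].
Qed.

(** The same with the annuli outside the ball. *)
Lemma integral_far (b r : R) : 0 < b -> 0 < r ->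
  (\int[mu]_z (\1_(~` eball 0 r) z * kern (d%:R + b) z)%:E <=
   (4 ^+ d * (r `^ b)^-1 / (1 - (2 `^ b)^-1))%:E)%E.
Proof.
move=> b0 r0.
have qb : 0 <= d%:R + b by rewrite addr_ge0 // ltW.
pose c k := ((r * 2 ^+ k) ^+ d)^-1 * ((r * 2 ^+ k) `^ b)^-1.
have rk k : 0 < r * 2 ^+ k by rewrite mulr_gt0 // exprn_gt0.
have ck k : 0 <= c k by rewrite mulr_ge0 ?invr_ge0 ?powR_ge0 ?exprn_ge0 // ltW.
apply: (@integral_geometric_cover _ _ _ _ _ (fun k => eball 0 (r * 2 ^+ k.+1)) c).
- apply: measurable_funM; last exact: measurable_kern.
  by apply: measurable_indic; apply: measurableC; exact: measurable_eball.
- by move=> x; rewrite mulr_ge0 ?kern_ge0.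
- by move=> k; exact: measurable_eball.
- exact: ck.
- by rewrite mulr_ge0 ?invr_ge0 ?powR_ge0 // exprn_ge0.
- exact: geometric_ratio.
- move=> k.
  apply: (@le_trans _ _ ((c k)%:E * ((2 * (r * 2 ^+ k.+1)) ^+ d)%:E)%E).
    by apply: lee_wpmul2l; [rewrite lee_fin|exact: lebesgue_eball_le].
  rewrite -EFinM lee_fin le_eqVlt; apply/orP; left; apply/eqP.
  rewrite /c [in (r * _) `^ b]powRM ?exprn_ge0 ?(ltW r0) // powR_exprn // exprVn.
  rewrite invfM exprS; have := rk k; set A := r * 2 ^+ k => A0.
  have An : A != 0 by rewrite gt_eqF.
  rewrite (_ : 2 * (r * (2 * 2 ^+ k)) = 4 * A); last by rewrite /A; ring.
  by rewrite [(4 * A) ^+ d]exprMn; field; rewrite expf_neq0 // expf_neq0 ?gt_eqF ?powR_gt0.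
move=> x; rewrite indicE; case: (boolP (x \in _)) => [|_]; last by rewrite mul0r ltxx.
rewrite inE /eball /= subr0 mul1r => /negP; rewrite -leNgt => xr _.
have x0 : 0 < enorm x by apply: lt_le_trans xr.
have [k /andP[k1 k2]] : exists k : nat, 2 ^+ k <= enorm x / r < 2 ^+ k.+1.
  by apply: dyadic_scale; rewrite ler_pdivlMr // mul1r.
have kx : r * 2 ^+ k <= enorm x by rewrite mulrC -ler_pdivlMr.
exists k; first by rewrite /= mulrC -ltr_pdivrMr.
rewrite kern_split // /c ler_pM ?invr_ge0 ?powR_ge0 ?exprn_ge0 ?enorm_ge0 //.
  by rewrite lef_pV2 ?posrE ?exprn_gt0 // lerXn2r // nnegrE ?enorm_ge0 // ltW.
rewrite lef_pV2 ?posrE ?powR_gt0 // ge0_ler_powR ?nnegrE ?enorm_ge0 //; exact: ltW.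
Qed.

Lemma integ_kern_far (b r : R) : 0 < b -> 0 < r ->
  integ mu (fun z => \1_(~` eball 0 r) z * kern (d%:R + b) z).
Proof.
move=> b0 r0; apply/integrableP; split.
  apply/measurable_EFinP; apply: measurable_funM; last exact: measurable_kern.
  by apply: measurable_indic; apply: measurableC; exact: measurable_eball.
apply: le_lt_trans (ltry (4 ^+ d * (r `^ b)^-1 / (1 - (2 `^ b)^-1))).
apply: le_trans (integral_far b0 r0); rewrite le_eqVlt; apply/orP; left; apply/eqP.
by apply: eq_integral => z _ /=; rewrite ger0_norm // mulr_ge0 ?kern_ge0.
Qed.

Lemma integ_near (b r : R) : 0 < b -> 0 < r ->
  integ mu (fun z => \1_(eball 0 r) z * (enorm z `^ b / enorm z ^+ d)).
Proof.
move=> b0 r0; apply/integrableP; split.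
  apply/measurable_EFinP; apply: measurable_funM; first (by apply: measurable_indic; exact: measurable_eball).
  apply: measurable_funM; first exact: measurable_enorm_powR.
  apply: (measurableT_comp measurable_invr); apply: measurable_funX.
  exact: measurable_enorm.
apply: le_lt_trans (ltry (8 ^+ d * r `^ b / (1 - (2 `^ b)^-1))).
apply: le_trans (integral_near b0 r0); rewrite le_eqVlt; apply/orP; left; apply/eqP.
apply: eq_integral => z _ /=; rewrite ger0_norm //.
by rewrite !mulr_ge0 ?powR_ge0 ?invr_ge0 ?exprn_ge0 ?enorm_ge0.
Qed.

Lemma Rint_near (b r : R) : 0 < b -> 0 < r ->
  \int[mu]_z (\1_(eball 0 r) z * (enorm z `^ b / enorm z ^+ d)) <=
  8 ^+ d * r `^ b / (1 - (2 `^ b)^-1).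
Proof.
by move=> b0 r0; rewrite -lee_fin EFin_Rint ?integral_near //; exact: integ_near.
Qed.

End RadialKernels.

(** * Almost everywhere equal integrands and the tail space *)

Section AlmostEverywhere.
Context d (T : measurableType d) (R : realType).
Variable mu : {measure set T -> \bar R}.

Import HBNNSimple.

(** Cutting a simple function off on a null set changes neither its
    measurability nor its integral; so the supremum that defines the integral
    ignores null sets, for integrands that need not be measurable. *)
Lemma ge0_integral_ae_le (D : set T) (f g : T -> \bar R) :
  (forall x, 0 <= f x)%E -> (forall x, 0 <= g x)%E ->
  {ae mu, forall x, f x = g x} ->
  (\int[mu]_(x in D) f x <= \int[mu]_(x in D) g x)%E.
Proof.
move=> f0 g0 [N [mN N0 fgN]].
rewrite !ge0_integralE //.
apply: ge_ereal_sup => _ [h hf <-].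
have mC : measurable (~` N) by exact: measurableC.
have -> : sintegral mu h = sintegral mu (proj_nnsfun h mC).
  rewrite -!integralT_nnsfun; apply: ae_eq_integral => //.
  - exact/measurable_EFinP.
  - exact/measurable_EFinP.
  exists N; split => // x /= H; apply: contrapT => Nx; apply: H => _.
  by rewrite /= mindicE mem_set //= mulr1.
apply: ereal_sup_ubound; exists (proj_nnsfun h mC) => // x.
rewrite /= mindicE; case: (boolP (x \in ~` N)) => xN /=; last first.
  by rewrite mulr0 patchE; case: ifP.
rewrite mulr1; apply: (le_trans (hf x)); rewrite !patchE; case: ifP => // _.
move: xN; rewrite inE => Nx.
have -> // : f x = g x by apply: contrapT => fg; exact/Nx/fgN.
Qed.

Lemma ge0_integral_ae (D : set T) (f g : T -> \bar R) :
  (forall x, 0 <= f x)%E -> (forall x, 0 <= g x)%E ->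
  {ae mu, forall x, f x = g x} ->
  (\int[mu]_(x in D) f x = \int[mu]_(x in D) g x)%E.
Proof.
move=> f0 g0 fg; apply/eqP; rewrite eq_le !ge0_integral_ae_le //.
by apply: filterS fg => x ->.
Qed.

Lemma integral_ae (D : set T) (f g : T -> \bar R) :
  {ae mu, forall x, f x = g x} ->
  (\int[mu]_(x in D) f x = \int[mu]_(x in D) g x)%E.
Proof.
move=> fg; rewrite integralE [RHS]integralE; congr (_ - _)%E.
  by apply: ge0_integral_ae => //; apply: filterS fg => x; rewrite !funeposE => ->.
by apply: ge0_integral_ae => //; apply: filterS fg => x; rewrite !funenegE => ->.
Qed.

End AlmostEverywhere.

Section TailSpace.
Variables (R : realType) (d : nat) (s p : R).
Hypotheses (s_gt0 : 0 < s) (p_gt2 : 2 < p).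
Local Notation mu := (lebesgue_rV R d).
Local Notation T := 'rV[R]_d.
Let q : R := d%:R + s * p.

Definition weight (y : T) : R := (1 + enorm y `^ (d%:R + s * p))^-1.

Let sp0 : 0 < s * p. Proof. by rewrite mulr_gt0 //; have := p_gt2; lra. Qed.
Let q0 : 0 < q. Proof. by rewrite ltr_wpDl. Qed.

Lemma weight_gt0 y : 0 < weight y.
Proof. by rewrite invr_gt0 ltr_pwDl // powR_ge0. Qed.

Lemma weight_ge0 y : 0 <= weight y.
Proof. exact/ltW/weight_gt0. Qed.

Lemma measurable_weight : measurable_fun setT weight.
Proof.
have m : measurable_fun setT (fun y : T => 1 + enorm y `^ (d%:R + s * p)).
  by apply: measurable_funD => //; exact: measurable_enorm_powR.
exact: (measurableT_comp (@measurable_invr R) m).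
Qed.

Lemma weight_le1 y : weight y <= 1.
Proof. by rewrite invf_le1 ?ltr_pwDl ?powR_ge0 // lerDl powR_ge0. Qed.

Lemma integ_weight : integ mu weight.
Proof.
pose k (z : T) := \1_(~` eball 0 1) z * kern (d%:R + s * p) z.
apply: (@integ_le _ _ _ _ _ (fun z : T => 1 * \1_(eball 0 1) z + k z)).
- exact: measurable_weight.
- apply: integD; last exact: integ_kern_far.
  by apply: integ_indicM; [exact: measurable_eball|exact: lebesgue_eball_fin].
move=> z; rewrite ger0_norm ?weight_ge0 // /k !indicE.
case: (boolP (z \in eball 0 1)) => zb.
  rewrite mul1r (_ : _ \in _ = false) ?mul0r ?addr0 ?weight_le1 //.
  by rewrite in_setC zb.
rewrite mulr0 add0r in_setC zb mul1r.
have z1 : 1 <= enorm z.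
  by rewrite leNgt; apply: contraNN zb => h; rewrite inE /eball /= subr0.
rewrite /weight /kern lef_pV2 ?posrE ?ltr_pwDl ?powR_ge0 //; first by rewrite lerDr.
by rewrite powR_gt0 // (lt_le_trans ltr01).
Qed.

Definition kern_const (M rho : R) : R := (rho `^ q)^-1 + (1 + M / rho) `^ q.

Lemma kern_const_ge0 M rho : 0 <= kern_const M rho.
Proof. by rewrite addr_ge0 ?invr_ge0 ?powR_ge0. Qed.

(** Away from [x] the distances to [x] and to the origin are comparable, as
    [|y| <= |x - y| + M <= (1 + M / rho) |x - y|]. *)
Lemma kern_le_weight (M rho : R) (x y : T) : 0 < rho -> enorm x <= M ->
  rho <= enorm (x - y) -> kern q (x - y) <= kern_const M rho * weight y.
Proof.
move=> r0 xM rxy; have M0 : 0 <= M by apply: le_trans xM; exact: enorm_ge0.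
have xy0 : 0 < enorm (x - y) by apply: lt_le_trans rxy.
rewrite /weight /kern ler_pdivlMr ?ltr_pwDl ?powR_ge0 //.
rewrite mulrC ler_pdivrMr ?powR_gt0 // /kern_const mulrDl lerD //.
  rewrite mulrC ler_pdivlMr ?powR_gt0 // mul1r ge0_ler_powR ?nnegrE ?enorm_ge0 //.
    exact: ltW.
  exact: ltW.
rewrite -powRM ?enorm_ge0 //; last by rewrite addr_ge0 // divr_ge0 // ltW.
have t0 : 0 <= 1 + M / rho by rewrite addr_ge0 // divr_ge0 // ltW.
rewrite ge0_ler_powR ?nnegrE ?mulr_ge0 ?enorm_ge0 //; first exact: ltW.
have := enorm_triangle (y - x) x; rewrite subrK enormB => h; apply: (le_trans h).
rewrite mulrDl mul1r lerD2l; apply: (le_trans xM).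
by rewrite -mulrA ler_peMr // mulrC ler_pdivlMr // mul1r.
Qed.

(** Functions in the tail space are only Lebesgue measurable; integrals are taken
    of Borel representatives, which can be added and compared. *)
Definition tail_rep (w f : T -> R) : Prop :=
  measurable_fun setT f /\ {ae mu, forall x, w x = f x}.

Lemma tail_rep_integ w f : tail_space s p w -> tail_rep w f ->
  integ mu (fun y => `|f y| `^ (p - 1) * weight y).
Proof.
move=> [_ wfin] [mf wf]; apply/integrableP; split.
  apply/measurable_EFinP; apply: measurable_funM; last exact: measurable_weight.
  by apply: (measurableT_comp (@measurable_powR R _)); exact: measurableT_comp.
have p1 : (p - 1)^-1 != 0 by rewrite invr_eq0 gt_eqF //; have := p_gt2; lra.
have := lty_poweRy p1 wfin; congr (_ < _)%E; apply: integral_ae.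
apply: filterS wf => x -> /=; rewrite [X in _ = X%:E]ger0_norm //.
by rewrite mulr_ge0 ?powR_ge0 ?weight_ge0.
Qed.

(** The tail norm sees a function only through its representatives. *)
Lemma tail_norm_lt (w f : T -> R) (e : R) : 0 < e -> tail_rep w f ->
  (tail_norm s p w < e%:E)%E ->
  (\int[mu]_y (`|f y| `^ (p - 1) * weight y)%:E <= (e `^ (p - 1))%:E)%E.
Proof.
move=> e0 [mf wf]; rewrite /tail_norm.
rewrite (_ : (\int[mu]_x _)%E = (\int[mu]_y (`|f y| `^ (p - 1) * weight y)%:E)%E); last first.
  by apply: integral_ae; apply: filterS wf => x ->.
set J := (\int[mu]_y _)%E => Je.
have J0 : (0 <= J)%E.
  by apply: integral_ge0 => y _; rewrite lee_fin mulr_ge0 ?powR_ge0 ?weight_ge0.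
have p1 : p - 1 != 0 by rewrite gt_eqF //; have := p_gt2; lra.
have p10 : 0 <= p - 1 by have := p_gt2; lra.
have -> : J = ((J `^ (p - 1)^-1) `^ (p - 1))%E by rewrite -poweRrM mulVf // poweRe1.
rewrite -poweR_EFin; apply: gt0_ler_poweR => //.
- by rewrite in_itv /= poweR_ge0 leey.
- by rewrite in_itv /= lee_fin (ltW e0) leey.
- exact: ltW.
Qed.

Lemma tail_repB w1 w2 f1 f2 : tail_rep w1 f1 -> tail_rep w2 f2 ->
  tail_rep (fun x => w1 x - w2 x) (fun x => f1 x - f2 x).
Proof.
move=> [m1 e1] [m2 e2]; split; first exact: measurable_funB.
by apply: filterS2 e1 e2 => x -> ->.
Qed.

(** Continuity in time with values in the tail space, read on representatives. *)
Lemma C_tail_close (I : set R) (u : T * R -> R) (t e : R) : C_tail s p I u ->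
  I t -> 0 < e -> exists2 om : R, 0 < om & forall tau, I tau -> `|tau - t| < om ->
  forall f g, tail_rep (fun x => u (x, tau)) f -> tail_rep (fun x => u (x, t)) g ->
  integ mu (fun y => `|f y - g y| `^ (p - 1) * weight y) /\
  \int[mu]_y (`|f y - g y| `^ (p - 1) * weight y) <= e.
Proof.
move=> uC It e0; have p10 : 0 < p - 1 by have := p_gt2; lra.
pose e1 := e `^ (p - 1)^-1.
have e10 : 0 < e1 by exact: powR_gt0.
have e1E : e1 `^ (p - 1) = e by rewrite /e1 -powRrM mulVf ?powRr1 ?gt_eqF // ltW.
have [_ cv] := uC t It.
have : \forall tau \near within I (nbhs t),
    (tail_norm s p (fun x => (u (x, tau) - u (x, t))%R) < e1%:E)%E.
  by apply: (cv [set y | (y < e1%:E)%E]); apply: open_ereal_lt'; rewrite lte_fin.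
rewrite near_withinE => /nbhs_ballP[om /= om0 H]; exists om => // tau It' tt f g Hf Hg.
have lt : (tail_norm s p (fun x => (u (x, tau) - u (x, t))%R) < e1%:E)%E.
  by apply: H => //; rewrite -ball_normE /= distrC.
have := tail_norm_lt e10 (tail_repB Hf Hg) lt; rewrite e1E => le.
have Hi : integ mu (fun y => `|f y - g y| `^ (p - 1) * weight y).
  apply/integrableP; split.
    apply/measurable_EFinP; apply: measurable_funM; last exact: measurable_weight.
    apply: (measurableT_comp (@measurable_powR R _)); apply: measurableT_comp => //.
    by apply: measurable_funB; [case: Hf|case: Hg].
  apply: le_lt_trans (ltry e); apply: le_trans le; rewrite le_eqVlt; apply/orP; left.
  apply/eqP; apply: eq_integral => y _ /=.
  by rewrite [X in X%:E = _]ger0_norm // mulr_ge0 ?powR_ge0 ?weight_ge0.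
by split => //; rewrite -lee_fin EFin_Rint.
Qed.

End TailSpace.

(** * Testing with paraboloids *)

Section Paraboloid.
Variables (R : realType) (d : nat).
Local Notation T := 'rV[R]_d.

Definition sqdist (z w : T * R) : R := enorm (z.1 - w.1) ^+ 2 + (z.2 - w.2) ^+ 2.

Definition paraboloid (A c : R) (w z : T * R) : R := A + c * sqdist z w.

Lemma sqdist_ge0 z w : 0 <= sqdist z w.
Proof. by rewrite addr_ge0 ?sqr_ge0. Qed.

Lemma sqdistC z w : sqdist z w = sqdist w z.
Proof. by rewrite /sqdist enormB -[(z.2 - w.2) ^+ 2]sqrrN opprB. Qed.

Lemma sqdistxx z : sqdist z z = 0.
Proof. by rewrite /sqdist !subrr enorm0 expr0n addr0. Qed.

(** Along a line a paraboloid is a quadratic polynomial, whose directional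
    derivative can be read off. *)
Lemma derive_line (f : T -> R) (a v : T) (b c : R) :
  (forall h, f (h *: v + a) - f a = h * b + h ^+ 2 * c) ->
  derivable f a v /\ 'D_v f a = b.
Proof.
move=> H.
have cv : (fun h => h^-1 *: ((f \o shift a) (h *: v) - f a)) @ 0^' --> (b : R).
  have : (fun h : R => b + h * c) @ 0^' --> (b : R).
    rewrite -[X in _ --> X]addr0; apply: cvgD; first exact: cvg_cst.
    rewrite -[X in _ --> X](mul0r c); apply: cvgMl.
    exact: cvg_within.
  apply: cvg_trans; apply: near_eq_cvg; rewrite near_withinE; apply: nearW => h h0.
  by rewrite /= H /GRing.scale /=; field.
by split; [apply/cvg_ex; exists b|exact: cvg_lim cv].
Qed.

Variables (A c : R) (w : T * R).
Local Notation phi := (paraboloid A c w).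

Lemma coord_evec (i j : 'I_d) : evec R i ord0 j = (i == j)%:R.
Proof. by rewrite /evec mxE eqxx eq_sym. Qed.

Lemma dotp_evec (i : 'I_d) (h : R) (y : T) : dotp (h *: evec R i) y = h * y ord0 i.
Proof.
rewrite /dotp (bigD1 i) //= !mxE !eqxx mulr1 big1 ?addr0 // => j ji.
by rewrite !mxE eqxx (negbTE ji) mulr0 mul0r.
Qed.

Lemma sqr_enorm_dotp (y : T) : enorm y ^+ 2 = dotp y y.
Proof. by rewrite sqr_enorm; apply: eq_bigr => i _; rewrite expr2. Qed.

Lemma paraboloid_derive i z :
  x_derivable i phi z /\ Dx i phi z = 2 * c * (z.1 - w.1) ord0 i.
Proof.
apply: (derive_line (c := c)) => h.
rewrite /paraboloid /sqdist /= -(addrA (h *: evec R i)) (sqr_enormD (h *: evec R i)) dotp_evec.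
have -> : enorm (h *: evec R i) ^+ 2 = h ^+ 2.
  by rewrite sqr_enorm_dotp dotp_evec mxE coord_evec eqxx mulr1 expr2.
ring.
Qed.

Lemma paraboloid_derive2 i j z :
  x_derivable j (Dx i phi) z /\ Dx j (Dx i phi) z = 2 * c * (i == j)%:R.
Proof.
have E : Dx i phi = fun z => 2 * c * (z.1 - w.1) ord0 i.
  by apply/funext => y; have [] := paraboloid_derive i y.
rewrite E; apply: (derive_line (c := 0)) => h /=.
rewrite !mxE eqxx /=; ring.
Qed.

Lemma time_filter_proper (t0 t : R) : t <= t0 -> ProperFilter (time_filter t0 t).
Proof.
move=> tt; split; last exact: within_filter.
rewrite /time_filter /within /= => /nbhs_ballP[e /= e0 H].
apply: (H (t - e / 2)); last by rewrite /=; lra.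
  by rewrite -ball_normE /= opprB addrC subrK ger0_norm; lra.
by rewrite lt_eqF //; lra.
Qed.

Lemma paraboloid_time (t0 : R) z : z.2 <= t0 ->
  time_quotient phi z @ time_filter t0 z.2 --> (2 * c * (z.2 - w.2) : R).
Proof.
move=> zt.
have : (fun tau : R => c * (tau + z.2 - 2 * w.2)) @ time_filter t0 z.2 -->
    (2 * c * (z.2 - w.2) : R).
  have -> : 2 * c * (z.2 - w.2) = c * (z.2 + z.2 - 2 * w.2) by ring.
  apply: cvgMr; apply: cvgB; last exact: cvg_cst.
  apply: cvgD; last exact: cvg_cst.
  by apply: cvg_within_filter; exact: cvg_within.
apply: cvg_trans; apply: near_eq_cvg.
rewrite /time_filter near_withinE near_withinE; apply: nearW => tau tz _.
rewrite /time_quotient /paraboloid /sqdist /=; field.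
by rewrite subr_eq0.
Qed.

Lemma paraboloid_Dt (t0 : R) z : z.2 <= t0 -> Dt t0 phi z = 2 * c * (z.2 - w.2).
Proof.
move=> zt; have PF := time_filter_proper zt.
exact: (@cvg_lim _ _ _ _ PF _ _ (paraboloid_time zt)).
Qed.

Lemma sqdist_continuous : continuous (sqdist ^~ w).
Proof.
move=> z; apply: cvgD.
  have e1 : continuous (fun z : T * R => enorm (z.1 - w.1)).
    move=> y; apply: (@continuous_comp _ _ _ (fun z : T * R => z.1 - w.1)).
      by apply: cvgB; [exact: cvg_fst|exact: cvg_cst].
    exact: enorm_continuous.
  by apply: cvgM; exact: e1.
have e2 : continuous (fun z : T * R => z.2 - w.2).
  by move=> y; apply: cvgB; [exact: cvg_snd|exact: cvg_cst].
by apply: cvgM; exact: e2.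
Qed.

Lemma paraboloid_continuous : continuous phi.
Proof.
move=> z; apply: cvgD; first exact: cvg_cst.
by apply: cvgMr; exact: sqdist_continuous.
Qed.

Lemma paraboloid_C2 x0 t0 r : C2_cylinder x0 t0 r phi.
Proof.
have Q2 z : cylinder x0 t0 r z -> z.2 <= t0.
  by move=> [_]; rewrite /= in_itv /= => /andP[].
split.
- exact/continuous_subspaceT/paraboloid_continuous.
- split=> [z /Q2 zt|].
    by apply/cvg_ex; exists (2 * c * (z.2 - w.2)); exact: paraboloid_time.
  apply: (@subspace_eq_continuous _ _ _ (fun z : T * R => 2 * c * (z.2 - w.2))).
    by move=> z /set_mem /Q2 zt; exact/esym/paraboloid_Dt.
  apply: (@continuous_subspaceT _ _ _ (fun z : T * R => 2 * c * (z.2 - w.2))) => z.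
  by apply: cvgMr; apply: cvgB; [exact: cvg_snd|exact: cvg_cst].
- move=> i; split=> [z _|]; first by have [] := paraboloid_derive i z.
  have -> : Dx i phi = fun z => 2 * c * (z.1 - w.1) ord0 i.
    by apply/funext => y; have [] := paraboloid_derive i y.
  apply: continuous_subspaceT => z; apply: cvgMr.
  apply: (@continuous_comp _ _ _ (fun z : T * R => z.1 - w.1) (fun y => y ord0 i)).
    by apply: cvgB; [exact: cvg_fst|exact: cvg_cst].
  exact: coord_continuous.
move=> i j; split=> [z _|]; first by have [] := paraboloid_derive2 i j z.
have -> : Dx j (Dx i phi) = fun=> 2 * c * (i == j)%:R.
  by apply/funext => y; have [] := paraboloid_derive2 i j y.
by apply: continuous_subspaceT => z; exact: cvg_cst.
Qed.

End Paraboloid.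

(** * The fractional p-Laplacian of a glued paraboloid *)

Section Jump.
Variables (R : realType) (d : nat) (s p : R).
Hypotheses (s_gt0 : 0 < s) (s_lt1 : s < 1) (p_gt2 : 2 < p).
Local Notation mu := (lebesgue_rV R d).
Local Notation T := 'rV[R]_d.
Local Notation q := (d%:R + s * p).
Local Notation K := (@kern R d q).

Definition jump (x : T) (a : R) (f : T -> R) (y : T) : R :=
  spow p (a - f y) * kern (d%:R + s * p) (x - y).

Let sp0 : 0 < s * p. Proof. by rewrite mulr_gt0 //; have := p_gt2; lra. Qed.
Let q0 : 0 < q. Proof. by rewrite ltr_wpDl. Qed.
Let pm1 : 0 <= p - 1. Proof. by have := p_gt2; lra. Qed.
Let pm2 : 0 <= p - 2. Proof. by have := p_gt2; lra. Qed.

Lemma measurable_spow : measurable_fun setT (@spow R p).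
Proof.
apply: measurable_funM => //.
by apply: (measurableT_comp (@measurable_powR R _)); exact: normr_measurable.
Qed.

Lemma measurable_jump x a f : measurable_fun setT f ->
  measurable_fun setT (jump x a f).
Proof.
move=> mf; apply: measurable_funM.
  by apply: (measurableT_comp measurable_spow); exact: measurable_funB.
have m : measurable_fun setT (fun y : T => x - y).
  have := measurable_affine true x; congr (measurable_fun _ _).
  by apply/funext => y; rewrite /affine expr1 scaleN1r.
exact: (measurableT_comp (@measurable_kern R d q) m).
Qed.

Lemma spow_sub_le (a b : R) :
  `|spow p (a - b)| <= 2 `^ (p - 1) * (`|a| `^ (p - 1) + `|b| `^ (p - 1)).
Proof.
rewrite normr_spow //; apply: le_trans (powR_add_le p_gt2 _ _) => //.
by apply: ge0_ler_powR => //; rewrite ?nnegrE ?ler_normB // addr_ge0.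
Qed.

Definition tail_integ (f : T -> R) : Prop :=
  measurable_fun setT f /\ integ mu (fun y => `|f y| `^ (p - 1) * weight s p y).

Lemma jump_far_le (x y : T) (a M rho : R) f : 0 < rho -> enorm x <= M ->
  rho <= enorm (x - y) ->
  `|jump x a f y| <= 2 `^ (p - 1) * kern_const d s p M rho *
     (`|a| `^ (p - 1) * weight s p y + `|f y| `^ (p - 1) * weight s p y).
Proof.
move=> r0 xM xy; rewrite /jump normrM (ger0_norm (kern_ge0 _ _)).
apply: (@le_trans _ _ (2 `^ (p - 1) * (`|a| `^ (p - 1) + `|f y| `^ (p - 1)) *
   (kern_const d s p M rho * weight s p y))).
  by apply: ler_pM; rewrite ?kern_ge0 ?spow_sub_le // kern_le_weight.
by rewrite le_eqVlt; apply/orP; left; apply/eqP; ring.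
Qed.

Lemma integ_jump_far (x : T) (a rho : R) f (A : set T) : 0 < rho ->
  measurable A -> A `<=` ~` eball x rho -> tail_integ f ->
  integ mu (fun y => \1_A y * jump x a f y).
Proof.
move=> r0 mA Ar [mf If].
apply: (@integ_le _ _ _ _ _ (fun y : T => 2 `^ (p - 1) * kern_const d s p (enorm x) rho *
     (`|a| `^ (p - 1) * weight s p y + `|f y| `^ (p - 1) * weight s p y))).
- by apply: measurable_funM; [exact: measurable_indic|exact: measurable_jump].
- by apply: integZ; apply: integD => //; apply: integZ; exact: integ_weight.
move=> y; rewrite normrM indicE; case: (boolP (y \in A)) => yA.
  rewrite normr1 mul1r; apply: jump_far_le => //.
  by rewrite leNgt enormB; apply/negP => h; exact: (Ar y (set_mem yA)).
rewrite normr0 mul0r mulr_ge0 ?mulr_ge0 ?powR_ge0 ?kern_const_ge0 //.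
by rewrite addr_ge0 // mulr_ge0 ?powR_ge0 ?weight_ge0.
Qed.

(** The increment of a paraboloid is [Q + c |z|^2] with [Q] linear.
    Pairing [z] with [-z] cancels the odd part, and what is left is of order
    [|z|^p], which is integrable against the kernel because [s < 1]. *)
Section NearPart.
Variables (c : R) (e : T).

Definition near_jump (z : T) : R :=
  spow p (- (c * (2 * dotp e z + enorm z ^+ 2))) * K z.

Lemma measurable_near_jump : measurable_fun setT near_jump.
Proof.
apply: measurable_funM; last exact: measurable_kern.
apply: (measurableT_comp measurable_spow); apply: measurable_funN.
apply: measurable_funM => //; apply: measurable_funD.
  apply: measurable_funM => //; rewrite /dotp.
  apply: (@measurable_sum _ _ _ _ _ (index_enum _)
    (fun (i : 'I_d) (z : T) => e ord0 i * z ord0 i)) => i.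
  by apply: measurable_funM => //; exact: measurable_coord.
by apply: measurable_funX; exact: measurable_enorm.
Qed.

Lemma near_jump_sym (N M : R) (z : T) : 0 <= N ->
  (forall a b, `|spow p a - spow p b| <= N * (`|a| + `|b|) `^ (p - 2) * `|a - b|) ->
  enorm e <= M -> enorm z <= 1 ->
  `|near_jump z + near_jump (- z)| <=
    2 * N * (4 * M + 2) `^ (p - 2) * `|c| `^ (p - 1) *
     (enorm z `^ (p - s * p) / enorm z ^+ d).
Proof.
move=> N0 HN eM z1; have M0 : 0 <= M by apply: le_trans eM; exact: enorm_ge0.
have z0 := enorm_ge0 z.
have [zz|zn] := eqVneq (enorm z) 0.
  rewrite (enorm_eq0 zz) oppr0.
  have -> : near_jump 0 = 0.
    by rewrite /near_jump /kern enorm0 powR0 ?invr0 ?mulr0 // gt_eqF.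
  rewrite addr0 normr0 mulr_ge0 // ?mulr_ge0 ?powR_ge0 ?invr_ge0 ?exprn_ge0 ?enorm_ge0 //.
have zp : 0 < enorm z by rewrite lt_neqAle eq_sym zn.
rewrite /near_jump kernN enormN dotpNr.
set Q := 2 * dotp e z; set S := enorm z ^+ 2.
have -> : - (c * (Q + S)) = - (c * Q + c * S) by ring.
have -> : - (c * (2 * - dotp e z + S)) = c * Q - c * S by rewrite /Q; ring.
rewrite (spowN p (c * Q + c * S)) -mulrDl addrC normrM (ger0_norm (kern_ge0 _ _)).
have Qz : `|Q| <= 2 * M * enorm z.
  rewrite /Q normrM normr_nat -mulrA ler_pM2l //.
  by apply: (le_trans (cauchy_schwarz _ _)); rewrite ler_wpM2r.
have Sz : S <= enorm z by rewrite /S expr2 ler_piMr.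
have S0 : 0 <= S by exact: sqr_ge0.
have hB : `|c * Q - c * S| + `|c * Q + c * S| <= (4 * M + 2) * `|c| * enorm z.
  rewrite -mulrBr -mulrDr !normrM -mulrDr (mulrAC _ `|c|) [X in _ <= X]mulrC.
  rewrite ler_wpM2l //.
  have := ler_normB Q S; have := ler_normD Q S; rewrite (ger0_norm S0).
  by nra.
have t0 : 0 <= 4 * M + 2 by lra.
apply: (@le_trans _ _ (N * ((4 * M + 2) * `|c| * enorm z) `^ (p - 2) * (2 * `|c| * S) * K z)).
  rewrite ler_wpM2r ?kern_ge0 //; apply: (le_trans (HN _ _)).
  apply: ler_pM => //.
  - by rewrite mulr_ge0 ?powR_ge0.
  - by rewrite ler_wpM2l // ge0_ler_powR // ?nnegrE ?addr_ge0 ?mulr_ge0.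
  rewrite (_ : c * Q - c * S - _ = - (2 * c * S)); last by ring.
  by rewrite normrN (normrM (2 * c)) (normrM 2) normr_nat (ger0_norm S0).
rewrite !powRM ?mulr_ge0 // -(powR_pred p_gt2 (normr_ge0 c)).
have e1 : enorm z `^ (p - s * p) = enorm z `^ (p - 2) * S / enorm z `^ (s * p).
  rewrite /S -(powR_mulrn 2 z0) -(@powRD _ _ (p - 2)) ?zn ?implybT //.
  by rewrite -powRB ?zn ?implybT //; congr (_ `^ _); ring.
rewrite kern_split // e1 le_eqVlt; apply/orP; left; apply/eqP; ring.
Qed.

End NearPart.

Let beta : R := p - s * p.
Let beta0 : 0 < beta. Proof. by rewrite /beta; have := p_gt2; have := s_lt1; nra. Qed.
Let Cb : R := 8 ^+ d / (1 - (2 `^ beta)^-1).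
Let Cb0 : 0 <= Cb.
Proof.
have /andP[_ h] := geometric_ratio beta0.
by rewrite divr_ge0 ?exprn_ge0 // subr_ge0 ltW.
Qed.

Definition near_int (c : R) (e : T) (r eps : R) : R :=
  \int[mu]_z (\1_(eball 0 r `\` eball 0 eps) z * near_jump c e z).

(** The limit of [near_int] as [eps] tends to 0, as an absolutely convergent
    integral. *)
Definition near_lim (c : R) (e : T) (r : R) : R :=
  2^-1 * \int[mu]_z (\1_(eball 0 r) z * (near_jump c e z + near_jump c e (- z))).

Lemma near_bound (c M : R) : exists2 C : R, 0 <= C &
  forall e z, enorm e <= M -> enorm z <= 1 ->
  `|near_jump c e z + near_jump c e (- z)| <=
     C * (enorm z `^ beta / enorm z ^+ d).
Proof.
have [N N0 HN] := spow_lip p_gt2.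
exists (2 * N * (4 * M + 2) `^ (p - 2) * `|c| `^ (p - 1)).
  by rewrite !mulr_ge0 ?powR_ge0.
by move=> e z eM z1; exact: near_jump_sym.
Qed.

Lemma integ_near_jump c e r eps : 0 < eps -> r <= 1 ->
  integ mu (fun z => \1_(eball 0 r `\` eball 0 eps) z * near_jump c e z).
Proof.
move=> e0 r1; have mA : measurable (eball (0 : T) r `\` eball 0 eps).
  by apply: measurableD; exact: measurable_eball.
pose B := (`|c| * (2 * enorm e + 1)) `^ (p - 1) * (eps `^ q)^-1.
apply: (@integ_le _ _ _ _ _ (fun z : T => B * \1_(eball 0 r) z)).
- by apply: measurable_funM; [exact: measurable_indic|exact: measurable_near_jump].
- by apply: integ_indicM; [exact: measurable_eball|exact: lebesgue_eball_fin].
move=> z; rewrite normrM !indicE.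
have [|zA] := boolP (z \in eball 0 r `\` eball 0 eps); last first.
  by rewrite normr0 mul0r mulr_ge0 // mulr_ge0 ?powR_ge0 // invr_ge0 powR_ge0.
rewrite inE => -[zr /negP]; rewrite mem_set // /eball /= subr0 -leNgt normr1 mul1r mulr1 => ze.
have z1 : enorm z <= 1 by move: zr; rewrite /eball /= subr0; lra.
have z0 := enorm_ge0 z.
rewrite /near_jump normrM (ger0_norm (kern_ge0 _ _)) normr_spow // /B.
apply: ler_pM; rewrite ?powR_ge0 ?kern_ge0 //; last first.
  rewrite /kern lef_pV2 ?posrE ?powR_gt0 //; last exact: lt_le_trans ze.
  by rewrite ge0_ler_powR ?nnegrE // ltW.
rewrite ge0_ler_powR // ?nnegrE ?mulr_ge0 ?addr_ge0 ?mulr_ge0 ?enorm_ge0 //.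
rewrite normrN normrM ler_wpM2l //; apply: (le_trans (ler_normD _ _)).
rewrite normrM normr_nat (ger0_norm (sqr_ge0 _)) lerD //.
  rewrite ler_pM2l //; apply: (le_trans (cauchy_schwarz _ _)).
  by rewrite ler_piMr ?enorm_ge0.
by rewrite expr_le1.
Qed.

Lemma indic_oppE (r eps : R) (z : T) :
  \1_(eball 0 r `\` eball 0 eps) (- z) = \1_(eball 0 r `\` eball 0 eps) z :> R.
Proof.
rewrite !indicE; congr (nat_of_bool _)%:R; apply/idP/idP; rewrite !inE /eball /=;
by rewrite !subr0 enormN.
Qed.

Lemma near_int_sym c e r eps : 0 < eps -> r <= 1 -> near_int c e r eps =
  2^-1 * \int[mu]_z (\1_(eball 0 r `\` eball 0 eps) z *
    (near_jump c e z + near_jump c e (- z))).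
Proof.
move=> e0 r1; have I1 := integ_near_jump c e e0 r1.
have I2 := integ_opp I1.
have -> : \int[mu]_z (\1_(eball 0 r `\` eball 0 eps) z *
    (near_jump c e z + near_jump c e (- z))) =
  \int[mu]_z (\1_(eball 0 r `\` eball 0 eps) z * near_jump c e z +
     \1_(eball 0 r `\` eball 0 eps) (- z) * near_jump c e (- z)).
  by apply: eq_Rintegral => z _; rewrite indic_oppE mulrDr.
rewrite (RintD I1 I2) (Rint_opp I1) -/(near_int c e r eps).
by set X := near_int c e r eps; lra.
Qed.

Lemma integ_near_sym c e r : 0 < r -> r <= 1 ->
  integ mu (fun z => \1_(eball 0 r) z * (near_jump c e z + near_jump c e (- z))).
Proof.
move=> r0 r1; have [C C0 HC] := near_bound c (enorm e).
apply: (@integ_le _ _ _ _ _ (fun z : T => C * (\1_(eball 0 r) z * (enorm z `^ beta / enorm z ^+ d)))).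
- apply: measurable_funM; first by apply: measurable_indic; exact: measurable_eball.
  apply: measurable_funD; first exact: measurable_near_jump.
  have m : measurable_fun setT (fun y : T => - y).
    have := measurable_affine true (0 : T); congr (measurable_fun _ _).
    by apply/funext => y; rewrite /affine expr1 scaleN1r add0r.
  exact: (measurableT_comp (measurable_near_jump c e) m).
- by apply: integZ; exact: integ_near.
move=> z; rewrite normrM indicE.
have [|zA] := boolP (z \in eball 0 r); last by rewrite normr0 !mul0r mulr0.
rewrite inE /eball /= subr0 => zr.
by rewrite normr1 !mul1r HC //; lra.
Qed.

Lemma near_lim_le (c M : R) : exists2 C : R, 0 <= C &
  forall e r, 0 < r -> r <= 1 -> enorm e <= M ->
  `|near_lim c e r| <= C * r `^ beta /\
  forall eps, 0 < eps -> eps < r ->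
    `|near_lim c e r - near_int c e r eps| <= C * eps `^ beta.
Proof.
have [C C0 HC] := near_bound c M.
exists (C * Cb); first exact: mulr_ge0.
move=> e r r0 r1 eM.
have small a : 0 < a -> a <= r ->
    `|2^-1 * \int[mu]_z (\1_(eball 0 a) z * (near_jump c e z + near_jump c e (- z)))|
    <= C * Cb * a `^ beta.
  move=> a0 ar; rewrite normrM.
  have a1 : a <= 1 by lra.
  have Ia := integ_near_sym c e a0 a1.
  have In := integ_near d beta0 a0.
  apply: (@le_trans _ _ (C * \int[mu]_z (\1_(eball 0 a) z * (enorm z `^ beta / enorm z ^+ d)))).
    apply: (@le_trans _ _ (1 * `|\int[mu]_z (\1_(eball 0 a) z * (near_jump c e z + near_jump c e (- z)))|)).
      by rewrite ler_wpM2r // ger0_norm //; lra.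
    rewrite mul1r; apply: (le_trans (Rint_norm Ia)).
    rewrite -RintZ //; apply: Rint_le; [exact: integ_norm|exact: integZ|].
    move=> z; rewrite normrM indicE.
    have [|zA] := boolP (z \in eball 0 a); last by rewrite normr0 !mul0r mulr0.
    rewrite inE /eball /= subr0 => zr.
    by rewrite normr1 !mul1r HC //; lra.
  rewrite -mulrA ler_wpM2l //; apply: (le_trans (Rint_near d beta0 a0)).
  by rewrite /Cb le_eqVlt; apply/orP; left; apply/eqP; ring.
split; first exact: small.
move=> eps e0 er; rewrite near_int_sym // -mulrBr -RintB; last 2 first.
- exact: integ_near_sym.
- have := integ_indic (measurableC (measurable_eball (0 : T) eps)) (integ_near_sym c e r0 r1).
  apply: eq_integrable => // z _ /=; rewrite !indicE mulrA -natrM mulnb.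
  by rewrite -in_setI setIC.
apply: le_trans (small eps e0 (ltW er)).
rewrite le_eqVlt; apply/orP; left; apply/eqP; congr `|_ * _|.
apply: eq_Rintegral => z _; rewrite -mulrBl; congr (_ * _); rewrite !indicE.
have [|zA] := boolP (z \in eball 0 eps).
  rewrite inE => ze; rewrite mem_set; last by move: ze; rewrite /eball /=; lra.
  by rewrite memNset ?subr0 // => -[_]; exact.
rewrite in_setD zA andbT subrr //.
Qed.

End Jump.

Section TestOperator.
Variables (R : realType) (d : nat) (s p : R).
Hypotheses (s_gt0 : 0 < s) (s_lt1 : s < 1) (p_gt2 : 2 < p).
Local Notation mu := (lebesgue_rV R d).
Local Notation T := 'rV[R]_d.
Local Notation q := (d%:R + s * p).

Let beta : R := p - s * p.
Let beta0 : 0 < beta. Proof. by rewrite /beta; have := p_gt2; have := s_lt1; nra. Qed.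

Lemma cylinder_slice (x0 y : T) (t0 r : R) : 0 < r ->
  cylinder x0 t0 r (y, t0) <-> eball x0 r y.
Proof.
move=> r0; split=> [[]|yr] //; split => //=.
by rewrite in_itv /= lexx andbT ltrBlDr ltrDl exprn_gt0.
Qed.

Definition far_int (x : T) (a rho : R) (f : T -> R) : R :=
  \int[mu]_y (\1_(~` eball x rho) y * jump s p x a f y).

(** Inside the cylinder the principal value converges by symmetry, whatever the
    exterior data; outside it the integral is absolutely convergent. *)
Lemma frac_glued (x0 : T) (t0 r A c : R) (w : T * R) u f :
  0 < r -> r <= 1 -> tail_rep (fun x => u (x, t0)) f -> tail_integ s p f ->
  frac_pLaplacian s p
    (fun x => glued x0 t0 r (paraboloid A c w) u (x, t0)) x0 =
  (near_lim s p c (x0 - w.1) r +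
   far_int x0 (paraboloid A c w (x0, t0)) r f)%:E.
Proof.
move=> r0 r1 [mf uf] tf.
pose e := x0 - w.1; pose a := paraboloid A c w (x0, t0).
pose g y := if y \in eball x0 r then paraboloid A c w (y, t0) else f y.
have gluedE y : glued x0 t0 r (paraboloid A c w) u (y, t0) =
    if y \in eball x0 r then paraboloid A c w (y, t0) else u (y, t0).
  rewrite /glued /patch.
  rewrite (_ : ((y, t0) \in cylinder x0 t0 r) = (y \in eball x0 r)) //.
  by apply/idP/idP; rewrite !inE => /(cylinder_slice _ _ _ r0).
have x0r : x0 \in eball x0 r by rewrite inE /eball /= subrr enorm0.
have ug : {ae mu, forall y, glued x0 t0 r (paraboloid A c w) u (y, t0) = g y}.
  by apply: filterS uf => y uy; rewrite gluedE /g; case: ifP.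
have mA eps : measurable (eball (0 : T) r `\` eball 0 eps).
  by apply: measurableD; exact: measurable_eball.
have mfar : measurable (~` eball x0 r) by apply: measurableC; exact: measurable_eball.
have Ifar : integ mu (fun y => \1_(~` eball x0 r) y * jump s p x0 a f y).
  exact: (integ_jump_far s_gt0 p_gt2 a r0 mfar _ tf).
have main eps : 0 < eps -> eps < r ->
   (\int[mu]_(y in ~` eball x0 eps)
     (jump s p x0 (glued x0 t0 r (paraboloid A c w) u (x0, t0))
       (fun y => glued x0 t0 r (paraboloid A c w) u (y, t0)) y)%:E)%E =
   (near_int s p c e r eps + far_int x0 a r f)%:E.
  move=> e0 er; rewrite {1}gluedE x0r -/a.
  rewrite (@integral_ae _ _ _ mu _ _ (fun y => (jump s p x0 a g y)%:E)); last first.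
    by apply: filterS ug => y gy; rewrite /jump gy.
  have In := integ_near_jump s_gt0 p_gt2 c e e0 r1.
  have In' := integ_shift (- x0) In.
  rewrite integral_mkcond.
  rewrite (_ : near_int _ _ _ _ _ _ + _ = \int[mu]_y
      (\1_(eball 0 r `\` eball 0 eps) (- x0 + y) * near_jump s p c e (- x0 + y) +
       \1_(~` eball x0 r) y * jump s p x0 a f y)); last first.
    by rewrite (RintD In' Ifar) (Rint_shift (- x0) In).
  rewrite (EFin_Rint (integD In' Ifar)).
  apply: eq_integral => y _; rewrite patchE !indicE.
  have yb0 (b : R) : (- x0 + y \in eball 0 b) = (y \in eball x0 b).
    by apply/idP/idP; rewrite !inE /eball /= subr0 addrC.
  rewrite !in_setC in_setD !yb0.
  have [ye|ye] := boolP (y \in eball x0 eps).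
    have -> : y \in eball x0 r by rewrite inE; move: ye; rewrite inE /eball /=; lra.
    by rewrite andbF !mul0r addr0.
  rewrite andbT; have [yr|yr] := boolP (y \in eball x0 r); last first.
    by rewrite mul0r add0r mul1r /jump /g (negbTE yr).
  rewrite mul1r mul0r addr0; congr (_%:E).
  rewrite /jump /near_jump /g yr kernB (addrC (- x0)); congr (spow p _ * _).
  rewrite /a /paraboloid /sqdist /=.
  have -> : y - w.1 = (y - x0) + e by rewrite /e addrA subrK.
  by rewrite (sqr_enormD (y - x0)) /e /dotp (eq_bigr _ (fun i _ => mulrC _ _)); ring.
have near_main : \forall eps \near 0^'+, (near_int s p c e r eps + far_int x0 a r f)%:E =
   (\int[mu]_(y in ~` eball x0 eps)
     (jump s p x0 (glued x0 t0 r (paraboloid A c w) u (x0, t0))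
       (fun y => glued x0 t0 r (paraboloid A c w) u (y, t0)) y)%:E)%E.
  near=> eps; have e0 : 0 < eps by near: eps; exact: nbhs_right_gt.
  have er : eps < r by near: eps; exact: nbhs_right_lt.
  by rewrite (main eps e0 er).
rewrite /frac_pLaplacian; apply: cvg_lim => //.
apply: cvg_trans; first exact: near_eq_cvg near_main.
apply: cvg_EFin; first exact: nearW.
have [C C0 HC] := @near_lim_le R d s p s_gt0 s_lt1 p_gt2 c (enorm e).
have [_ {}HC] := HC e r r0 r1 (lexx _).
apply: cvgD; last exact: cvg_cst.
have C1 : 0 < C + 1 by lra.
apply/cvgrPdist_le => eta eta0.
have eta1 : 0 < (C + 1)^-1 * eta by rewrite mulr_gt0 ?invr_gt0.
have small : \forall eps \near 0^'+, eps `^ beta <= (C + 1)^-1 * eta.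
  have /cvgrPdist_le /(_ _ eta1) := @powR_cvg0 R beta beta0.
  by apply: filterS => eps; rewrite sub0r normrN ger0_norm // powR_ge0.
near=> eps.
have e0 : 0 < eps by near: eps; exact: nbhs_right_gt.
have er : eps < r by near: eps; exact: nbhs_right_lt.
apply: (le_trans (HC eps e0 er)).
apply: (@le_trans _ _ ((C + 1) * eps `^ beta)).
  by rewrite ler_wpM2r ?powR_ge0 //; lra.
rewrite -ler_pdivlMl //; near: eps; exact: small.
Unshelve. all: by end_near. Qed.

(** The contribution of the paraboloid tends to zero with the radius of the
    cylinder, uniformly in the data; the radius can thus be taken small after
    the curvature [c], which blows up with the penalization. *)
Lemma test_paraboloid (c M eta : R) : 0 < eta ->
  exists2 rho1 : R, 0 < rho1 <= 1 & forall r x0 t0 A w u f,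
    0 < r -> r < rho1 -> enorm (x0 - w.1) <= M ->
    tail_rep (fun x => u (x, t0)) f -> tail_integ s p f ->
    exists2 S : R, `|S| <= eta &
      test_operator s p x0 t0 r (paraboloid A c w) u =
      (2 * c * (t0 - w.2) + (S + far_int x0 (paraboloid A c w (x0, t0)) r f))%:E.
Proof.
move=> eta0; have [C C0 HC] := @near_lim_le R d s p s_gt0 s_lt1 p_gt2 c M.
have C1 : 0 < C + 1 by lra.
pose rho := (eta / (C + 1)) `^ beta^-1.
have h0 : 0 < eta / (C + 1) by rewrite divr_gt0.
have rho0 : 0 < rho by exact: powR_gt0.
exists (Num.min 1 rho); first by rewrite lt_min ltr01 rho0 /= ge_min lexx.
move=> r x0 t0 A w u f r0; rewrite lt_min => /andP[r1 rr] eM uf tf.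
exists (near_lim s p c (x0 - w.1) r).
  have [h _] := HC (x0 - w.1) r r0 (ltW r1) eM; apply: (le_trans h).
  apply: (@le_trans _ _ ((C + 1) * rho `^ beta)).
    rewrite ler_pM ?powR_ge0 //; first by lra.
    by rewrite ge0_ler_powR ?nnegrE // ltW.
  by rewrite /rho -powRrM mulVf ?gt_eqF // powRr1 ?(ltW h0) // mulrC divfK // gt_eqF.
rewrite /test_operator paraboloid_Dt //= (@frac_glued x0 t0 r A c w u f r0 (ltW r1) uf tf).
by rewrite -EFinD.
Qed.

End TestOperator.

(** * Semicontinuous functions on compact sets, sup-convolutions *)

Section Semicontinuity.
Variables (R : realType) (d : nat).
Local Notation T := 'rV[R]_d.
Implicit Types (z w : T * R) (A K : set (T * R)) (f g V : T * R -> R).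

Definition close (om : R) z w : Prop :=
  enorm (z.1 - w.1) < om /\ `|z.2 - w.2| < om.

Lemma closeC om z w : close om z w -> close om w z.
Proof. by move=> [h1 h2]; split; rewrite 1?enormB // distrC. Qed.

Lemma close_trans om1 om2 om z w y : close om1 z w -> close om2 w y ->
  om1 + om2 <= om -> close om z y.
Proof.
move=> [h1 h2] [h3 h4] h; split.
  have := enorm_triangle (z.1 - w.1) (w.1 - y.1).
  by rewrite addrA subrK; lra.
have := ler_normD (z.2 - w.2) (w.2 - y.2).
by rewrite addrA subrK; lra.
Qed.

Lemma close_le om om' z w : om <= om' -> close om z w -> close om' z w.
Proof. by move=> h [h1 h2]; split; [exact: lt_le_trans h1 h|exact: lt_le_trans h2 h]. Qed.

Lemma close_refl om z : 0 < om -> close om z z.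
Proof. by move=> h; split; rewrite subrr ?enorm0 ?normr0. Qed.

Lemma nbhs_close z (om : R) : 0 < om -> \forall z' \near z, close om z' z.
Proof.
move=> om0; exists (eball z.1 om, ball z.2 om).
  by split; [exact: nbhs_eball|exact: nbhsx_ballx].
move=> [y tau] [/= h1 h2]; split => //=.
by move: h2; rewrite -ball_normE /= distrC.
Qed.

Lemma nbhs_closeP z (P : set (T * R)) : nbhs z P ->
  exists2 om : R, 0 < om & forall z', close om z' z -> P z'.
Proof.
move=> [[A B] [/= /nbhs_eballP[r1 r10 h1] /nbhs_ballP[r2 /= r20 h2]] AB].
exists (Num.min r1 r2); first by rewrite lt_min r10.
move=> [y tau] [/=]; rewrite !lt_min => /andP[y1 _] /andP[_ t2].
apply: AB; split; first exact: h1.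
by apply: h2; rewrite -ball_normE /= distrC.
Qed.

(** Lebesgue number argument: a property of small scales that holds near each
    point of a compact set holds at a uniform scale. *)
Lemma compact_close K (P : R -> T * R -> Prop) : compact K ->
  (forall z, K z -> exists2 om : R, 0 < om & forall z', close om z' z ->
     forall rho, 0 < rho -> rho < om -> P rho z') ->
  exists2 om : R, 0 < om & forall rho, 0 < rho -> rho < om -> forall z, K z -> P rho z.
Proof.
move=> /compact_near_coveringP cK H.
have [|om /= om0 Hom] := cK R (0^'+) P _.
- move=> z Kz; have [om om0 Hom] := H z Kz.
  exists ([set z' | close om z' z], [set rho | 0 < rho /\ rho < om]).
    split; first exact: nbhs_close.
    by near=> rho; split; near: rho; [exact: nbhs_right_gt|exact: nbhs_right_lt].
  by move=> [z' rho] /= [h1 [h2 h3]]; exact: Hom.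
exists om => // rho r0 r1 z Kz; apply: Hom => //=.
by rewrite sub0r normrN gtr0_norm.
Unshelve. all: by end_near. Qed.

Definition usc_on A f : Prop := forall z, A z -> forall c, f z < c ->
  exists2 om : R, 0 < om & forall z', A z' -> close om z' z -> f z' < c.

Lemma USC_usc_on A f : USC A f -> usc_on A f.
Proof.
move=> uf z Az c fc; have : ((- c)%:E < (- f z)%:E)%E by rewrite lte_fin ltrN2.
move=> /(uf z (- c)) [V].
move=> zV; have : within A (nbhs z) V by rewrite (nbhs_subspace_in Az).
move=> /nbhs_closeP[om om0 H1] H2.
exists om => // z' Az' zz'; have := H2 z' (H1 z' zz' Az').
by rewrite lte_fin ltrN2.
Qed.

Lemma usc_on_cst_add A f (h : T * R -> R) : usc_on A f ->
  (forall z, A z -> forall e, 0 < e -> exists2 om : R, 0 < om &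
     forall z', A z' -> close om z' z -> h z' < h z + e) ->
  usc_on A (fun z => f z + h z).
Proof.
move=> uf uh z Az c fc; pose e := (c - (f z + h z)) / 2.
have e0 : 0 < e by rewrite /e; lra.
have fe : f z < f z + e by lra.
have [om1 om10 H1] := uf z Az (f z + e) fe.
have [om2 om20 H2] := uh z Az e e0.
exists (Num.min om1 om2); first by rewrite lt_min om10.
move=> z' Az' zz'; have := H1 z' Az' (close_le _ zz').
rewrite ge_min lexx => /(_ isT) h1; have := H2 z' Az' (close_le _ zz').
by rewrite ge_min lexx orbT => /(_ isT) h2; rewrite /e in h1 h2; lra.
Qed.

Lemma usc_on_bounded A f : compact A -> usc_on A f ->
  exists B : R, forall z, A z -> f z <= B.
Proof.
move=> cA uf.
have [om om0 H] : exists2 om : R, 0 < om & forall rho, 0 < rho -> rho < om ->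
    forall z, A z -> (fun rho z => A z -> f z <= rho^-1) rho z.
  apply: compact_close => // z Az.
  have fe : f z < `|f z| + 1 by have := ler_norm (f z); lra.
  have [om1 om10 H1] := uf z Az (`|f z| + 1) fe.
  have b0 : 0 < `|f z| + 1 by rewrite ltr_pwDr.
  exists (Num.min om1 (`|f z| + 1)^-1); first by rewrite lt_min om10 invr_gt0.
  move=> z' zz' rho r0; rewrite lt_min => /andP[_ r1] Az'.
  have := H1 z' Az' (close_le _ zz'); rewrite ge_min lexx => /(_ isT) h.
  apply: (le_trans (ltW h)).
  by rewrite -[X in X <= _]invrK lef_pV2 ?posrE ?invr_gt0 // ltW.
exists (om / 2)^-1 => z Az; apply: (H (om / 2)) => //; lra.
Qed.

Lemma usc_on_max A f : compact A -> A !=set0 -> usc_on A f ->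
  exists2 z, A z & forall z', A z' -> f z' <= f z.
Proof.
move=> cA [z0 Az0] uf; have [B HB] := usc_on_bounded cA uf.
pose E := [set f z | z in A].
have hE : has_sup E by split; [exists (f z0); exists z0|exists B => _ [z Az <-]; exact: HB].
apply: contrapT => Hno.
have lt z : A z -> f z < sup E.
  move=> Az; rewrite lt_neqAle; apply/andP; split; last first.
    by apply: ub_le_sup; [exact: hE.2|exists z].
  apply/eqP => fz; apply: Hno; exists z => // z' Az'; rewrite fz.
  by apply: ub_le_sup; [exact: hE.2|exists z'].
have [om om0 H] : exists2 om : R, 0 < om & forall rho, 0 < rho -> rho < om ->
    forall z, A z -> (fun rho z => A z -> f z <= sup E - rho) rho z.
  apply: compact_close => // z Az; pose e := (sup E - f z) / 2.
  have e0 : 0 < e by rewrite /e; have := lt z Az; lra.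
  have fe : f z < f z + e by lra.
  have [om1 om10 H1] := uf z Az (f z + e) fe.
  exists (Num.min om1 e); first by rewrite lt_min om10.
  move=> z' zz' rho r0; rewrite lt_min => /andP[_ r1] Az'.
  have := H1 z' Az' (close_le _ zz'); rewrite ge_min lexx => /(_ isT) h.
  by rewrite /e in h r1 *; lra.
have : sup E <= sup E - om / 2.
  apply: ge_sup; first exact: hE.1.
  by move=> _ [z Az <-]; apply: H => //; lra.
by lra.
Qed.

Lemma sqdist_lip (M : R) z z' w : enorm (z.1 - w.1) <= M -> enorm (z'.1 - w.1) <= M ->
  `|z.2 - w.2| <= M -> `|z'.2 - w.2| <= M ->
  forall om, close om z' z -> `|sqdist z' w - sqdist z w| <= 4 * M * om.
Proof.
move=> h1 h2 h3 h4 om [c1 c2].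
have M0 : 0 <= M by apply: le_trans h1; exact: enorm_ge0.
have k1 : `|enorm (z'.1 - w.1) ^+ 2 - enorm (z.1 - w.1) ^+ 2| <= 2 * M * om.
  rewrite subr_sqr normrM mulrC ler_pM //.
    by rewrite ger0_norm ?addr_ge0 ?enorm_ge0 //; lra.
  apply: (le_trans (enorm_dist _ _)); rewrite opprB addrA subrK; exact: ltW.
have k2 : `|(z'.2 - w.2) ^+ 2 - (z.2 - w.2) ^+ 2| <= 2 * M * om.
  rewrite subr_sqr normrM mulrC ler_pM //.
    by apply: (le_trans (ler_normD _ _)); lra.
  by rewrite opprB addrA subrK; exact: ltW.
rewrite /sqdist (_ : _ - _ = (enorm (z'.1 - w.1) ^+ 2 - enorm (z.1 - w.1) ^+ 2) +
  ((z'.2 - w.2) ^+ 2 - (z.2 - w.2) ^+ 2)); last by ring.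
by apply: (le_trans (ler_normD _ _)); lra.
Qed.

(** The supremum is required to be attained: the maximum points are what is used
    of a sup-convolution. *)
Definition supconv A (n : R) f V : Prop := forall z,
  (forall z', A z' -> f z' - n * sqdist z z' <= V z) /\
  exists2 z', A z' & V z = f z' - n * sqdist z z'.

Lemma sqdist_near z w (e : R) : 0 < e -> exists2 om : R, 0 < om &
  forall z', close om z' z -> `|sqdist z' w - sqdist z w| < e.
Proof.
move=> e0; have := @sqdist_continuous R d w z.
move=> /cvgrPdist_lt /(_ e e0) /nbhs_closeP[om om0 H]; exists om => // z' /H.
by rewrite distrC.
Qed.

Lemma supconv_exists A (n : R) f : compact A -> A !=set0 -> usc_on A f ->
  exists V, supconv A n f V.
Proof.
move=> cA A0 uf.
have [Z HZ] : {Z : T * R -> T * R & forall z, A (Z z) /\ forall z', A z' ->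
    f z' - n * sqdist z z' <= f (Z z) - n * sqdist z (Z z)}.
  apply: (@choice _ _ (fun z Zz => A Zz /\ forall z', A z' ->
    f z' - n * sqdist z z' <= f Zz - n * sqdist z Zz)) => z.
  have [|y Ay Hy] := usc_on_max cA A0 (f := fun z' => f z' + - (n * sqdist z z')).
    apply: usc_on_cst_add => // y Ay e e0.
    have e1 : 0 < e / (`|n| + 1) by rewrite divr_gt0 // ltr_pwDr.
    have [om om0 H] := sqdist_near y z e1; exists om => // y' Ay' yy'.
    have n1 : 0 < `|n| + 1 by rewrite ltr_pwDr.
    have := H y' yy'; rewrite ltr_pdivlMr // => h.
    rewrite -ltrBlDl (sqdistC z y') (sqdistC z y) opprK addrC -mulrBr.
    rewrite (_ : sqdist y z - _ = - (sqdist y' z - sqdist y z)); last by ring.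
    rewrite mulrN; apply: (le_lt_trans (ler_norm _)); rewrite normrN normrM.
    by apply: le_lt_trans h; rewrite mulrC ler_wpM2l //; lra.
  by exists y.
exists (fun z => f (Z z) - n * sqdist z (Z z)) => z; have [h1 h2] := HZ z.
by split => //; exists (Z z).
Qed.

(** A supremum of functions of [z] that are Lipschitz with the same constant. *)
Lemma supconv_cont A (n M : R) f V : 0 <= n ->
  (forall z, A z -> enorm z.1 <= M /\ `|z.2| <= M) -> supconv A n f V ->
  forall z e, 0 < e -> exists2 om : R, 0 < om &
    forall z', close om z' z -> `|V z' - V z| < e.
Proof.
move=> n0 HM HV z e e0.
pose L := 4 * (enorm z.1 + `|z.2| + 1 + M).
have [_ [w0 Aw0 _]] := HV z; have [hM _] := HM w0 Aw0.
have M0 : 0 <= M by apply: le_trans hM; exact: enorm_ge0.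
have z10 := enorm_ge0 z.1; have z20 := normr_ge0 z.2.
have L0 : 0 <= L by rewrite /L; lra.
have nL : 0 < n * L + 1 by rewrite ltr_wpDl // mulr_ge0.
have omE : 0 < e / (n * L + 1) by rewrite divr_gt0.
exists (Num.min 1 (e / (n * L + 1))); first by rewrite lt_min ltr01.
set om := Num.min _ _ => z' zz'.
have om0 : 0 < om by rewrite lt_min ltr01.
have om1 : om <= 1 by rewrite ge_min lexx.
have small : n * (L * om) < e.
  have : om <= e / (n * L + 1) by rewrite ge_min lexx orbT.
  rewrite ler_pdivlMr // mulrDr mulr1 => h.
  have : n * (L * om) = om * (n * L) by ring.
  by lra.
have key y : A y -> `|sqdist z' y - sqdist z y| <= L * om.
  move=> Ay; have [y1 y2] := HM y Ay; have [c1 c2] := zz'.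
  have b1 := enorm_triangle z.1 (- y.1); rewrite enormN in b1.
  have b2 := enorm_triangle (z'.1 - z.1) (z.1 - y.1); rewrite addrA subrK in b2.
  have b3 := ler_normB z.2 y.2.
  have b4 := ler_normD (z'.2 - z.2) (z.2 - y.2); rewrite addrA subrK in b4.
  by apply: sqdist_lip zz'; lra.
rewrite ltr_norml; apply/andP; split.
  have [_ [y Ay ->]] := HV z; have [h _] := HV z'; have := h y Ay.
  have := ler_wpM2l n0 (key y Ay); have := ler_norm (sqdist z' y - sqdist z y).
  by move=> /(ler_wpM2l n0); rewrite mulrBr; lra.
have [_ [y Ay ->]] := HV z'; have [h _] := HV z; have := h y Ay.
have := ler_wpM2l n0 (key y Ay); have := ler_norm (- (sqdist z' y - sqdist z y)).
by rewrite normrN => /(ler_wpM2l n0); rewrite mulrN mulrBr; lra.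
Qed.

End Semicontinuity.

(** * Localization of the doubled maximum *)

Section Strips.
Variables (R : realType) (d : nat) (Omega : set 'rV[R]_d).
Local Notation mu := (lebesgue_rV R d).
Local Notation T := 'rV[R]_d.
Hypotheses (oO : open Omega) (bO : bounded_set Omega).

(** The points at distance at least [r] from the complement of [Omega]. *)
Definition deep (r : R) : set T := [set x | eball x r `<=` Omega].

Lemma deep_sub r : 0 < r -> deep r `<=` Omega.
Proof. by move=> r0 x; apply; rewrite /eball /= subrr enorm0. Qed.

Lemma deep_le r r' : r <= r' -> deep r' `<=` deep r.
Proof. by move=> rr x Dx y xy; apply: Dx; exact: lt_le_trans xy rr. Qed.

Lemma closed_deep r : closed (deep r).
Proof.
rewrite (_ : deep r = ~` \bigcup_(y in ~` Omega) eball y r).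
  by apply: open_closedC; apply: bigcup_open => y _; exact: open_eball.
apply/seteqP; split=> [x Dx [y Oy]|x H y xy].
  by rewrite /eball /= enormB => xy; exact/Oy/Dx.
apply: contrapT => Oy; apply: H; exists y => //.
by rewrite /eball /= enormB.
Qed.

Lemma bounded_enorm : exists2 M : R, 0 < M & forall x, closure Omega x -> enorm x <= M.
Proof.
have [M0 [_ /(_ (`|M0| + 1))]] := bO.
rewrite (le_lt_trans (ler_norm M0)) ?ltrDl // => /(_ isT) H.
exists (d%:R * (`|M0| + 1) + 1); first by rewrite ltr_wpDl // mulr_ge0 // addr_ge0.
move=> x /(_ (eball x 1)) [|y [Oy xy]]; first exact: nbhs_eball.
have := enorm_triangle (x - y) y; rewrite subrK => h; apply: (le_trans h).
rewrite addrC lerD //; last by move: xy; rewrite /eball /= enormB => /ltW.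
apply: (le_trans (enorm_le_norm _)); rewrite ler_wpM2l //.
exact: (H y Oy).
Qed.

Lemma compact_closure : compact (closure Omega).
Proof.
apply: bounded_closed_compact; last exact: closed_closure.
have [M M0 HM] := bounded_enorm.
exists M; split; first exact: num_real.
move=> M' MM' x /= Ox; apply: (le_trans (norm_le_enorm _)).
exact: le_trans (HM x Ox) (ltW MM').
Qed.

Lemma compact_deep r : 0 < r -> compact (deep r).
Proof.
move=> r0; apply: (@subclosed_compact _ (deep r) (closure Omega)).
- exact: closed_deep.
- exact: compact_closure.
by move=> x /(deep_sub r0) Ox; exact: subset_closure.
Qed.

Lemma measurable_Omega : measurable Omega.
Proof. exact: open_measurable_rV. Qed.

Lemma Omega_fin : (mu Omega < +oo)%E.
Proof.
have [M M0 HM] := bounded_enorm.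
apply: (@le_lt_trans _ _ (mu (eball 0 (M + 1)))); last exact: lebesgue_eball_fin.
apply: le_measure; rewrite ?inE; [exact: measurable_Omega|exact: measurable_eball|].
move=> x Ox; rewrite /eball /= subr0.
by have := HM x (subset_closure Ox); lra.
Qed.

Lemma measurable_strip r : measurable (Omega `\` deep r).
Proof.
by apply: measurableD; [exact: measurable_Omega|apply: closed_measurable_rV; exact: closed_deep].
Qed.

(** The strips decrease to the empty set, since [Omega] is open. *)
Lemma strip_small (dl : R) : 0 < dl ->
  exists2 r : R, 0 < r & (mu (Omega `\` deep r) <= dl%:E)%E.
Proof.
move=> dl0; pose F n := Omega `\` deep n.+1%:R^-1.
have cv : mu \o F @ \oo --> mu (\bigcap_n F n).
  apply: nonincreasing_cvg_mu.
  - apply: le_lt_trans Omega_fin; apply: le_measure; rewrite ?inE.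
    + exact: measurable_strip.
    + exact: measurable_Omega.
    + by move=> x [].
  - by move=> n; exact: measurable_strip.
  - by apply: bigcap_measurable => // n _; exact: measurable_strip.
  move=> n m nm; apply/subsetPset => x [Ox Dx]; split=> // Dn; apply: Dx.
  by apply: deep_le Dn; rewrite lef_pV2 ?posrE // ler_nat.
have F0 : \bigcap_n F n = set0.
  apply/seteqP; split=> // x H.
  have Ox : Omega x by have [] := H 0%N I.
  have [r r0 rO] := nbhs_eballP (open_nbhs_nbhs (conj oO Ox)).
  have [_] := H (Num.truncn r^-1) I; apply => y xy; apply: rO.
  apply: (lt_le_trans xy); rewrite -[X in _ <= X]invrK lef_pV2 ?posrE ?invr_gt0 //.
  by apply: ltW; exact: truncnS_gt.
rewrite F0 measure0 in cv.
have : \forall n \near \oo, ((mu \o F) n < dl%:E)%E.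
  by apply: (cv [set y | (y < dl%:E)%E]); apply: open_ereal_lt'; rewrite lte_fin.
move=> [n _ /(_ n (leqnn n)) /= H].
by exists n.+1%:R^-1 => //; exact: ltW.
Qed.

End Strips.

Section Localization.
Variables (R : realType) (d : nat) (Omega : set 'rV[R]_d) (t1 t2 : R).
Local Notation T := 'rV[R]_d.
Hypotheses (oO : open Omega) (bO : bounded_set Omega).
Variables (f g : T * R -> R).
Local Notation A := (closure Omega `*` `[t1, t2]%classic).
Hypotheses (uf : usc_on A f) (ug : usc_on A g).
Hypothesis lateral : forall x t, boundary Omega x -> t1 < t <= t2 -> f (x, t) + g (x, t) <= 0.
Hypothesis initial : forall x, Omega x -> f (x, t1) + g (x, t1) <= 0.

Lemma cylA_compact (a b : R) : compact (closure Omega `*` `[a, b]%classic).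
Proof. by apply: compact_setX; [exact: compact_closure|exact: segment_compact]. Qed.

Lemma sum_usc z c : A z -> f z + g z < c -> exists2 om : R, 0 < om &
  forall z1 z2, A z1 -> A z2 -> close om z1 z -> close om z2 z -> f z1 + g z2 < c.
Proof.
move=> Az fgc; pose e := (c - (f z + g z)) / 2.
have e0 : 0 < e by rewrite /e; lra.
have h1 : f z < f z + e by lra.
have h2 : g z < g z + e by lra.
have [om1 om10 H1] := uf Az h1; have [om2 om20 H2] := ug Az h2.
exists (Num.min om1 om2); first by rewrite lt_min om10.
move=> z1 z2 A1 A2 c1 c2.
have := H1 z1 A1 (close_le _ c1); rewrite ge_min lexx => /(_ isT).
have := H2 z2 A2 (close_le _ c2); rewrite ge_min lexx orbT => /(_ isT).
by rewrite /e; lra.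
Qed.

Lemma eball_sub (x y : T) (r r' : R) : enorm (y - x) + r <= r' -> eball y r `<=` eball x r'.
Proof.
move=> h z; rewrite /eball /= => zy.
by have := enorm_triangle (z - y) (y - x); rewrite addrA subrK; lra.
Qed.

(** A point of the compact lateral cylinder where [f + g] is positive is
    interior; by compactness this holds with a uniform radius, and also for
    [f] and [g] evaluated at different but close points. *)
Lemma interior_scale (t' kappa : R) : t1 < t' -> 0 < kappa ->
  exists2 rho0 : R, 0 < rho0 & forall rho, 0 < rho -> rho < rho0 ->
  forall z, A z -> t' <= z.2 -> forall z1 z2, A z1 -> A z2 ->
  close rho z1 z -> close rho z2 z -> kappa <= f z1 + g z2 ->
  deep Omega rho z1.1 /\ deep Omega rho z2.1.
Proof.
move=> tt k0.
pose P rho z := forall z1 z2, A z1 -> A z2 ->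
  close rho z1 z -> close rho z2 z -> kappa <= f z1 + g z2 ->
  deep Omega rho z1.1 /\ deep Omega rho z2.1.
have [||rho0 r0 H] := @compact_close R d (closure Omega `*` `[t', t2]%classic) P.
- exact: cylA_compact.
- move=> z [/= Oz]; rewrite in_itv /= => /andP[tz zt].
  have Az : A z by split; rewrite //= in_itv /= zt andbT; lra.
  have [fgk|fgk] := ltP (f z + g z) kappa.
    have [om om0 Hom] := sum_usc Az fgk.
    exists (om / 2); first by rewrite divr_gt0.
    move=> z' zz' rho r0 r1 z1 z2 A1 A2 c1 c2.
    rewrite leNgt Hom //; [apply: (close_trans c1 zz')|apply: (close_trans c2 zz')]; lra.
  have Oz1 : Omega z.1.
    apply: contrapT => nO; have : f z + g z <= 0.
      case: z Oz tz zt {Az} fgk nO => x t /= Ox tx xt _ nO.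
      apply: lateral; last by apply/andP; split => //; lra.
      by split => // /interior_subset.
    lra.
  have [r r0 rO] := nbhs_eballP (open_nbhs_nbhs (conj oO Oz1)).
  exists (r / 3); first by rewrite divr_gt0.
  move=> z' [zz' _] rho rho0 rho1 z1 z2 A1 A2 [c1 _] [c2 _] _; split.
    apply: subset_trans rO; apply: eball_sub.
    by have := enorm_triangle (z1.1 - z'.1) (z'.1 - z.1); rewrite addrA subrK; lra.
  apply: subset_trans rO; apply: eball_sub.
  by have := enorm_triangle (z2.1 - z'.1) (z'.1 - z.1); rewrite addrA subrK; lra.
exists rho0 => // rho h1 h2 z [/= Oz]; rewrite in_itv /= => /andP[_ zt] tz.
by apply: (H rho h1 h2); split => //=; rewrite in_itv /= tz zt.
Qed.

(** The same compactness argument at the initial time, away from the lateral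
    boundary: the corner is excluded. *)
Lemma initial_scale (r kappa : R) : t1 <= t2 -> 0 < r -> 0 < kappa ->
  exists2 rho0 : R, 0 < rho0 & forall rho, 0 < rho -> rho < rho0 ->
  forall x, deep Omega r x -> forall z1 z2, A z1 -> A z2 ->
  close rho z1 (x, t1) -> close rho z2 (x, t1) -> f z1 + g z2 < kappa.
Proof.
move=> t12 r0 k0.
pose P rho z := forall z1 z2, A z1 -> A z2 ->
  close rho z1 z -> close rho z2 z -> f z1 + g z2 < kappa.
have [||rho0 rr H] := @compact_close R d (deep Omega r `*` [set t1]) P.
- by apply: compact_setX; [exact: compact_deep|exact: compact_set1].
- move=> [x t] [/= /(deep_sub r0) Ox ->].
  have Az : A (x, t1) by split; rewrite /= ?in_itv /= ?lexx //; exact: subset_closure.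
  have fgk : f (x, t1) + g (x, t1) < kappa by have := initial Ox; lra.
  have [om om0 Hom] := sum_usc Az fgk.
  exists (om / 2); first by rewrite divr_gt0.
  move=> z' zz' rho rho0 rho1 z1 z2 A1 A2 c1 c2.
  by apply: Hom => //; [apply: (close_trans c1 zz')|apply: (close_trans c2 zz')]; lra.
exists rho0 => // rho h1 h2 x Dx; exact: (H rho h1 h2 (x, t1) (conj Dx erefl)).
Qed.

Variable B : R.
Hypothesis fB : forall z, A z -> f z <= B.
Hypothesis gB : forall z, A z -> g z <= B.

Lemma sqdist_close (om : R) (z w : T * R) : 0 < om -> sqdist z w < om ^+ 2 -> close om z w.
Proof.
move=> om0 h; have h1 := sqr_ge0 (enorm (z.1 - w.1)); have h2 := sqr_ge0 (z.2 - w.2).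
rewrite /sqdist in h; split.
  by rewrite -(ltr_pXn2r (n := 2)) // ?nnegrE ?enorm_ge0 ?(ltW om0) //; lra.
rewrite -(ltr_pXn2r (n := 2)) // ?nnegrE ?(ltW om0) // -normrX ger0_norm //; lra.
Qed.

(** The upper bound [B] limits the penalization that a nonnegative sum can pay. *)
Lemma penalty_close (om : R) : 0 < om -> exists2 N0 : R, 1 <= N0 &
  forall N, N0 <= N -> forall z z1 z2, A z1 -> A z2 ->
  0 <= f z1 + g z2 - N * (sqdist z z1 + sqdist z z2) ->
  close om z1 z /\ close om z2 z.
Proof.
move=> om0; pose N0 := 2 * `|B| / om ^+ 2 + 1.
have o2 : 0 < om ^+ 2 by rewrite exprn_gt0.
have N01 : 1 <= N0 by rewrite lerDr divr_ge0 ?mulr_ge0 // ltW.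
exists N0 => // N NN0 z z1 z2 A1 A2 h.
have f1 := fB A1; have g2 := gB A2.
have s1 := sqdist_ge0 z z1; have s2 := sqdist_ge0 z z2.
have N0E : N0 * om ^+ 2 = 2 * `|B| + om ^+ 2.
  by rewrite /N0 mulrDl mul1r divfK // gt_eqF.
have BB := ler_norm B.
have hN : N * (sqdist z z1 + sqdist z z2) < N * om ^+ 2.
  apply: (@lt_le_trans _ _ (N0 * om ^+ 2)); first by rewrite N0E; lra.
  by rewrite ler_wpM2r // ltW.
have {}hN : sqdist z z1 + sqdist z z2 < om ^+ 2.
  by move: hN; rewrite ltr_pM2l //; lra.
by split; apply: closeC; apply: sqdist_close => //; lra.
Qed.

(** The radius [rho0] depends on [t'] and [kappa] only; the closeness [om] of the
    maximum points can be prescribed afterwards. *)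
Lemma localize (t' kappa : R) : t1 < t' -> 0 < kappa ->
  exists2 rho0 : R, 0 < rho0 & forall om, 0 < om -> exists2 N0 : R, 1 <= N0 &
  forall N, N0 <= N -> forall z z1 z2, A z1 -> A z2 -> t' <= z.2 ->
  kappa <= f z1 + g z2 - N * (sqdist z z1 + sqdist z z2) ->
  [/\ close om z1 z, close om z2 z, deep Omega rho0 z1.1, deep Omega rho0 z2.1 &
      (t1 + t') / 2 <= z1.2 /\ (t1 + t') / 2 <= z2.2].
Proof.
move=> tt k0; have ht : t1 < (t1 + t') / 2 by lra.
have [rho0 r0 H] := interior_scale ht k0.
exists (rho0 / 2); first by rewrite divr_gt0.
move=> om om0; pose om' := Num.min om (Num.min ((t' - t1) / 2) (rho0 / 4)).
have om'0 : 0 < om' by rewrite !lt_min om0 !divr_gt0 // subr_gt0.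
have [N0 N01 HN] := penalty_close om'0; exists N0 => // N NN0 z z1 z2 A1 A2 tz h.
have [|c1 c2] := HN N NN0 z z1 z2 A1 A2; first by lra.
have oo : om' <= om by rewrite ge_min lexx.
have ot : om' <= (t' - t1) / 2 by rewrite !ge_min lexx orbT.
have orr : om' <= rho0 / 4 by rewrite !ge_min lexx !orbT.
have k12 : kappa <= f z1 + g z2.
  have Np : 0 <= N by lra.
  have : 0 <= N * (sqdist z z1 + sqdist z z2).
    by apply: mulr_ge0 => //; apply: addr_ge0; exact: sqdist_ge0.
  by lra.
have b1 : (t1 + t') / 2 <= z1.2.
  by case: c1 => _; rewrite ltr_norml => /andP[]; lra.
have b2 : (t1 + t') / 2 <= z2.2.
  by case: c2 => _; rewrite ltr_norml => /andP[]; lra.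
have h2 : rho0 / 2 < rho0 by lra.
have h0 : 0 < rho0 / 2 by lra.
have [||d1 d2] := H (rho0 / 2) h0 h2 z1 A1 b1 z1 z2 A1 A2 _ _ k12.
- exact: close_refl.
- by apply: (close_trans c2 (closeC c1)); lra.
by split => //; [exact: close_le c1|exact: close_le c2].
Qed.

(** At a suitable time close to [t1] the doubled maximum reaches [kappa] only
    above points of the strip [Omega] minus [deep r]. *)
Lemma localize_initial (r kappa tb : R) : t1 < tb -> tb <= t2 -> 0 < r -> 0 < kappa ->
  exists2 t' : R, t1 < t' < tb & exists2 N0 : R, 1 <= N0 &
  forall N, N0 <= N -> forall x z1 z2, deep Omega r x -> A z1 -> A z2 ->
  f z1 + g z2 - N * (sqdist (x, t') z1 + sqdist (x, t') z2) < kappa.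
Proof.
move=> h1 h2 r0 k0; have t12 : t1 <= t2 by lra.
have [rho0 rr H] := initial_scale t12 r0 k0.
pose a := Num.min rho0 (tb - t1) / 4.
have m0 : 0 < Num.min rho0 (tb - t1) by rewrite lt_min rr subr_gt0.
have a0 : 0 < a by rewrite divr_gt0.
have a1 : 4 * a <= rho0.
  by rewrite /a mulrC divfK // ge_min lexx.
have a2 : 4 * a <= tb - t1.
  by rewrite /a mulrC divfK // ge_min lexx orbT.
exists (t1 + a); first by apply/andP; split; lra.
have [N0 N01 HN] := penalty_close a0; exists N0 => // N NN0 x z1 z2 Dx A1 A2.
rewrite ltNge; apply/negP => h.
have [|c1 c2] := HN N NN0 (x, t1 + a) z1 z2 A1 A2; first by lra.
have N0' : 0 <= N by lra.
have s1 := sqdist_ge0 (x, t1 + a) z1; have s2 := sqdist_ge0 (x, t1 + a) z2.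
have : f z1 + g z2 < kappa.
  have ct : close (2 * a) (x, t1 + a) (x, t1).
    split => /=; first by rewrite subrr enorm0; lra.
    by rewrite (_ : t1 + a - t1 = a) ?gtr0_norm //; lra.
  apply: (H (3 * a)) Dx _ _ A1 A2 _ _; [lra|lra| |].
  - by apply: (close_trans c1 ct); lra.
  - by apply: (close_trans c2 ct); lra.
have : 0 <= N * (sqdist (x, t1 + a) z1 + sqdist (x, t1 + a) z2).
  by rewrite mulr_ge0 // addr_ge0.
by lra.
Qed.

End Localization.

Section SupconvSlices.
Variables (R : realType) (d : nat) (t1 t2 : R) (Omega : set 'rV[R]_d).
Local Notation T := 'rV[R]_d.
Local Notation A := (closure Omega `*` `[t1, t2]%classic).
Hypothesis bO : bounded_set Omega.

Lemma cylA_bounded : exists M : R, forall z : T * R, A z -> enorm z.1 <= M /\ `|z.2| <= M.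
Proof.
have [M M0 HM] := bounded_enorm bO; exists (M + `|t1| + `|t2|) => z [/= /HM h1].
rewrite in_itv /= => /andP[h2 h3]; have n1 := normr_ge0 t1; have n2 := normr_ge0 t2.
have k1 := ler_norm t2; have k2 := ler_norm (- t1); rewrite normrN in k2.
by split; [lra|rewrite ler_norml; apply/andP; split; lra].
Qed.

Lemma supconv_measurable (n : R) (f V : T * R -> R) t : 0 <= n -> supconv A n f V ->
  measurable_fun setT (fun x => V (x, t)).
Proof.
move=> n0 HV; have [M HM] := cylA_bounded.
apply: measurable_open_superlevel => c; rewrite openE => x /= xc.
have e0 : 0 < V (x, t) - c by lra.
have [om om0 H] := supconv_cont n0 HM HV (x, t) e0.
apply: filterS (nbhs_eball x om0) => y yx.
have /H : close om (y, t) (x, t) by split; rewrite //= subrr normr0.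
by rewrite ltr_norml /= => /andP[]; lra.
Qed.

Lemma supconv_le (n B : R) (f V : T * R -> R) z : 0 <= n -> supconv A n f V ->
  (forall z, A z -> f z <= B) -> V z <= B.
Proof.
move=> n0 HV fB; have [_ [y Ay ->]] := HV z; have := fB y Ay.
by have := mulr_ge0 n0 (sqdist_ge0 z y); lra.
Qed.

(** The maximum point for time [t] is a competitor for time [t - h]; this replaces
    differentiability in time. *)
Lemma supconv_step (n t h : R) (f V : T * R -> R) x z : supconv A n f V -> A z ->
  V (x, t) = f z - n * sqdist (x, t) z ->
  V (x, t) - V (x, t - h) <= h * (2 * n * (z.2 - t)) + n * h ^+ 2.
Proof.
move=> HV Az VE; have [H _] := HV (x, t - h); have := H z Az.
have -> : sqdist (x, t - h) z = sqdist (x, t) z - 2 * h * (t - z.2) + h ^+ 2.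
  by rewrite /sqdist /=; ring.
move=> {}H; have -> : h * (2 * n * (z.2 - t)) + n * h ^+ 2 =
  n * (sqdist (x, t) z - 2 * h * (t - z.2) + h ^+ 2) - n * sqdist (x, t) z by ring.
lra.
Qed.

End SupconvSlices.

(** * Inequalities at the maximum points *)

Section Representatives.
Variables (R : realType) (d : nat) (s p t1 t2 : R) (Omega : set 'rV[R]_d).
Local Notation mu := (lebesgue_rV R d).
Local Notation T := 'rV[R]_d.
Hypotheses (s_gt0 : 0 < s) (s_lt1 : s < 1) (p_gt2 : 2 < p).
Local Notation A := (closure Omega `*` `[t1, t2]%classic).

(** The slice of [f] is Borel on the closed domain by semicontinuity; outside, where
    only Lebesgue measurability is known, [g] takes over. *)
Lemma measurable_usc_slice (f : T * R -> R) (g : T -> R) t : usc_on A f ->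
  t1 <= t <= t2 -> measurable_fun setT g ->
  measurable_fun setT (fun y => if y \in closure Omega then f (y, t) else g y).
Proof.
move=> uf /andP[h1 h2] mg.
set h := (h in measurable_fun _ h).
pose Oc c : set T := [set y | exists2 r : R, 0 < r & forall y', closure Omega y' ->
  enorm (y' - y) < r -> f (y', t) < c].
have oOc c : open (Oc c).
  rewrite openE => y [r r0 H]; rewrite /interior.
  have r2 : 0 < r / 2 by rewrite divr_gt0.
  apply: filterS (nbhs_eball y r2) => x; rewrite /eball /= => xy.
  exists (r / 2) => // y' Oy' yx; apply: H => //.
  by have := enorm_triangle (y' - x) (x - y); rewrite addrA subrK; lra.
have mcl : measurable (closure Omega).
  by apply: closed_measurable_rV; exact: closed_closure.
move=> mT; apply: (measurability _ (RGenInftyO.measurableE R)) => //.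
move=> _ [_ [c ->] <-]; rewrite setTI.
rewrite (_ : _ @^-1` _ = (closure Omega `&` Oc c) `|`
    (~` closure Omega `&` (g @^-1` `]-oo, c[%classic))).
  apply: measurableU.
    by apply: measurableI => //; exact: open_measurable_rV.
  apply: measurableI; first exact: measurableC.
  by rewrite -[X in measurable X]setTI; exact: mg.
apply/seteqP; split=> [y|y []].
- rewrite /= /h in_itv /=; case: ifPn => [/set_mem Oy fc|/negP Oy gc].
    left; split => //.
    have Ay : A (y, t) by split => //=; rewrite in_itv /= h1.
    have [om om0 H] := uf _ Ay c fc; exists om => // y' Oy' yy'.
    apply: H; first by split => //=; rewrite in_itv /= h1.
    by split => //=; rewrite subrr normr0.
  right; split; last by rewrite /= in_itv.
  by move=> Oy'; apply: Oy; rewrite inE.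
- move=> [Oy [r r0 H]]; rewrite /= /h in_itv /= mem_set //; apply: H => //.
  by rewrite subrr enorm0.
move=> [Oy]; rewrite /= /h !in_itv /= memNset //.
Qed.

(** Exactness on the closed domain is needed because the maximum property is a
    pointwise one. *)
Definition good_rep (f : T * R -> R) (t : R) (h : T -> R) : Prop :=
  [/\ tail_rep (fun y => f (y, t)) h, tail_integ s p h &
      forall y, closure Omega y -> h y = f (y, t)].

Lemma Cloc_slice (f : T * R -> R) t : Cloc_tail s p t1 t2 f -> t1 < t -> t <= t2 ->
  tail_space s p (fun x => f (x, t)).
Proof.
move=> fC h1 h2; have [] // := fC t t h1 (lexx t) h2 t.
by rewrite /= in_itv /= lexx.
Qed.

Lemma good_rep_exists (f : T * R -> R) t : Cloc_tail s p t1 t2 f -> t1 < t -> t <= t2 ->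
  (forall g : T -> R, measurable_fun setT g ->
    measurable_fun setT (fun y => if y \in closure Omega then f (y, t) else g y)) ->
  exists h, good_rep f t h.
Proof.
move=> fC h1 h2 Hm; have ts := Cloc_slice fC h1 h2.
have [[g mg fg] _] := ts.
pose h y := if y \in closure Omega then f (y, t) else g y.
have rh : tail_rep (fun y => f (y, t)) h.
  split; first exact: Hm.
  by apply: filterS fg => y fgy; rewrite /h; case: ifP.
exists h; split => //.
- by split; [case: rh|exact: tail_rep_integ ts rh].
- by move=> y Oy; rewrite /h mem_set.
Qed.

Lemma good_rep_usc (f : T * R -> R) t : usc_on A f -> Cloc_tail s p t1 t2 f ->
  t1 < t -> t <= t2 -> exists h, good_rep f t h.
Proof.
move=> uf fC h1 h2; apply: good_rep_exists => // g mg.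
by apply: measurable_usc_slice => //; rewrite h2 ltW.
Qed.

Lemma good_rep_lsc (f : T * R -> R) t : usc_on A (fun z => - f z) ->
  Cloc_tail s p t1 t2 f -> t1 < t -> t <= t2 -> exists h, good_rep f t h.
Proof.
move=> uf fC h1 h2; apply: good_rep_exists => // g mg.
have h12 : t1 <= t <= t2 by rewrite h2 ltW.
have mg' : measurable_fun setT (fun y => - g y) by exact: measurable_funN.
have := measurable_funN (measurable_usc_slice uf h12 mg').
congr measurable_fun; apply/funext => y.
by rewrite /=; case: ifP => _; rewrite opprK.
Qed.

(** At a maximum point the paraboloid of the penalization is a test function; the
    part of the operator inside the cylinder is absorbed in [eta]. *)
Lemma sub_test (v : T * R -> R) (N eta : R) : viscosity_subsolution s p Omega t1 t2 v ->
  0 < eta -> exists2 rho1 : R, 0 < rho1 & forall rho, 0 < rho -> rho < rho1 ->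
  forall z z1 f, enorm (z1.1 - z.1) <= 1 -> deep Omega rho z1.1 ->
  t1 <= z1.2 - rho ^+ 2 -> z1.2 <= t2 -> good_rep v z1.2 f ->
  (forall z', A z' -> v z' - N * sqdist z z' <= v z1 - N * sqdist z z1) ->
  2 * N * (z1.2 - z.2) + far_int s p z1.1 (v z1) rho f <= eta.
Proof.
move=> [_ _ vis] eta0.
have [rho1 /andP[r10 r11] H] := @test_paraboloid R d s p s_gt0 s_lt1 p_gt2 N 1 eta eta0.
exists rho1 => // rho r0 r1 z z1 f e1 Dz tz tz2 [rf tf _] Hmax.
have r20 : 0 < rho ^+ 2 by rewrite exprn_gt0.
pose A0 := v z1 - N * sqdist z z1.
have E : paraboloid A0 N z z1 = v z1 by rewrite /paraboloid /A0 sqdistC subrK.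
have z1E : z1 = (z1.1, z1.2) by case: (z1).
have cD : cylinder z1.1 z1.2 rho `<=` Omega `*` `]t1, t2]%classic.
  move=> [y tau] [/= /Dz Oy]; rewrite !in_itv /= => /andP[h1 h2]; split => //=.
  by apply/andP; split; lra.
have [S Se] := H rho z1.1 z1.2 A0 z v f r0 r1 e1 rf tf.
rewrite -z1E E => TE.
have := vis z1.1 z1.2 rho (paraboloid A0 N z) r0 cD (paraboloid_C2 _ _ _ _ _ _).
rewrite -z1E E => /(_ erefl); rewrite TE lee_fin => /(_ _) h.
have {}h : 2 * N * (z1.2 - z.2) + (S + far_int s p z1.1 (v z1) rho f) <= 0.
  apply: h => z' /cD [/= Oz']; rewrite in_itv /= => /andP[h1 h2].
  have Az' : A z' by split => /=; [exact: subset_closure|rewrite in_itv /= h2 ltW].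
  by have := Hmax z' Az'; rewrite /paraboloid /A0 (sqdistC z'); lra.
by have := ler_norm (- S); rewrite normrN; lra.
Qed.

Lemma super_test (u : T * R -> R) (N eta : R) : viscosity_supersolution s p Omega t1 t2 u ->
  0 < eta -> exists2 rho1 : R, 0 < rho1 & forall rho, 0 < rho -> rho < rho1 ->
  forall z z1 f, enorm (z1.1 - z.1) <= 1 -> deep Omega rho z1.1 ->
  t1 <= z1.2 - rho ^+ 2 -> z1.2 <= t2 -> good_rep u z1.2 f ->
  (forall z', A z' -> - u z' - N * sqdist z z' <= - u z1 - N * sqdist z z1) ->
  - eta <= - (2 * N * (z1.2 - z.2)) + far_int s p z1.1 (u z1) rho f.
Proof.
move=> [_ _ vis] eta0.
have [rho1 /andP[r10 r11] H] := @test_paraboloid R d s p s_gt0 s_lt1 p_gt2 (- N) 1 eta eta0.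
exists rho1 => // rho r0 r1 z z1 f e1 Dz tz tz2 [rf tf _] Hmax.
have r20 : 0 < rho ^+ 2 by rewrite exprn_gt0.
pose A0 := u z1 + N * sqdist z z1.
have E : paraboloid A0 (- N) z z1 = u z1 by rewrite /paraboloid /A0 sqdistC mulNr addrK.
have z1E : z1 = (z1.1, z1.2) by case: (z1).
have cD : cylinder z1.1 z1.2 rho `<=` Omega `*` `]t1, t2]%classic.
  move=> [y tau] [/= /Dz Oy]; rewrite !in_itv /= => /andP[h1 h2]; split => //=.
  by apply/andP; split; lra.
have [S Se] := H rho z1.1 z1.2 A0 z u f r0 r1 e1 rf tf.
rewrite -z1E E => TE.
have := vis z1.1 z1.2 rho (paraboloid A0 (- N) z) r0 cD (paraboloid_C2 _ _ _ _ _ _).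
rewrite -z1E E => /(_ erefl); rewrite TE lee_fin => /(_ _) h.
have {}h : 0 <= 2 * - N * (z1.2 - z.2) + (S + far_int s p z1.1 (u z1) rho f).
  apply: h => z' /cD [/= Oz']; rewrite in_itv /= => /andP[h1 h2].
  have Az' : A z' by split => /=; [exact: subset_closure|rewrite in_itv /= h2 ltW].
  by have := Hmax z' Az'; rewrite /paraboloid /A0 (sqdistC z') mulNr; lra.
have := ler_norm S.
have : 2 * - N * (z1.2 - z.2) = - (2 * N * (z1.2 - z.2)) by ring.
by lra.
Qed.

End Representatives.

(** * The contribution of the exterior *)

Section SigmaFiniteCopy.
Variables (R : realType) (d : nat).

(** A copy of [lebesgue_rV] that carries the sigma-finite structure required by
    product measures. *)
Definition leb : set 'rV[R]_d -> \bar R := lebesgue_rV R d.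

HB.instance Definition _ := Measure.copy leb (lebesgue_rV R d).
HB.instance Definition _ := Measure_isSigmaFinite.Build _ _ _ leb
  (@lebesgue_rV_sigma_finite R d).

End SigmaFiniteCopy.

Section Slices.
Variables (R : realType) (d : nat).
Local Notation mu := (lebesgue_rV R d).
Local Notation T := 'rV[R]_d.

Lemma ae_slices (Q : T * measurableTypeR R -> Prop) :
  {ae (mu \x @lebesgue_measure R)%E, forall z, Q z} ->
  {ae @lebesgue_measure R, forall t, {ae mu, forall x, Q (x, t)}}.
Proof.
move=> [N [mN N0 QN]].
have N2 : (@leb R d \x^ @lebesgue_measure R)%E N = 0%E.
  rewrite -N0; apply/esym.
  apply: (@product_measure_unique _ _ _ _ _ (@leb R d) (@lebesgue_measure R)
    (@leb R d \x^ @lebesgue_measure R)%E) => // X Y mX mY.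
  exact: (@product_measure2E _ _ _ _ _ (@leb R d) (@lebesgue_measure R)).
have mf : measurable_fun setT (fun y => mu (ysection N y)).
  exact: (@measurable_fun_ysection _ _ _ _ _ (@leb R d)).
have : (\int[@lebesgue_measure R]_y `|mu (ysection N y)| = 0)%E.
  by rewrite -N2; apply: eq_integral => y _; rewrite gee0_abs.
move=> /(ae_eq_integral_abs _ measurableT mf).1 ae0.
apply: filterS ae0 => t /(_ I) /= Nt.
exists (ysection N t); split => //; first exact: measurable_ysection.
move=> x /= nQ; rewrite /ysection /= inE; exact: (QN (x, t) nQ).
Qed.

Lemma ae_meets_interval (P : R -> Prop) (a b : R) : a < b ->
  {ae @lebesgue_measure R, forall t, P t} -> exists2 t, a < t < b & P t.
Proof.
move=> ab [N [mN N0 PN]]; apply: contrapT => H.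
have sub : `]a, b[%classic `<=` N.
  move=> t; rewrite /= in_itv /= => tab; apply: PN => Pt.
  by apply: H; exists t.
have : ((@lebesgue_measure R) `]a, b[%classic <= 0)%E.
  by rewrite -N0; apply: le_measure; rewrite ?inE.
by rewrite lebesgue_measure_itv /= lte_fin ab -EFinB lee_fin; lra.
Qed.

End Slices.

Section Exterior.
Variables (R : realType) (d : nat) (s p t1 t2 : R) (Omega : set 'rV[R]_d).
Local Notation mu := (lebesgue_rV R d).
Local Notation T := 'rV[R]_d.
Local Notation q := (d%:R + s * p).
Local Notation K := (@kern R d q).
Local Notation W := (@weight R d s p).
Hypotheses (s_gt0 : 0 < s) (s_lt1 : s < 1) (p_gt2 : 2 < p).
Hypotheses (oO : open Omega) (bO : bounded_set Omega).

Let sp0 : 0 < s * p. Proof. by rewrite mulr_gt0 //; have := p_gt2; lra. Qed.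
Let q0 : 0 < q. Proof. by rewrite ltr_wpDl. Qed.
Let pm1 : 0 <= p - 1. Proof. by have := p_gt2; lra. Qed.

Definition ext_int (x : T) (a : R) (f : T -> R) : R :=
  \int[mu]_y (\1_(~` Omega) y * jump s p x a f y).

Lemma dist_le_both (a b c : R) : `|a - b| <= c -> a - b <= c /\ b - a <= c.
Proof. by rewrite ler_norml => /andP[h1 h2]; split => //; lra. Qed.

Lemma le_chain (a1 a2 a3 a4 a5 a6 c : R) : a2 - a1 <= c -> a3 - a2 <= c ->
  a4 <= a3 -> a5 - a4 <= c -> a6 - a5 <= c -> - (c + c + (c + c)) <= a1 - a6.
Proof. lra. Qed.

Lemma deep_dist (r : R) x y : deep Omega r x -> ~ Omega y -> r <= enorm (x - y).
Proof.
move=> Dx Oy; rewrite leNgt; apply/negP => h; apply: Oy; apply: Dx.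
by rewrite /eball /= enormB.
Qed.

Lemma integ_ext (r : R) x a f : 0 < r -> deep Omega r x -> tail_integ s p f ->
  integ mu (fun y => \1_(~` Omega) y * jump s p x a f y).
Proof.
move=> r0 Dx tf; apply: (integ_jump_far s_gt0 p_gt2 a r0 _ _ tf).
  by apply: measurableC; exact: measurable_Omega.
by move=> y Oy xy; apply: Oy; exact: Dx.
Qed.

Lemma powR_near1 (eta : R) : 0 < eta -> exists2 th : R, 0 < th &
  forall r, 0 <= r -> `|r - 1| <= th -> `|r `^ q - 1| <= eta.
Proof.
move=> eta0.
have d1 : derivable (fun x : R => x `^ q) 1 1.
  by apply: derivable_powR; rewrite in_itv /= ltr01.
have cv := differentiable_continuous ((derivable1_diffP _ _).1 d1).
have /cvgrPdist_le /(_ eta eta0) := cv.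
move=> /nbhs_ballP[th /= th0 H]; exists (th / 2); first by rewrite divr_gt0.
move=> r r0 rt; have := H r; rewrite -ball_normE /= powR1 distrC => h.
by rewrite -normrN opprB; apply: h; lra.
Qed.

(** The quotient of the two kernels is a power of a quotient of distances, which
    is close to 1 uniformly in [z]; the weight controls each of them. *)
Lemma kern_diff (M rho eta : R) : 0 < rho -> 0 < eta -> exists2 om : R, 0 < om &
  forall x y z, enorm x <= M -> rho <= enorm (x - z) -> rho <= enorm (y - z) ->
  enorm (x - y) < om -> `|K (x - z) - K (y - z)| <= eta * W z.
Proof.
move=> r0 eta0; pose C := kern_const d s p M rho + 1.
have C0 : 0 < C by rewrite ltr_pwDr // kern_const_ge0.
have eC : 0 < eta / C by rewrite divr_gt0.
have [th th0 H] := powR_near1 eC.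
exists (th * rho); first exact: mulr_gt0.
move=> x y z xM xz yz xy.
have xz0 : 0 < enorm (x - z) by lra.
have yz0 : 0 < enorm (y - z) by lra.
pose r := enorm (x - z) / enorm (y - z).
have rr : `|r - 1| <= th.
  have -> : r - 1 = (enorm (x - z) - enorm (y - z)) / enorm (y - z).
    by rewrite /r mulrBl divff // gt_eqF.
  rewrite normrM (ger0_norm (_ : 0 <= (enorm (y - z))^-1)) ?invr_ge0 ?enorm_ge0 //.
  rewrite ler_pdivrMr //; apply: (le_trans (enorm_dist _ _)).
  rewrite opprB addrA subrK; apply: (le_trans (ltW xy)).
  by rewrite ler_wpM2l // ltW.
have rE : K (y - z) = r `^ q * K (x - z).
  rewrite /kern /r powRM ?enorm_ge0 ?invr_ge0 ?enorm_ge0 // powRV ?enorm_ge0 //.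
  by rewrite mulrAC divff ?mul1r // gt_eqF // powR_gt0.
rewrite rE -[X in `|X - _|]mul1r -mulrBl normrM (ger0_norm (kern_ge0 _ _)).
rewrite -normrN opprB; have r00 : 0 <= r by rewrite divr_ge0 ?enorm_ge0.
have h1 := H r r00 rr.
have h2 : K (x - z) <= C * W z.
  apply: (le_trans (kern_le_weight s_gt0 p_gt2 r0 xM xz)).
  by rewrite ler_wpM2r ?weight_ge0 // lerDl.
apply: (@le_trans _ _ (eta / C * (C * W z))).
  by apply: ler_pM => //; exact: kern_ge0.
by rewrite mulrA divfK // gt_eqF.
Qed.

Definition slice_rep (w : T * R -> R) t f : Prop :=
  tail_rep (fun y => w (y, t)) f /\ tail_integ s p f.

(** Joint continuity of the exterior integral in the time and the point, uniformly in
    the value [a]: the kernels are close, and the data are close in the tail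
    space. *)
Lemma ext_cont (w : T * R -> R) (ta th rho0 B e : R) (fh : T -> R) :
  Cloc_tail s p t1 t2 w -> t1 < ta -> ta <= th <= t2 -> 0 < rho0 -> 0 < e ->
  slice_rep w th fh ->
  exists2 om : R, 0 < om & forall tau, ta <= tau <= t2 -> `|tau - th| < om ->
  forall f, slice_rep w tau f -> forall x y a, deep Omega rho0 x -> deep Omega rho0 y ->
  enorm (x - y) < om -> `|a| <= B -> `|ext_int x a f - ext_int y a fh| <= e.
Proof.
move=> wC h1 h2 r0 e0 [rfh tfh].
have [M M0 HM] := bounded_enorm bO.
pose C1 := kern_const d s p M rho0.
have C10 : 0 <= C1 by exact: kern_const_ge0.
have [mfh Ifh] := tfh.
have IW := @integ_weight R d s p s_gt0 p_gt2.
pose Hf y := 2 `^ (p - 1) * (`|B| `^ (p - 1) * W y + `|fh y| `^ (p - 1) * W y).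
have IH : integ mu Hf by apply: integZ; apply: integD => //; exact: integZ.
have Hf0 y : 0 <= Hf y.
  by rewrite mulr_ge0 ?powR_ge0 // addr_ge0 // mulr_ge0 ?powR_ge0 ?weight_ge0.
pose H := \int[mu]_y Hf y.
have H0 : 0 <= H by apply: Rintegral_ge0 => y _; exact: Hf0.
pose dl := e / 3 / (C1 * H + 1).
have CH : 0 < C1 * H + 1 by rewrite ltr_wpDl // mulr_ge0.
have dl0 : 0 < dl by rewrite !divr_gt0.
have [Cd Cd0 Hsplit] := spow_split p_gt2 dl0.
pose eta := e / 3 / (H + 1).
have H1 : 0 < H + 1 by lra.
have eta0 : 0 < eta by rewrite !divr_gt0.
have [om1 om10 Hk] := @kern_diff M rho0 eta r0 eta0.
pose e2 := e / 3 / (Cd * C1 + 1).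
have CC : 0 < Cd * C1 + 1 by rewrite ltr_wpDl // mulr_ge0.
have e20 : 0 < e2 by rewrite !divr_gt0.
have /andP[hta hth] := h2.
have Ith : `[ta, t2]%classic th by rewrite /= in_itv /= h2.
have hat : ta <= t2 by lra.
have [om2 om20 Hc] := C_tail_close p_gt2 (wC ta t2 h1 hat (lexx t2)) Ith e20.
exists (Num.min om1 om2); first by rewrite lt_min om10.
move=> tau Itau; rewrite lt_min => /andP[_ tt] f [rf tf] x y a Dx Dy.
rewrite lt_min => /andP[xy _] aB.
have Itau' : `[ta, t2]%classic tau by rewrite /= in_itv /= Itau.
have [Id Ile] := Hc tau Itau' tt f fh rf rfh.
have Ix := integ_ext a r0 Dx tf; have Iy := integ_ext a r0 Dy tfh.
have xM : enorm x <= M by apply: HM; apply: subset_closure; exact: deep_sub Dx.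
apply: (le_trans (Rint_normB Ix Iy)).
have c0 : 0 <= dl * C1 + eta.
  by apply: addr_ge0; [apply: mulr_ge0 => //|]; exact: ltW.
pose bound z := (dl * C1 + eta) * Hf z + Cd * C1 * (`|f z - fh z| `^ (p - 1) * W z).
have Ib : integ mu bound by apply: integD; exact: integZ.
apply: (@le_trans _ _ (\int[mu]_z bound z)).
  apply: (Rint_le (integ_norm (integB Ix Iy)) Ib) => z.
  rewrite -mulrBr normrM indicE.
  have [|zO] := boolP (z \in ~` Omega); last first.
    rewrite normr0 mul0r /bound; apply: addr_ge0; first exact: mulr_ge0.
    by rewrite !mulr_ge0 ?powR_ge0 ?weight_ge0.
  rewrite inE => zO; rewrite normr1 mul1r.
  have xz := deep_dist Dx zO; have yz := deep_dist Dy zO.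
  rewrite /jump; set k1 := kern _ (x - z); set k2 := kern _ (y - z).
  rewrite (_ : _ - _ = (spow p (a - f z) - spow p (a - fh z)) * k1 +
     spow p (a - fh z) * (k1 - k2)); last by ring.
  apply: (le_trans (ler_normD _ _)).
  rewrite (normrM _ k1) (normrM (spow p (a - fh z))).
  have k1W : k1 <= C1 * W z := kern_le_weight s_gt0 p_gt2 r0 xM xz.
  have k10 : 0 <= k1 := kern_ge0 _ _.
  have kd : `|k1 - k2| <= eta * W z := Hk x y z xM xz yz xy.
  have aH : `|a - fh z| `^ (p - 1) * W z <= Hf z.
    rewrite /Hf -mulrDl mulrA ler_wpM2r ?weight_ge0 //.
    have := spow_sub_le p_gt2 a (fh z); rewrite normr_spow // => h.
    apply: (le_trans h); rewrite ler_wpM2l ?powR_ge0 // lerD2r.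
    rewrite ge0_ler_powR ?nnegrE //; exact: le_trans aB (ler_norm _).
  rewrite (ger0_norm k10) (normr_spow p_gt2 (a - fh z)).
  have sp := Hsplit (a - f z) (a - fh z).
  have fd : `|a - f z - (a - fh z)| = `|f z - fh z|.
    by rewrite -normrN; congr `|_|; ring.
  rewrite fd in sp.
  apply: (@le_trans _ _ ((dl * `|a - fh z| `^ (p - 1) + Cd * `|f z - fh z| `^ (p - 1)) *
     (C1 * W z) + `|a - fh z| `^ (p - 1) * (eta * W z))).
    apply: lerD; first by apply: ler_pM.
    by rewrite ler_wpM2l ?powR_ge0.
  rewrite /bound.
  have hh := ler_wpM2l c0 aH.
  by apply: le_trans (lerD hh (lexx _)); rewrite le_eqVlt; apply/orP; left; apply/eqP; ring.
rewrite /bound (RintD (integZ (dl * C1 + eta) IH) (integZ (Cd * C1) Id)).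
rewrite (RintZ _ IH) (RintZ _ Id) -/H.
have hd : dl * C1 * H <= e / 3.
  rewrite /dl -mulrA mulrAC ler_pdivrMr // ler_wpM2l //; first by lra.
  by rewrite lerDl.
have he : eta * H <= e / 3.
  by rewrite /eta mulrAC ler_pdivrMr // ler_wpM2l ?lerDl //; lra.
have hc : Cd * C1 * \int[mu]_z (`|f z - fh z| `^ (p - 1) * W z) <= e / 3.
  apply: (@le_trans _ _ (Cd * C1 * e2)); first by rewrite ler_wpM2l // mulr_ge0.
  rewrite /e2 mulrC mulrAC ler_pdivrMr // ler_wpM2l ?lerDl //; lra.
by rewrite mulrDl; lra.
Qed.

Lemma ext_int_le (y : T) (a b r : R) f g : 0 < r -> deep Omega r y -> b <= a ->
  tail_integ s p f -> tail_integ s p g ->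
  {ae mu, forall x, ~ Omega x -> f x <= g x} -> ext_int y b g <= ext_int y a f.
Proof.
move=> r0 Dy ba tf tg fg.
have If := integ_ext a r0 Dy tf; have Ig := integ_ext b r0 Dy tg.
rewrite -subr_ge0 /ext_int -(RintB If Ig) /Rintegral.
rewrite (@integral_ae _ _ _ mu _ _ (fun x =>
  `|\1_(~` Omega) x * jump s p y a f x - \1_(~` Omega) x * jump s p y b g x|%:E)).
  by apply: fine_ge0; apply: integral_ge0 => x _; rewrite lee_fin.
apply: filterS fg => x fgx; rewrite ger0_norm // subr_ge0 indicE.
have [|xO] := boolP (x \in ~` Omega); last by rewrite !mul0r.
rewrite inE => /fgx h; rewrite !mul1r /jump ler_wpM2r ?kern_ge0 // spow_le //.
by lra.
Qed.

Variables u v : T * R -> R.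
Hypotheses (uC : Cloc_tail s p t1 t2 u) (vC : Cloc_tail s p t1 t2 v).
Hypothesis urep : forall t, t1 < t -> t <= t2 -> exists f, slice_rep u t f.
Hypothesis vrep : forall t, t1 < t -> t <= t2 -> exists f, slice_rep v t f.
Hypothesis uv_exterior : {ae (lebesgue_rV R d \x @lebesgue_measure R)%E,
       forall z, ~ Omega z.1 -> t1 < z.2 <= t2 -> v z <= u z}.

(** The exterior integrals of [v] and [u] are continuous in time, and ordered
    at almost every time; so they are nearly ordered at nearby times. *)
Lemma exterior (ta rho0 B e : R) : t1 < ta -> ta <= t2 -> 0 < rho0 -> 0 < e ->
  exists2 om : R, 0 < om & forall tau1 tau2, ta <= tau1 <= t2 -> ta <= tau2 <= t2 ->
  `|tau1 - tau2| < om -> forall f g, slice_rep v tau1 f -> slice_rep u tau2 g ->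
  forall x y a b, deep Omega rho0 x -> deep Omega rho0 y -> enorm (x - y) < om ->
  b <= a -> `|a| <= B -> `|b| <= B -> - e <= ext_int x a f - ext_int y b g.
Proof.
move=> h1 h2 r0 e0; have e4 : 0 < e / 4 by rewrite divr_gt0.
pose P om (z : T * R) := forall tau1 tau2, ta <= tau1 <= t2 -> ta <= tau2 <= t2 ->
  `|tau1 - z.2| < om -> `|tau2 - z.2| < om ->
  forall f g, slice_rep v tau1 f -> slice_rep u tau2 g ->
  forall x y a b, deep Omega rho0 x -> deep Omega rho0 y -> enorm (x - y) < om ->
  b <= a -> `|a| <= B -> `|b| <= B -> - e <= ext_int x a f - ext_int y b g.
have [||om om0 H] := @compact_close R d ([set 0] `*` `[ta, t2]%classic) P.
- by apply: compact_setX; [exact: compact_set1|exact: segment_compact].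
- move=> [x0 th] [/= _]; rewrite in_itv /= => /andP[hta hth].
  have tth : t1 < th by lra.
  have [fh rfh] := vrep tth hth; have [gh rgh] := urep tth hth.
  pose tb := (t1 + ta) / 2.
  have tb1 : t1 < tb by rewrite /tb; lra.
  have tbh : tb <= th <= t2 by apply/andP; split => //; rewrite /tb; lra.
  have [om1 om10 H1] := ext_cont B vC tb1 tbh r0 e4 rfh.
  have [om2 om20 H2] := ext_cont B uC tb1 tbh r0 e4 rgh.
  pose om := Num.min (Num.min om1 om2) (ta - tb).
  have om0 : 0 < om by rewrite !lt_min om10 om20 /tb /=; lra.
  have omE : [/\ om <= om1, om <= om2 & om <= ta - tb].
    by rewrite !ge_min !lexx !orbT.
  have [le1 le2 le3] := omE.
  have [t0 /andP[t0a t0b] gd] : exists2 t0, th - om < t0 < th &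
      {ae mu, forall x, ~ Omega x -> t1 < t0 <= t2 -> v (x, t0) <= u (x, t0)}.
    have hlt : th - om < th by lra.
    exact: (ae_meets_interval hlt (ae_slices uv_exterior)).
  have t01 : t1 < t0 by lra.
  have t02 : t0 <= t2 by lra.
  have [f0 rf0] := vrep t01 t02; have [g0 rg0] := urep t01 t02.
  have fg0 : {ae mu, forall x, ~ Omega x -> f0 x <= g0 x}.
    have [[_ E1] _] := rf0; have [[_ E2] _] := rg0.
    move: gd E1 E2; apply: filterS3 => x hx <- <- nO.
    by apply: hx => //; apply/andP.
  have It0 : tb <= t0 <= t2 by apply/andP; split; lra.
  exists (om / 2); first by rewrite divr_gt0.
  move=> z' [_ zz'] rho rp rom tau1 tau2 I1 I2 c1 c2 f g rf rg x y a b Dx Dy xy ba aB bB.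
  rewrite /= in zz'.
  have tr tau : `|tau - z'.2| < rho -> `|tau - th| < om.
    move=> c; have := ler_normD (tau - z'.2) (z'.2 - th); rewrite addrA subrK; lra.
  have {}I1 : tb <= tau1 <= t2.
    by case/andP: I1 => ? ?; apply/andP; split => //; rewrite /tb; lra.
  have {}I2 : tb <= tau2 <= t2.
    by case/andP: I2 => ? ?; apply/andP; split => //; rewrite /tb; lra.
  have c10 : `|tau1 - th| < om1 by apply: lt_le_trans (tr _ c1) le1.
  have c20 : `|tau2 - th| < om2 by apply: lt_le_trans (tr _ c2) le2.
  have d1 : `|t0 - th| < om1 by rewrite ltr_norml; apply/andP; split; lra.
  have d2 : `|t0 - th| < om2 by rewrite ltr_norml; apply/andP; split; lra.
  have xy1 : enorm (x - y) < om1 by lra.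
  have yy1 : enorm (y - y) < om1 by rewrite subrr enorm0.
  have yy2 : enorm (y - y) < om2 by rewrite subrr enorm0.
  have {H1} [[k1 k2] [k3 k4]] := (dist_le_both (H1 tau1 I1 c10 f rf x y a Dx Dy xy1 aB),
    dist_le_both (H1 t0 It0 d1 f0 rf0 y y a Dy Dy yy1 aB)).
  have {H2} [[k5 k6] [k7 k8]] := (dist_le_both (H2 tau2 I2 c20 g rg y y b Dy Dy yy2 bB),
    dist_le_both (H2 t0 It0 d2 g0 rg0 y y b Dy Dy yy2 bB)).
  have k9 := ext_int_le r0 Dy ba rf0.2 rg0.2 fg0.
  rewrite -(_ : - (e / 4 + e / 4 + (e / 4 + e / 4)) = - e); last by field.
  exact: le_chain k2 k3 k9 k8 k5.
exists (om / 2); first by rewrite divr_gt0.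
move=> tau1 tau2 I1 I2 tt f g rf rg x y a b Dx Dy xy.
have o2 : 0 < om / 2 by lra.
have o3 : om / 2 < om by lra.
have K0 : ([set 0] `*` `[ta, t2]%classic : set (T * R)) (0, tau2).
  by split => //=; rewrite in_itv.
apply: (H (om / 2) o2 o3 (0, tau2) K0 tau1 tau2 I1 I2) => //=.
by rewrite subrr normr0.
Qed.

End Exterior.

(** * Comparing the two nonlocal terms *)

Section Doubled.
Variables (R : realType) (d : nat) (s p t1 t2 : R) (Omega : set 'rV[R]_d).
Local Notation mu := (lebesgue_rV R d).
Local Notation T := 'rV[R]_d.
Local Notation q := (d%:R + s * p).
Local Notation K := (@kern R d q).
Local Notation A := (closure Omega `*` `[t1, t2]%classic).
Hypotheses (s_gt0 : 0 < s) (s_lt1 : s < 1) (p_gt2 : 2 < p).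
Hypotheses (oO : open Omega) (bO : bounded_set Omega).

Let sp0 : 0 < s * p. Proof. by rewrite mulr_gt0 //; have := p_gt2; lra. Qed.
Let q0 : 0 < q. Proof. by rewrite ltr_wpDl. Qed.

(** The part of [far_int] where [x + z] is in the domain, in the variable
    [z = y - x]. *)
Definition inner (x : T) (a rho : R) (f : T -> R) (z : T) : R :=
  \1_(~` eball 0 rho) z * (\1_Omega (x + z) * (spow p (a - f (x + z)) * K z)).

Lemma far_split (x : T) (a rho rho0 : R) f : 0 < rho -> rho < rho0 ->
  deep Omega rho0 x -> tail_integ s p f ->
  integ mu (inner x a rho f) /\
  far_int s p x a rho f = \int[mu]_z inner x a rho f z + ext_int s p Omega x a f.
Proof.
move=> r0 rr Dx tf; have r00 : 0 < rho0 by lra.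
have Dr : deep Omega rho x by apply: deep_le Dx; exact: ltW.
pose A1 := Omega `\` eball x rho.
have mA1 : measurable A1.
  by apply: measurableD; [exact: measurable_Omega|exact: measurable_eball].
have sA1 : A1 `<=` ~` eball x rho by move=> y [].
have I1 := integ_jump_far s_gt0 p_gt2 a r0 mA1 sA1 tf.
have I2 := integ_ext s_gt0 p_gt2 oO a r00 Dx tf.
have E z : \1_A1 (x + z) * jump s p x a f (x + z) = inner x a rho f z.
  rewrite /inner /jump mulrA; congr (_ * (_ * _)); last first.
    by rewrite opprD addNKr kernN.
  rewrite !indicE -natrM mulnb; congr (nat_of_bool _)%:R.
  apply/idP/andP; rewrite !inE.
    by move=> [h1 h2]; split => // h; apply: h2; rewrite /eball /= addrC addKr -[z]subr0.
  by move=> [h1 h2]; split => // h; apply: h1; move: h; rewrite /eball /= addrC addKr subr0.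
have I1' := integ_shift x I1.
have Ii : integ mu (inner x a rho f) by apply: eq_integrable I1' => // z _ /=; rewrite E.
split => //.
have -> : \int[mu]_z inner x a rho f z = \int[mu]_y (\1_A1 y * jump s p x a f y).
  by rewrite -(Rint_shift x I1); apply: eq_Rintegral => z _; rewrite E.
rewrite /ext_int -(RintD I1 I2) /far_int; apply: eq_Rintegral => y _.
rewrite -mulrDl; congr (_ * _); rewrite !indicE !in_setC in_setD.
have [yO|yO] := boolP (y \in Omega); rewrite ?addr0 ?add0r //.
rewrite memNset // => /Dr yO'; case/negP: yO; exact: mem_set.
Qed.

(** Translating both integrals to the origin makes the integrands comparable
    wherever both translates stay in the domain.  Where only one of them does,
    the jump is bounded on one side and lives on a thin strip. *)
Lemma inner_compare (x1 x2 : T) (a b B rho rho0 om dl : R) f g H :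
  0 < rho -> rho < rho0 -> deep Omega rho0 x1 -> deep Omega rho0 x2 ->
  enorm (x1 - x2) < om -> 0 <= B -> `|a| <= B -> `|b| <= B ->
  tail_integ s p f -> tail_integ s p g ->
  (forall y, Omega y -> f y <= B) -> (forall y, Omega y -> - B <= g y) ->
  (mu (Omega `\` deep Omega om) <= dl%:E)%E ->
  integ mu H ->
  (forall z, rho <= enorm z -> Omega (x1 + z) -> Omega (x2 + z) ->
     H z <= (spow p (a - f (x1 + z)) - spow p (b - g (x2 + z))) * K z) ->
  (forall z, ~ (rho <= enorm z /\ Omega (x1 + z) /\ Omega (x2 + z)) -> H z <= 0) ->
  \int[mu]_z H z - 2 * (spow p (2 * B) * (rho0 `^ q)^-1) * dl <=
  \int[mu]_z inner x1 a rho f z - \int[mu]_z inner x2 b rho g z.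
Proof.
move=> r0 rr D1 D2 x12 B0 aB bB tf tg fB gB mS IH H1 H2.
have [I1 _] := far_split a r0 rr D1 tf; have [I2 _] := far_split b r0 rr D2 tg.
pose S := Omega `\` deep Omega om.
have mS' : measurable S by exact: measurable_strip.
have Sfin : (mu S < +oo)%E by apply: (le_lt_trans mS); rewrite ltry.
pose C0 := spow p (2 * B) * (rho0 `^ q)^-1.
have C00 : 0 <= C0 by rewrite mulr_ge0 ?spow_ge0 ?mulr_ge0 // invr_ge0 powR_ge0.
have IS x : integ mu (fun z => 1 * \1_S (x + z)).
  by have := integ_shift x (integ_indicM 1 mS' Sfin).
have ISv x : \int[mu]_z (1 * \1_S (x + z)) <= dl.
  rewrite (Rint_shift x (integ_indicM 1 mS' Sfin)).
  rewrite (_ : \int[mu]_y (1 * \1_S y) = \int[mu]_y \1_S y); last first.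
    by apply: eq_Rintegral => y _; rewrite mul1r.
  rewrite Rint_indic // -lee_fin fineK // ge0_fin_numE //.
have IC : integ mu (fun z => C0 * (1 * \1_S (x1 + z) + 1 * \1_S (x2 + z))).
  by apply: integZ; exact: (integD (IS x1) (IS x2)).
apply: (@le_trans _ _ (\int[mu]_z H z -
    \int[mu]_z (C0 * (1 * \1_S (x1 + z) + 1 * \1_S (x2 + z))))).
  rewrite (RintZ _ (integD (IS x1) (IS x2))) (RintD (IS x1) (IS x2)) lerD2l lerN2.
  rewrite -/C0 -mulrA mulrCA ler_wpM2l //.
  by rewrite mulr_natl mulr2n lerD.
rewrite -(RintB IH IC) -(RintB I1 I2).
apply: (Rint_le (integB IH IC) (integB I1 I2)) => z.
have kz : rho0 <= enorm z -> K z <= (rho0 `^ q)^-1.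
  move=> h; have h0 : 0 < rho0 by lra.
  have hz : 0 < enorm z by lra.
  rewrite /kern lef_pV2 ?posrE ?powR_gt0 //.
  by apply: ge0_ler_powR; rewrite ?nnegrE ?enorm_ge0 // ltW.
have sB : spow p (- (2 * B)) = - spow p (2 * B) by rewrite spowN.
have K0 : 0 <= K z by exact: kern_ge0.
rewrite /inner !mul1r.
have [zr|zr] := leP rho (enorm z); last first.
  have z0 : \1_(~` eball (0 : T) rho) z = 0 :> R.
    by rewrite indicE in_setC mem_set // /eball /= subr0.
  rewrite z0 !mul0r subrr; apply: (@le_trans _ _ (0 - 0)); last by rewrite subr0.
  apply: lerB; first by apply: H2 => -[h _]; move: zr; rewrite ltNge h.
  by rewrite mulr_ge0 // addr_ge0.
have z1 : \1_(~` eball (0 : T) rho) z = 1 :> R.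
  rewrite indicE in_setC memNset // /eball /= subr0 => h.
  by move: zr; rewrite leNgt h.
rewrite z1 !mul1r.
have strip x y : ~ Omega (y + z) -> enorm (x - y) < om -> Omega (x + z) ->
    \1_S (x + z) = 1 :> R.
  move=> yO xy xO; rewrite indicE mem_set //; split => // Dx; apply: yO; apply: Dx.
  by rewrite /eball /= opprD addrACA subrr addr0 enormB.
have zdeep x : deep Omega rho0 x -> ~ Omega (x + z) -> rho0 <= enorm z.
  move=> Dx xO; have := deep_dist Dx xO.
  by rewrite opprD addNKr enormN.
have ind0 (x : T) : 0 <= \1_S x :> R by [].
have [x1O|x1O] := pselect (Omega (x1 + z)); have [x2O|x2O] := pselect (Omega (x2 + z)).
- rewrite !(indic_in R x1O) !(indic_in R x2O) !mul1r -mulrBl.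
  apply: le_trans (H1 z zr x1O x2O); rewrite gerBl mulr_ge0 // addr_ge0 //.
- rewrite (indic_in R x1O) (indic_notin R x2O).
  rewrite mul0r subr0 mul1r (strip x1 x2) //.
  have h0 : H z <= 0 by apply: H2 => -[_ []].
  have hk := kz (zdeep _ D2 x2O).
  apply: (@le_trans _ _ (- C0)).
    have : 0 <= C0 * \1_S (x2 + z) by rewrite mulr_ge0.
    by rewrite mulrDr mulr1; lra.
  apply: (@le_trans _ _ (- (spow p (2 * B) * K z))).
    by rewrite lerN2 ler_wpM2l // spow_ge0 // mulr_ge0.
  rewrite -mulNr -sB ler_wpM2r // spow_le //.
  have := fB _ x1O; have := ler_norm (- a); rewrite normrN; lra.
- rewrite (indic_notin R x1O) (indic_in R x2O).
  rewrite mul0r sub0r mul1r (strip x2 x1) //; last by rewrite enormB.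
  have h0 : H z <= 0 by apply: H2 => -[_ []].
  have hk := kz (zdeep _ D1 x1O).
  apply: (@le_trans _ _ (- C0)).
    have : 0 <= C0 * \1_S (x1 + z) by rewrite mulr_ge0.
    by rewrite mulrDr mulr1; lra.
  rewrite lerN2; apply: (@le_trans _ _ (spow p (2 * B) * K z)).
    rewrite ler_wpM2r // spow_le //.
    have := gB _ x2O; have := ler_norm b; lra.
  by rewrite ler_wpM2l // spow_ge0 // mulr_ge0.
rewrite (indic_notin R x1O) (indic_notin R x2O).
rewrite !mul0r subr0; have h0 : H z <= 0 by apply: H2 => -[_ []].
have : 0 <= C0 * (\1_S (x1 + z) + \1_S (x2 + z)) by rewrite mulr_ge0 // addr_ge0.
lra.
Qed.

End Doubled.

(** * Cancellation in the symmetrized double integral *)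

Section Antisymmetric.
Variables (R : realType) (d : nat).
Local Notation mu := (lebesgue_rV R d).
Local Notation T := 'rV[R]_d.

Lemma measurable_translate : measurable_fun setT (fun z : T * T => z.2 - z.1).
Proof.
apply: measurable_fun_rVP => i.
rewrite (_ : _ \o _ = fun z : T * T => rV_coord i z.2 - rV_coord i z.1).
  by apply: measurable_funB;
    [apply: (measurableT_comp (@measurable_rV_coord R d i) (@measurable_snd _ _ _ _))
    |apply: (measurableT_comp (@measurable_rV_coord R d i) (@measurable_fst _ _ _ _))].
by apply/funext => z; rewrite /rV_coord /= !mxE.
Qed.

(** Exchanging the order of integration changes the sign of the double
    integral. *)
Lemma antisym_integral (E : set T) (C : R) (f : T * T -> R) :
  measurable E -> (mu E < +oo)%E -> measurable_fun setT f ->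
  (forall x y, f (y, x) = - f (x, y)) ->
  (forall x y, `|f (x, y)| <= C * \1_E x * \1_E y) ->
  [/\ forall x, integ mu (fun y => f (x, y)),
      integ mu (fun x => \int[mu]_y f (x, y)) &
      \int[mu]_x (\int[mu]_y f (x, y)) = 0].
Proof.
move=> mE Efin mf anti fC.
have If x : integ mu (fun y => f (x, y)).
  apply: (@integ_le _ _ _ _ _ (fun y => (C * \1_E x) * \1_E y)) => //.
    by apply: (measurableT_comp mf); exact: measurable_pair1.
  exact: integ_indicM.
have mI : measurable_fun setT (\1_E : T -> R) by exact: measurable_indic.
have mEf : measurable_fun setT (EFin \o f) by exact/measurable_EFinP.
have I2 : (@leb R d \x @leb R d)%E.-integrable setT (EFin \o f).
  apply/(integrable12ltyP (@leb R d) (@leb R d) mEf) => /=.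
  apply: (@le_lt_trans _ _ (\int[mu]_x \int[mu]_y (C * \1_E x * \1_E y)%:E)%E).
    apply: ge0_le_integral => //.
    + by move=> x _; apply: integral_ge0.
    + apply: (@measurable_fun_fubini_tonelli_F _ _ _ _ _ (@leb R d)
        (fun z => `|(f z)%:E|%E)) => //.
      exact: measurableT_comp.
    + apply: (@measurable_fun_fubini_tonelli_F _ _ _ _ _ (@leb R d)
        (fun z => (C * \1_E z.1 * \1_E z.2)%:E)).
        apply/measurable_EFinP; apply: measurable_funM.
          apply: measurable_funM => //.
          exact: (measurableT_comp mI (@measurable_fst _ _ _ _)).
        exact: (measurableT_comp mI (@measurable_snd _ _ _ _)).
      by move=> [x y]; rewrite lee_fin; exact: le_trans (fC x y).
    move=> x _; apply: ge0_le_integral => //.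
    + by apply/measurable_EFinP; exact: integ_meas (integ_norm (If x)).
    + apply/measurable_EFinP; apply: measurable_funM => //; exact: measurable_indic.
    by move=> y _; rewrite lee_fin; exact: fC.
  have IE := integ_indicM C mE Efin.
  have E1 x : (\int[mu]_y (C * \1_E x * \1_E y)%:E)%E = (C * \1_E x * fine (mu E))%:E.
    rewrite -(EFin_Rint (integ_indicM (C * \1_E x) mE Efin)).
    rewrite RintegralZl //; last first.
      have := integ_indicM 1 mE Efin; apply: eq_integrable => // y _ /=.
      by rewrite mul1r.
    by rewrite Rint_indic.
  under eq_integral do rewrite E1.
  have I3 : integ mu (fun x => C * \1_E x * fine (mu E)).
    have := integZ (fine (mu E)) IE; apply: eq_integrable => // x _ /=.
    by rewrite mulrC.
  by rewrite -(EFin_Rint I3) ltry.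
have FE : fubini_F (@leb R d) (EFin \o f) = EFin \o (fun x => \int[mu]_y f (x, y)).
  apply/funext => x; rewrite /fubini_F /=.
  by rewrite (EFin_Rint (If x)).
have GE : fubini_G (@leb R d) (EFin \o f) = EFin \o (fun y => - \int[mu]_x f (y, x)).
  apply/funext => y; rewrite /fubini_G /= -(RintN (If y)) (EFin_Rint (integN (If y))).
  by apply: eq_integral => x _ /=; rewrite anti.
have IF : integ mu (fun x => \int[mu]_y f (x, y)).
  by have := integrable_fubini_F I2; rewrite FE.
split => //.
have /esym := integral12_prod_meas1 I2; rewrite -(integral21_prod_meas1 I2).
rewrite FE GE /comp => H.
set J := Rintegral _ _ _.
have /eqP : J = - J.
  by apply: EFin_inj; rewrite -RintN // (EFin_Rint (integN IF)) H -EFin_Rint.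
by rewrite -addr_eq0 -mulr2n mulrn_eq0 /= => /eqP.
Qed.

End Antisymmetric.

Section Radii.
Variables (R : realType) (d : nat).
Local Notation mu := (lebesgue_rV R d).
Local Notation T := 'rV[R]_d.

(** The kernel is not integrable at the origin: its infimum over a ball times
    the measure of the ball blows up as the radius tends to zero. *)
Lemma gain_radius (b c L rho : R) : 0 < b -> 0 < c -> 0 < rho ->
  exists2 r1 : R, 0 < r1 <= rho &
    L < c * (r1 `^ (d%:R + b))^-1 * (fine (mu (eball (0 : T) r1)) / 2).
Proof.
move=> b0 c0 rho0; pose c2 : R := (2 / d.+1%:R) ^+ d.
have c20 : 0 < c2 by rewrite exprn_gt0 // divr_gt0.
pose y := c * c2 / 2 / (`|L| + 1).
have L1 : 0 < `|L| + 1 by rewrite ltr_pwDr.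
have y0 : 0 < y by rewrite !divr_gt0 // mulr_gt0.
pose r1 := Num.min rho (y `^ b^-1).
have r10 : 0 < r1 by rewrite lt_min rho0 powR_gt0.
exists r1; first by rewrite r10 ge_min lexx.
have rb : r1 `^ b <= y.
  apply: (@le_trans _ _ ((y `^ b^-1) `^ b)).
    by apply: ge0_ler_powR; rewrite ?nnegrE ?powR_ge0 ?ge_min ?lexx ?orbT // ltW.
  by rewrite -powRrM mulVf ?gt_eqF // powRr1 // ltW.
have rb0 : 0 < r1 `^ b by exact: powR_gt0.
have m : c2 * r1 ^+ d <= fine (mu (eball (0 : T) r1)).
  rewrite -lee_fin fineK ?ge0_fin_numE //; last exact: lebesgue_eball_fin.
  apply: le_trans (lebesgue_eball_ge 0 r10).
  by rewrite lee_fin /c2 -exprMn mulrA mulrAC.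
apply: (@lt_le_trans _ _ (c * c2 / 2 * (r1 `^ b)^-1)).
  rewrite ltr_pdivlMr //; apply: (@le_lt_trans _ _ (`|L| * y)).
    apply: (@le_trans _ _ (`|L| * r1 `^ b)); first by rewrite ler_wpM2r ?ler_norm // ltW.
    by rewrite ler_wpM2l.
  apply: (@lt_le_trans _ _ ((`|L| + 1) * y)); first by rewrite ltr_pM2r // ltrDl.
  by rewrite /y mulrC divfK // gt_eqF.
rewrite powRD; last by rewrite (gt_eqF r10) implybT.
rewrite powR_mulrn ?(ltW r10) // invfM.
have rd : 0 < r1 ^+ d by rewrite exprn_gt0.
have -> : c * c2 / 2 * (r1 `^ b)^-1 =
    c * ((r1 ^+ d)^-1 * (r1 `^ b)^-1) * (c2 * r1 ^+ d / 2).
  by field; rewrite !gt_eqF.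
apply: ler_wpM2l; last by rewrite ler_wpM2r.
by rewrite mulr_ge0 ?mulr_ge0 ?invr_ge0 ?(ltW c0) ?(ltW rd) ?(ltW rb0).
Qed.

Lemma small_ball (beta : R) : (0 < d)%N -> 0 < beta -> exists2 r : R, 0 < r &
  forall rho, 0 < rho -> rho < r -> fine (mu (eball (0 : T) rho)) <= beta.
Proof.
move=> d0 b0; exists (Num.min 1 beta / 2); first by rewrite divr_gt0 // lt_min ltr01.
move=> rho r0; rewrite ltr_pdivlMr // lt_min => /andP[h1 h2].
rewrite -lee_fin fineK ?ge0_fin_numE //; last exact: lebesgue_eball_fin.
apply: (le_trans (lebesgue_eball_le 0 r0)); rewrite lee_fin.
case: d d0 => // n _; rewrite exprS.
apply: le_trans (ltW h2); rewrite mulrC [2 * rho]mulrC.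
by rewrite ger_pMl ?mulr_gt0 // exprn_ile1 // ?mulr_ge0 // ltW.
Qed.

End Radii.

(** * The doubled inequality at the maximum points *)

Section Comparison.
Variables (R : realType) (d : nat) (s p t1 t2 : R) (Omega : set 'rV[R]_d).
Variables (u v : 'rV[R]_d * R -> R).
Local Notation mu := (lebesgue_rV R d).
Local Notation T := 'rV[R]_d.
Local Notation q := (d%:R + s * p).
Local Notation K := (@kern R d q).
Local Notation A := (closure Omega `*` `[t1, t2]%classic).
Hypotheses (s_gt0 : 0 < s) (s_lt1 : s < 1) (p_gt2 : 2 < p).
Hypotheses (oO : open Omega) (bO : bounded_set Omega).
Hypotheses (u_super : viscosity_supersolution s p Omega t1 t2 u)
           (v_sub : viscosity_subsolution s p Omega t1 t2 v).
Hypotheses (uA : usc_on A (fun z => - u z)) (vA : usc_on A v).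
Hypothesis lateral : forall x t, boundary Omega x -> t1 < t <= t2 ->
  v (x, t) + - u (x, t) <= 0.
Hypothesis uv_exterior : {ae (lebesgue_rV R d \x @lebesgue_measure R)%E,
       forall z, ~ Omega z.1 -> t1 < z.2 <= t2 -> v z <= u z}.
Let sp0 : 0 < s * p. Proof. by rewrite mulr_gt0 //; have := p_gt2; lra. Qed.
Let q0 : 0 < q. Proof. by rewrite ltr_wpDl. Qed.

Section Bounded.
Variable B : R.
Hypothesis B0 : 0 <= B.
Hypothesis vB : forall z, A z -> v z <= B.
Hypothesis uB : forall z, A z -> - u z <= B.

Definition dif (V U : T * R -> R) (t : R) (x y : T) : R :=
  spow p (V (x, t) - V (y, t)) - spow p (U (y, t) - U (x, t)).

Lemma sum_errors (a b I1 I2 X1 X2 H c e : R) : a + (I1 + X1) <= e / 8 ->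
  - (e / 8) <= - b + (I2 + X2) -> - (e / 4) <= X1 - X2 -> H - c <= I1 - I2 ->
  c <= e / 4 -> 0 < e -> a + b + H <= e.
Proof. lra. Qed.

Lemma increment_le (a b c V V' : R) : b - c <= V' -> V = a - c -> V - V' <= a - b.
Proof. lra. Qed.

Lemma increment_ge (a b c V V' : R) : - b - c <= V' -> V = - a - c -> a - b <= V' - V.
Proof. lra. Qed.

Lemma norm_le_both (a b k : R) : 0 < k -> k <= a - b -> a <= B -> - b <= B ->
  [/\ b <= a, `|a| <= B & `|b| <= B].
Proof.
by move=> h1 h2 h3 h4; split; rewrite ?ler_norml; try (apply/andP; split); lra.
Qed.

(** The outcome of the two test inequalities at the maximum points: the slopes in
    time of [V] and [U], read off the paraboloids, plus the nonlocal difference,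
    are at most [e].  The latter need not converge at the origin, so it enters
    through its integrable minorants [H], which keep away from the origin and
    from the points that leave the domain. *)
Definition doubled_at (N kappa e rho rho0 : R) (V U : T * R -> R) (t : R) : Prop :=
  forall x, kappa <= V (x, t) + U (x, t) -> forall z1 z2, A z1 -> A z2 ->
    V (x, t) = v z1 - N * sqdist (x, t) z1 ->
    U (x, t) = - u z2 - N * sqdist (x, t) z2 ->
  [/\ close (rho0 / 2) z1 (x, t), close (rho0 / 2) z2 (x, t), deep Omega rho0 z1.1,
      deep Omega rho0 z2.1 &
  forall H, integ mu H ->
    (forall y, rho <= enorm y -> Omega (z1.1 + y) -> Omega (z2.1 + y) ->
       H y <= dif V U t x (x + y) * K y) ->
    (forall y, ~ (rho <= enorm y /\ Omega (z1.1 + y) /\ Omega (z2.1 + y)) -> H y <= 0) ->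
    2 * N * (z1.2 - t) + 2 * N * (z2.2 - t) + \int[mu]_y H y <= e].

Lemma doubled_inequality (t' kappa e : R) : t1 < t' -> 0 < kappa -> 0 < e ->
  exists2 rho0 : R, 0 < rho0 & exists2 N0 : R, 1 <= N0 &
  forall N, N0 <= N -> forall V U, supconv A N v V -> supconv A N (fun z => - u z) U ->
  exists2 rho1 : R, 0 < rho1 & forall rho, 0 < rho -> rho < rho1 ->
  forall t, t' <= t -> t <= t2 -> doubled_at N kappa e rho rho0 V U t.
Proof.
move=> tt k0 e0.
have [rho0 r00 Hloc] := localize oO bO vA uA lateral vB uB tt k0.
exists rho0 => //; pose om0 := rho0 / 2.
have om00 : 0 < om0 by rewrite divr_gt0.
pose ta := (t1 + t') / 2.
have [tat2|tat2] := lerP ta t2; last first.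
  exists 1 => // N _ V U _ _; exists 1 => // rho _ _ t h1 h2.
  by rewrite /ta in tat2; lra.
have ta1 : t1 < ta by rewrite /ta; lra.
have e4 : 0 < e / 4 by lra.
have e8 : 0 < e / 8 by lra.
have C00 : 0 <= spow p (2 * B) * (rho0 `^ q)^-1.
  by rewrite mulr_ge0 ?invr_ge0 ?powR_ge0 // spow_ge0 // mulr_ge0.
set C0 := spow p (2 * B) * _ in C00.
have C1 : 0 < 2 * C0 + 1 by lra.
(* The measure of the strip on which only one translate is in the domain. *)
pose dl := e / 4 / (2 * C0 + 1).
have dl0 : 0 < dl by rewrite divr_gt0.
have dlE : 2 * C0 * dl <= e / 4.
  by rewrite /dl mulrC mulrAC ler_pdivrMr // ler_wpM2l //; lra.
have [om1 om10 strip] := strip_small oO bO dl0.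
have [_ uC _] := u_super; have [_ vC _] := v_sub.
have urep t : t1 < t -> t <= t2 -> exists f, slice_rep s p u t f.
  by move=> h1 h2; have [f [? ? _]] := good_rep_lsc p_gt2 uA uC h1 h2; exists f.
have vrep t : t1 < t -> t <= t2 -> exists f, slice_rep s p v t f.
  by move=> h1 h2; have [f [? ? _]] := good_rep_usc p_gt2 vA vC h1 h2; exists f.
have [om2 om20 Hext] := exterior s_gt0 p_gt2 oO bO uC vC urep vrep uv_exterior B ta1 tat2 r00 e4.
pose om := Num.min (Num.min om0 1) (Num.min (om1 / 2) (om2 / 2)).
have om_gt0 : 0 < om by rewrite !lt_min om00 ltr01 !divr_gt0.
have [omE0 omE1 omE2 omE3] : [/\ om <= om0, om <= 1, om <= om1 / 2 & om <= om2 / 2].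
  by split; rewrite !ge_min lexx ?orbT.
have [N0 N01 HN] := Hloc om om_gt0; exists N0 => // N NN0 V U HV HU.
have Np : 0 <= N by lra.
have [rv rv0 Hv] := sub_test s_gt0 s_lt1 p_gt2 N v_sub e8.
have [ru ru0 Hu] := super_test s_gt0 s_lt1 p_gt2 N u_super e8.
pose rho1 := Num.min (Num.min rv ru) (Num.min rho0 (Num.min 1 (ta - t1))).
exists rho1; first by rewrite !lt_min rv0 ru0 r00 ltr01 subr_gt0.
move=> rho r0; rewrite !lt_min => /and3P[/andP[rrv rru] rr0 /andP[rr1 rrt]].
move=> t h1 h2 x hk z1 z2 A1 A2 VE UE.
have s1 := mulr_ge0 Np (sqdist_ge0 (x, t) z1).
have s2 := mulr_ge0 Np (sqdist_ge0 (x, t) z2).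
have hk' : kappa <= v z1 + - u z2 - N * (sqdist (x, t) z1 + sqdist (x, t) z2).
  by rewrite mulrDr opprD addrACA -VE -UE.
have [c1 c2 D1 D2 [tz1 tz2]] := HN N NN0 (x, t) z1 z2 A1 A2 h1 hk'.
split => //; [exact: close_le c1|exact: close_le c2|].
move=> H IH HH1 HH2.
have [Oz1 /=] := A1; rewrite in_itv /= => /andP[_ z1t].
have [Oz2 /=] := A2; rewrite in_itv /= => /andP[_ z2t].
have rho2 : rho ^+ 2 <= ta - t1.
  by rewrite expr2; apply: le_trans (ltW rrt); rewrite ger_pMl //; exact: ltW.
have tz1' : t1 < z1.2 by exact: lt_le_trans tz1.
have tz2' : t1 < z2.2 by exact: lt_le_trans tz2.
have [f gf] := good_rep_usc p_gt2 vA vC tz1' z1t.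
have [g gg] := good_rep_lsc p_gt2 uA uC tz2' z2t.
have [rf tf fE] := gf; have [rg tg gE] := gg.
have e1 : enorm (z1.1 - x) <= 1 by have [/= h _] := c1; exact: le_trans (ltW h) omE1.
have e2 : enorm (z2.1 - x) <= 1 by have [/= h _] := c2; exact: le_trans (ltW h) omE1.
have dp z : deep Omega rho0 z -> deep Omega rho z by apply: deep_le; exact: ltW.
have max1 z' : A z' -> v z' - N * sqdist (x, t) z' <= v z1 - N * sqdist (x, t) z1.
  by move=> Az'; rewrite -VE; have [h _] := HV (x, t); exact: h.
have max2 z' : A z' -> - u z' - N * sqdist (x, t) z' <= - u z2 - N * sqdist (x, t) z2.
  by move=> Az'; rewrite -UE; have [h _] := HU (x, t); exact: h.
have st1 : t1 <= z1.2 - rho ^+ 2 by rewrite lerBrDr -lerBrDl; apply: le_trans rho2 _; rewrite lerD2r.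
have st2 : t1 <= z2.2 - rho ^+ 2 by rewrite lerBrDr -lerBrDl; apply: le_trans rho2 _; rewrite lerD2r.
have {}Hv := Hv rho r0 rrv (x, t) z1 f e1 (dp _ D1) st1 z1t gf max1.
have {}Hu := Hu rho r0 rru (x, t) z2 g e2 (dp _ D2) st2 z2t gg max2.
have [_ E1] := far_split s_gt0 p_gt2 oO (v z1) r0 rr0 D1 tf.
have [_ E2] := far_split s_gt0 p_gt2 oO (u z2) r0 rr0 D2 tg.
have vz1 := vB A1; have uz2 := uB A2.
have ba : kappa <= v z1 - u z2 by apply: le_trans hk' _; rewrite gerBl mulrDr addr_ge0.
have [{}ba aB bB] := norm_le_both k0 ba vz1 uz2.
have x12 : enorm (z1.1 - z2.1) < 2 * om /\ `|z1.2 - z2.2| < 2 * om.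
  by apply: (close_trans c1 (closeC c2)); rewrite mulr_natl.
have Aof y tau : Omega y -> t1 < tau -> tau <= t2 -> A (y, tau).
  by move=> Oy k1 k2; split; [exact: subset_closure|rewrite /= in_itv /= k2 ltW].
have X : - (e / 4) <= ext_int s p Omega z1.1 (v z1) f - ext_int s p Omega z2.1 (u z2) g.
  apply: (Hext z1.2 z2.2) => //; rewrite -/ta ?tz1 ?tz2 ?z1t ?z2t //.
  - by case: x12 => _ h; apply: lt_le_trans h _; rewrite -ler_pdivlMl // mulrC.
  - by case: x12 => h _; apply: lt_le_trans h _; rewrite -ler_pdivlMl // mulrC.
have I : \int[mu]_z H z - 2 * C0 * dl <=
    \int[mu]_z inner s p Omega z1.1 (v z1) rho f z -
    \int[mu]_z inner s p Omega z2.1 (u z2) rho g z.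
  apply: (@inner_compare _ _ _ _ _ _ _ _ _ _ _ _ _ _ _ om1) => //.
  - by case: x12 => h _; apply: lt_le_trans h _; rewrite -ler_pdivlMl // mulrC.
  - by move=> y Oy; rewrite fE; [apply: vB; exact: Aof|exact: subset_closure].
  - move=> y Oy; rewrite gE; last exact: subset_closure.
    by rewrite lerNl; apply: uB; exact: Aof.
  move=> y yr y1 y2; apply: (le_trans (HH1 y yr y1 y2)).
  rewrite ler_wpM2r ?kern_ge0 // /dif fE ?gE; [|exact: subset_closure..].
  have [k1 _] := HV (x + y, t); have [k2 _] := HU (x + y, t).
  have {}k1 := k1 _ (Aof _ _ y1 tz1' z1t); have {}k2 := k2 _ (Aof _ _ y2 tz2' z2t).
  have sE (z : T * R) : sqdist (x + y, t) (z.1 + y, z.2) = sqdist (x, t) z.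
    by rewrite /sqdist /= opprD addrACA subrr addr0.
  rewrite sE in k1; rewrite sE in k2.
  by apply: lerB; apply: spow_le => //; apply: (increment_le k1 VE) || apply: (increment_ge k2 UE).
rewrite E1 in Hv; rewrite E2 in Hu; rewrite /= in Hv Hu.
exact: sum_errors Hv Hu X I dlE e0.
Qed.

(** * Decay of the truncated mass *)

Variables (N kappa e rho rho0 : R) (V U : T * R -> R).
Hypotheses (N0 : 0 <= N) (k0 : 0 < kappa) (r0 : 0 < rho) (r00 : 0 < rho0).
Hypotheses (HV : supconv A N v V) (HU : supconv A N (fun z => - u z) U).

Local Notation w z := (V z + U z).
Local Notation key_at := (doubled_at N kappa e rho rho0 V U).

Definition mass (t : R) : R := \int[mu]_x (\1_Omega x * Num.max 0 (w (x, t) - kappa)).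

Definition superlevel (c t : R) : set T := [set x | c < w (x, t)].

(** The nonlocal exchange between two points of the superlevel set, cut off near the
    diagonal to make it bounded. *)
Definition flux (t : R) (z : T * T) : R :=
  \1_(superlevel kappa t) z.1 * \1_(superlevel kappa t) z.2 * \1_(~` eball 0 rho) (z.2 - z.1) *
  (dif V U t z.1 z.2 * K (z.2 - z.1)).

Lemma measurable_V t : measurable_fun setT (fun x => V (x, t)).
Proof. exact: (supconv_measurable bO t N0 HV). Qed.

Lemma measurable_U t : measurable_fun setT (fun x => U (x, t)).
Proof. exact: (supconv_measurable bO t N0 HU). Qed.

Lemma measurable_w t : measurable_fun setT (fun x => w (x, t)).
Proof. exact: measurable_funD (measurable_V t) (measurable_U t). Qed.

Lemma measurable_superlevel c t : measurable (superlevel c t).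
Proof.
rewrite (_ : superlevel c t = (fun x => w (x, t)) @^-1` `]c, +oo[%classic).
  by rewrite -[X in measurable X]setTI; exact: measurable_w.
by apply/seteqP; split => x; rewrite /superlevel /= in_itv /= andbT.
Qed.

Lemma V_le z : V z <= B. Proof. exact: (supconv_le z N0 HV vB). Qed.

Lemma U_le z : U z <= B. Proof. exact: (supconv_le z N0 HU uB). Qed.

Lemma integ_mass t : integ mu (fun x => \1_Omega x * Num.max 0 (w (x, t) - kappa)).
Proof.
have mO : measurable Omega by exact: measurable_Omega.
apply: (@integ_le _ _ _ _ _ (fun x => 2 * B * \1_Omega x)).
- apply: measurable_funM; first exact: measurable_indic.
  apply: measurable_maxr => //; apply: measurable_funB => //; exact: measurable_w.
- by apply: integ_indicM => //; exact: Omega_fin.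
move=> x; rewrite normrM mulrC (ger0_norm (_ : 0 <= \1_Omega x)) // ler_wpM2r //.
rewrite ger0_norm; last by rewrite le_max lexx.
rewrite ge_max mulr_ge0 //=; have := V_le (x, t); have := U_le (x, t).
by have := k0; lra.
Qed.

Lemma key_in t x : key_at t -> kappa <= w (x, t) -> Omega x.
Proof.
move=> Hk Ex; have [_ [z1 A1 V1]] := HV (x, t); have [_ [z2 A2 U2]] := HU (x, t).
have [[c1 _] _ D1 _ _] := Hk x Ex z1 z2 A1 A2 V1 U2.
by apply: D1; rewrite /eball /= enormB; move: c1 => /= c1; have := r00; lra.
Qed.

Lemma key_super c t : kappa <= c -> key_at t -> superlevel c t `<=` Omega.
Proof. by move=> kc Hk x cx; apply: (key_in Hk); exact: le_trans kc (ltW cx). Qed.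

Lemma super_fin c t : kappa <= c -> key_at t -> (mu (superlevel c t) < +oo)%E.
Proof.
move=> kc Hk; apply: le_lt_trans (Omega_fin oO bO); apply: le_measure; rewrite ?inE.
- exact: measurable_superlevel.
- exact: measurable_Omega.
- exact: key_super.
Qed.

Lemma dif_le t x y : superlevel kappa t x -> superlevel kappa t y -> `|dif V U t x y| <= 2 * spow p (2 * B).
Proof.
move=> Ex Ey; rewrite /dif mulr_natl mulr2n.
have Bd a b : `|a - b| <= 2 * B -> `|spow p (a - b)| <= spow p (2 * B).
  move=> h; rewrite normr_spow // spow_pos // ?mulr_ge0 //.
  by apply: ge0_ler_powR => //; rewrite ?nnegrE ?mulr_ge0 //; have := p_gt2; lra.
have k := k0; rewrite /superlevel /= in Ex Ey.
have a1 := V_le (x, t); have a2 := V_le (y, t); have a3 := U_le (x, t); have a4 := U_le (y, t).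
apply: (le_trans (ler_normB _ _)); apply: lerD; apply: Bd;
  by rewrite ler_norml; apply/andP; split; lra.
Qed.

Lemma flux_anti t x y : flux t (y, x) = - flux t (x, y).
Proof.
rewrite /flux /= kernB; have -> : dif V U t y x = - dif V U t x y.
  by rewrite /dif -[V (y, t) - _]opprB -[U (x, t) - _]opprB !spowN; ring.
have -> : \1_(~` eball (0 : T) rho) (x - y) = \1_(~` eball (0 : T) rho) (y - x) :> R.
  rewrite !indicE !in_setC; congr (nat_of_bool (~~ _))%:R.
  by apply/idP/idP; rewrite !inE /eball /= !subr0 enormB.
by ring.
Qed.

Lemma flux_le t x y : `|flux t (x, y)| <=
  2 * spow p (2 * B) * (rho `^ q)^-1 * \1_(superlevel kappa t) x * \1_(superlevel kappa t) y.
Proof.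
have S0 : 0 <= 2 * spow p (2 * B) by rewrite mulr_ge0 // spow_ge0 // mulr_ge0.
have C0 : 0 <= 2 * spow p (2 * B) * (rho `^ q)^-1.
  by rewrite mulr_ge0 // invr_ge0 powR_ge0.
rewrite /flux /=.
have [Ex|Ex] := pselect (superlevel kappa t x); last by rewrite (indic_notin R Ex) !(mul0r, mulr0) normr0.
have [Ey|Ey] := pselect (superlevel kappa t y); last by rewrite (indic_notin R Ey) !(mul0r, mulr0) normr0.
rewrite (indic_in R Ex) (indic_in R Ey) !mulr1 mul1r.
have [zr|zr] := pselect ((~` eball (0 : T) rho) (y - x)); last first.
  by rewrite (indic_notin R zr) mul0r normr0.
rewrite (indic_in R zr) mul1r normrM; apply: ler_pM => //; first exact: dif_le.
have {}zr : rho <= enorm (y - x).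
  by rewrite leNgt; apply/negP => h; apply: zr; rewrite /eball /= subr0.
have r0' := r0; have h0 : 0 < enorm (y - x) by lra.
rewrite ger0_norm ?kern_ge0 // /kern lef_pV2 ?posrE ?powR_gt0 //.
by apply: ge0_ler_powR; rewrite ?nnegrE // ltW.
Qed.

Lemma measurable_flux t : measurable_fun setT (flux t).
Proof.
have mS : measurable_fun setT (\1_(superlevel kappa t) : T -> R).
  by apply: measurable_indic; exact: measurable_superlevel.
have mB : measurable_fun setT (\1_(~` eball (0 : T) rho) : T -> R).
  by apply: measurable_indic; apply: measurableC; exact: measurable_eball.
have m1 (f : T -> R) : measurable_fun setT f -> measurable_fun setT (fun z : T * T => f z.1).
  by move=> mf; exact: (measurableT_comp mf (@measurable_fst _ _ _ _)).
have m2 (f : T -> R) : measurable_fun setT f -> measurable_fun setT (fun z : T * T => f z.2).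
  by move=> mf; exact: (measurableT_comp mf (@measurable_snd _ _ _ _)).
have m3 (f : T -> R) : measurable_fun setT f ->
    measurable_fun setT (fun z : T * T => f (z.2 - z.1)).
  by move=> mf; exact: (measurableT_comp mf (@measurable_translate R d)).
have mV := measurable_V t; have mU := measurable_U t.
apply: measurable_funM.
  by apply: measurable_funM; [apply: measurable_funM; [exact: m1|exact: m2]|exact: m3].
apply: measurable_funM; last by apply: m3; exact: measurable_kern.
apply: measurable_funB; apply: (measurableT_comp (@measurable_spow R p));
  apply: measurable_funB.
- exact: m1 mV.
- exact: m2 mV.
- exact: m2 mU.
- exact: m1 mU.
Qed.

(** Towards points of the superlevel set both translates stay in the domain, since
    these points have interior maximum points themselves; towards other points [w]
    decreases and the nonlocal difference is nonnegative. *)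
Lemma flux_key t x z1 z2 : key_at t -> superlevel kappa t x -> A z1 -> A z2 ->
  V (x, t) = v z1 - N * sqdist (x, t) z1 -> U (x, t) = - u z2 - N * sqdist (x, t) z2 ->
  2 * N * (z1.2 - t) + 2 * N * (z2.2 - t) + \int[mu]_y flux t (x, y) <= e.
Proof.
move=> Hk Ex A1 A2 VE UE.
have [[c1 _] [c2 _] _ _ Key] := Hk x (ltW Ex) z1 z2 A1 A2 VE UE.
have [If _ _] := antisym_integral (measurable_superlevel kappa t) (super_fin (lexx kappa) Hk) (measurable_flux t)
  (flux_anti t) (flux_le t).
rewrite -(Rint_shift x (If x)); apply: Key; first exact: (integ_shift x (If x)).
  move=> y yr _ _; rewrite /flux /= (indic_in R Ex) addrAC subrr add0r mul1r.
  have zr : (~` eball (0 : T) rho) y.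
    by move=> h; move: yr; rewrite leNgt; move: h; rewrite /eball /= subr0 => ->.
  rewrite (indic_in R zr) mulr1.
  have [Ey|Ey] := pselect (superlevel kappa t (x + y)).
    by rewrite (indic_in R Ey) mul1r.
  rewrite (indic_notin R Ey) mul0r mulr_ge0 ?kern_ge0 // /dif subr_ge0 spow_le //.
  by move: Ex Ey; rewrite /superlevel /= => Ex /negP; rewrite -leNgt; lra.
move=> y hy; rewrite /flux /= addrAC subrr add0r.
have [Ey|Ey] := pselect (superlevel kappa t (x + y)); last first.
  by rewrite (indic_notin R Ey) mulr0 !mul0r.
have [zr|zr] := pselect ((~` eball (0 : T) rho) y); last first.
  by rewrite (indic_notin R zr) mulr0 !mul0r.
case: hy; split.
  by rewrite leNgt; apply/negP => h; apply: zr; rewrite /eball /= subr0.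
have [_ [y1 B1 Vy]] := HV (x + y, t); have [_ [y2 B2 Uy]] := HU (x + y, t).
have [[d1 _] _ D1 _ _] := Hk (x + y) (ltW Ey) y1 y2 B1 B2 Vy Uy.
move: c1 c2 d1 => /= c1 c2 d1.
have sh z : enorm (z - x) < rho0 / 2 -> Omega (z + y).
  move=> c; apply: D1; rewrite /eball /=.
  have := enorm_triangle (z - x) (x + y - y1.1); rewrite addrA.
  rewrite (_ : z - x + (x + y) = z + y); last by rewrite addrA subrK.
  by move: d1; rewrite enormB; lra.
by split; apply: sh.
Qed.

(** Where [w > kappa] the truncation is active at time [t] and can only help at
    time [t - h]; there the increment is bounded by the doubled inequality, whose
    nonlocal part integrates to zero. *)
Lemma mass_step t h : key_at t -> 0 <= h -> 0 <= e ->
  mass t <= mass (t - h) + fine (mu Omega) * (h * e + 2 * N * h ^+ 2).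
Proof.
move=> Hk h0 e0.
have [If IF F0] := antisym_integral (measurable_superlevel kappa t) (super_fin (lexx kappa) Hk) (measurable_flux t)
  (flux_anti t) (flux_le t).
set c := h * e + 2 * N * h ^+ 2.
have c0 : 0 <= c by rewrite /c addr_ge0 ?mulr_ge0 ?sqr_ge0.
have mO : measurable Omega by exact: measurable_Omega.
have Oi := integ_indicM c mO (Omega_fin oO bO).
have IR := integB Oi (integZ h IF).
rewrite addrC -lerBlDr /mass -(RintB (integ_mass t) (integ_mass (t - h))).
apply: (@le_trans _ _ (\int[mu]_x (c * \1_Omega x - h * \int[mu]_y flux t (x, y)))).
  apply: (Rint_le (integB (integ_mass t) (integ_mass (t - h))) IR) => x.
  have [Ex|Ex] := pselect (superlevel kappa t x); last first.
    have -> : \int[mu]_y flux t (x, y) = 0.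
      rewrite (_ : (fun y => _) = cst 0) ?Rintegral_cst //; last first.
        by apply/funext => y; rewrite /flux /= (indic_notin R Ex) !mul0r.
      by rewrite mul0r.
    rewrite mulr0 subr0 -mulrBr mulrC ler_wpM2r //.
    have -> : Num.max 0 (w (x, t) - kappa) = 0.
      by apply/max_idPl; move: Ex; rewrite /superlevel /= => /negP; rewrite -leNgt; lra.
    have : 0 <= Num.max 0 (w (x, t - h) - kappa) by rewrite le_max lexx.
    lra.
  rewrite (indic_in R (key_super (lexx kappa) Hk Ex)) !mul1r mulr1.
  have [_ [z1 A1 V1]] := HV (x, t); have [_ [z2 A2 U2]] := HU (x, t).
  have ck := flux_key Hk Ex A1 A2 V1 U2.
  have sV := supconv_step h HV A1 V1; have sU := supconv_step h HU A2 U2.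
  have -> : Num.max 0 (w (x, t) - kappa) = w (x, t) - kappa.
    by apply/max_idPr; move: Ex; rewrite /superlevel /=; lra.
  have m : w (x, t - h) - kappa <= Num.max 0 (w (x, t - h) - kappa).
    by rewrite le_max lexx orbT.
  have := ler_wpM2l h0 ck; move: (\int[mu]_y _) => F; rewrite !mulrDr /c => ck'.
  have -> : 2 * N * h ^+ 2 = N * h ^+ 2 + N * h ^+ 2 by ring.
  lra.
rewrite (RintB Oi (integZ h IF)) (RintZ h IF) F0 mulr0 subr0.
rewrite RintegralZl //; last first.
  by have := integ_indicM 1 mO (Omega_fin oO bO); apply: eq_integrable => // y _ /=; rewrite mul1r.
by rewrite Rint_indic // mulrC.
Qed.

(** Dividing the interval into [n] steps, the quadratic errors in the step add up
    to a term of order [1 / n]. *)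
Lemma mass_bound t' T' : (forall t, t' <= t -> t <= T' -> key_at t) -> t' <= T' -> 0 <= e ->
  mass T' <= mass t' + fine (mu Omega) * ((T' - t') * e).
Proof.
move=> Hk tT e0; apply/ler_addgt0Pr => eps eps0.
set m := fine (mu Omega); have m0 : 0 <= m by rewrite fine_ge0.
pose c := m * (2 * N * (T' - t') ^+ 2).
have c0 : 0 <= c by rewrite /c mulr_ge0 // mulr_ge0 ?sqr_ge0 // mulr_ge0.
pose n := (Num.truncn (c / eps)).+1.
have n0 : 0 < n%:R :> R by rewrite ltr0n.
pose h := (T' - t') / n%:R.
have h0 : 0 <= h by rewrite divr_ge0 ?subr_ge0 // ltW.
have hn : h * n%:R = T' - t' by rewrite /h divfK // gt_eqF.
have it k : (k <= n)%N -> mass (t' + k%:R * h) <=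
    mass t' + k%:R * (m * (h * e + 2 * N * h ^+ 2)).
  elim: k => [_|k IH kn]; first by rewrite !mul0r !addr0.
  have kh : t' + k.+1%:R * h <= T'.
    have : k.+1%:R * h <= n%:R * h by rewrite ler_wpM2r // ler_nat.
    by rewrite [n%:R * _]mulrC hn; lra.
  have kh0 : t' <= t' + k.+1%:R * h by rewrite lerDl mulr_ge0.
  have := mass_step (Hk _ kh0 kh) h0 e0.
  have -> : t' + k.+1%:R * h - h = t' + k%:R * h by rewrite -[k.+1%:R]natr1; ring.
  have := IH (ltnW kn); rewrite -/m; move: (m * _) => X.
  have -> : k.+1%:R * X = k%:R * X + X by rewrite -[k.+1%:R]natr1 mulrDl mul1r.
  lra.
have := it n (leqnn n); rewrite [n%:R * h]mulrC hn subrKC => /le_trans; apply.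
have -> : n%:R * (m * (h * e + 2 * N * h ^+ 2)) = m * ((T' - t') * e) + c / n%:R.
  by rewrite -hn /c -hn; field; rewrite gt_eqF.
have : c / n%:R <= eps.
  rewrite ler_pdivrMr // mulrC -ler_pdivrMr //; exact/ltW/truncnS_gt.
by move: (m * _) => X; lra.
Qed.

(** Off the strip the integrand vanishes, and on it [w] is at most [2 B]. *)
Lemma mass_initial t r dl : (forall x, deep Omega r x -> w (x, t) < kappa) ->
  (mu (Omega `\` deep Omega r) <= dl%:E)%E -> mass t <= 2 * B * dl.
Proof.
move=> Hd Sdl; set S := Omega `\` deep Omega r.
have mS : measurable S by exact: measurable_strip.
have Sfin : (mu S < +oo)%E by apply: (le_lt_trans Sdl); rewrite ltry.
have B2 : 0 <= 2 * B by rewrite mulr_ge0.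
apply: (@le_trans _ _ (\int[mu]_x (2 * B * (1 * \1_S x)))).
  apply: Rint_le (integ_mass t) _ _; first by apply: integZ; exact: integ_indicM.
  move=> x; rewrite mul1r.
  have [Ox|Ox] := pselect (Omega x); last by rewrite (indic_notin R Ox) mul0r mulr_ge0.
  rewrite (indic_in R Ox) mul1r.
  have [Dx|Dx] := pselect (deep Omega r x).
    have /max_idPl -> : w (x, t) - kappa <= 0 by have := Hd x Dx; lra.
    by rewrite mulr_ge0.
  have Sx : S x by split.
  rewrite (indic_in R Sx) mulr1 ge_max B2 /=.
  by have := V_le (x, t); have := U_le (x, t); have := k0; lra.
rewrite RintZ; last exact: integ_indicM.
rewrite ler_wpM2l // (_ : (fun x => 1 * \1_S x) = \1_S); last by apply/funext => x; rewrite mul1r.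
by rewrite Rint_indic // -lee_fin fineK // ge0_fin_numE.
Qed.

Lemma fine_indic (S : set T) : measurable S -> fine (mu S) = \int[mu]_x (1 * \1_S x).
Proof.
move=> mS; rewrite -(Rint_indic mu mS).
by congr (Rintegral _ _ _); apply/funext => x; rewrite mul1r.
Qed.

Let kappa_le2 : kappa <= 2 * kappa. Proof. by have := k0; lra. Qed.

Lemma superlevel_mass t : key_at t -> kappa * fine (mu (superlevel (2 * kappa) t)) <= mass t.
Proof.
move=> Hk; have I1 := integ_indicM 1 (measurable_superlevel (2 * kappa) t) (super_fin kappa_le2 Hk).
rewrite (fine_indic (measurable_superlevel (2 * kappa) t)).
rewrite -(RintZ _ I1); apply: (Rint_le (integZ _ I1) (integ_mass t)) => x; rewrite mul1r.
have [Ex|Ex] := pselect (superlevel (2 * kappa) t x); last first.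
  by rewrite (indic_notin R Ex) mulr0 mulr_ge0 // le_max lexx.
rewrite (indic_in R Ex) (indic_in R (key_super kappa_le2 Hk Ex)) mulr1 mul1r.
by rewrite le_max; apply/orP; right; move: Ex; rewrite /superlevel /=; lra.
Qed.

(** At a spatial maximum of [w] the nonlocal term sees the drop of [w] by at
    least [kappa] on all of a small ball but a set of small measure. *)
Lemma gain t x r1 z1 z2 : key_at t -> rho < r1 -> r1 <= rho0 ->
  3 * kappa <= w (x, t) -> (forall y, Omega y -> w (y, t) <= w (x, t)) ->
  A z1 -> A z2 -> V (x, t) = v z1 - N * sqdist (x, t) z1 ->
  U (x, t) = - u z2 - N * sqdist (x, t) z2 ->
  2 * N * (z1.2 - t) + 2 * N * (z2.2 - t) +
    2^-1 `^ (p - 1) * kappa `^ (p - 1) * (r1 `^ q)^-1 *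
    (fine (mu (eball 0 r1)) - (fine (mu (eball 0 rho)) + fine (mu (superlevel (2 * kappa) t)))) <= e.
Proof.
move=> Hk rr1 r10 hx Hmax A1 A2 VE UE.
have kx : kappa <= w (x, t) by have := k0; lra.
have [c1 c2 D1 D2 Key] := Hk x kx z1 z2 A1 A2 VE UE.
have rp := r0; have r1p : 0 < r1 by lra.
set c := _ * (r1 `^ q)^-1; have c0 : 0 <= c by rewrite !mulr_ge0 ?invr_ge0 ?powR_ge0.
have Ib r : integ mu (fun y => 1 * \1_(eball (0 : T) r) y).
  by apply: integ_indicM; [exact: measurable_eball|exact: lebesgue_eball_fin].
have IS := integ_indicM 1 (measurable_superlevel (2 * kappa) t) (super_fin kappa_le2 Hk).
rewrite !(fine_indic (measurable_eball _ _)) (fine_indic (measurable_superlevel (2 * kappa) t)).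
rewrite -(Rint_shift x IS) -(RintD (Ib rho) (integ_shift x IS)).
rewrite -(RintB (Ib r1) (integD (Ib rho) (integ_shift x IS))).
have IH := integB (Ib r1) (integD (Ib rho) (integ_shift x IS)).
rewrite -(RintZ c IH).
have Hneg y : ~ (rho <= enorm y /\ enorm y < r1 /\ ~ superlevel (2 * kappa) t (x + y)) ->
  c * (1 * \1_(eball 0 r1) y - (1 * \1_(eball 0 rho) y + 1 * \1_(superlevel (2 * kappa) t) (x + y))) <= 0.
  move=> hy; rewrite !mul1r -oppr_ge0 -mulrN mulr_ge0 // opprB subr_ge0.
  have [yr|yr] := pselect (eball (0 : T) r1 y); last first.
    by rewrite (indic_notin R yr) addr_ge0.
  rewrite (indic_in R yr); have [yr'|yr'] := pselect (eball (0 : T) rho y).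
    by rewrite (indic_in R yr') lerDl.
  rewrite (indic_notin R yr') add0r.
  have [Sy|Sy] := pselect (superlevel (2 * kappa) t (x + y)); first by rewrite (indic_in R Sy).
  case: hy; move: yr yr'; rewrite /eball /= subr0 => yr yr'; split => //.
  by rewrite leNgt; exact/negP.
have Hle y : w (x + y, t) <= w (x, t).
  have [k|k] := leP kappa (w (x + y, t)); last by lra.
  by apply: Hmax; exact: key_in Hk k.
apply: Key; first exact: integZ.
  move=> y yr _ _.
  have d0 : 0 <= dif V U t x (x + y).
    by rewrite /dif subr_ge0 spow_le //; have := Hle y; lra.
  have [hy|hy] := pselect (rho <= enorm y /\ enorm y < r1 /\ ~ superlevel (2 * kappa) t (x + y)); last first.
    by apply: (le_trans (Hneg y hy)); rewrite mulr_ge0 // kern_ge0.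
  have [_ [yr1 nS]] := hy.
  have b1 : eball (0 : T) r1 y by rewrite /eball /= subr0.
  have b2 : ~ eball (0 : T) rho y.
    by rewrite /eball /= subr0 => h; move: yr; rewrite leNgt h.
  rewrite (indic_in R b1) (indic_notin R b2) (indic_notin R nS) !mulr0 addr0 subr0 !mulr1.
  rewrite /c; apply: ler_pM; rewrite ?mulr_ge0 ?invr_ge0 ?powR_ge0 //.
    have kp : 0 <= kappa by exact: ltW.
    have := spow_gain p_gt2 (U (x + y, t) - U (x, t)) kp.
    rewrite -lerBrDl => h; apply: (le_trans h); rewrite lerD2r spow_le //.
    by move/negP: nS; rewrite -leNgt; lra.
  rewrite /kern lef_pV2 ?posrE ?powR_gt0 //; last by lra.
  by apply: ge0_ler_powR; rewrite ?nnegrE ?enorm_ge0 // ltW.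
move=> y hy; apply: Hneg => -[h1 [h2 _]]; apply: hy; split => //; split.
  by apply: D1; rewrite /eball /= addrC addKr; lra.
by apply: D2; rewrite /eball /= addrC addKr; lra.
Qed.

(** At a maximum relative to a level of slope [sigma], the backward increments of
    [w] are bounded from below, and [supconv_step] bounds them from above. *)
Lemma time_slope t x sigma tb z1 z2 : tb < t ->
  (forall h, 0 < h -> h <= t - tb -> w (x, t - h) <= w (x, t) + sigma * h) ->
  A z1 -> A z2 -> V (x, t) = v z1 - N * sqdist (x, t) z1 ->
  U (x, t) = - u z2 - N * sqdist (x, t) z2 ->
  - sigma <= 2 * N * (z1.2 - t) + 2 * N * (z2.2 - t).
Proof.
move=> tt Hw A1 A2 VE UE; apply/ler_addgt0Pr => eps eps0.
set a := (X in _ <= X + eps); pose h := Num.min (t - tb) (eps / (2 * N + 1)).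
have N1 : 0 < 2 * N + 1 by rewrite ltr_wpDl // mulr_ge0.
have h0 : 0 < h by rewrite lt_min subr_gt0 tt divr_gt0.
have h1 : h <= t - tb by rewrite ge_min lexx.
have h2 : 2 * N * h <= eps.
  have : h <= eps / (2 * N + 1) by rewrite ge_min lexx orbT.
  by rewrite ler_pdivlMr // mulrDr mulr1 mulrC; lra.
have := Hw h h0 h1; have := supconv_step h HV A1 VE; have := supconv_step h HU A2 UE.
move=> k1 k2 k3.
have : - sigma * h <= (a + 2 * N * h) * h.
  have -> : (a + 2 * N * h) * h = h * (2 * N * (z1.2 - t)) + N * h ^+ 2 +
    (h * (2 * N * (z2.2 - t)) + N * h ^+ 2) by rewrite /a; ring.
  by rewrite mulNr; lra.
by rewrite ler_pM2r //; lra.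
Qed.

End Bounded.

(** * Comparison *)

Hypothesis d_gt0 : (0 < d)%N.
Hypothesis initial : forall x, Omega x -> v (x, t1) + - u (x, t1) <= 0.

Lemma absurd_max (sg ab C b bb m : R) : - sg <= ab -> ab + C * (b - (bb + m)) <= 1 ->
  0 <= C -> bb <= b / 4 -> m <= b / 4 -> sg + 1 < C * (b / 2) -> False.
Proof.
move=> h1 h2 C0 h3 h4 h5.
have : C * (b / 2) <= C * (b - (bb + m)) by rewrite ler_wpM2l //; lra.
lra.
Qed.

Lemma upper_bound : exists2 B : R, 0 <= B & forall z, A z -> v z <= B /\ - u z <= B.
Proof.
have [B1 H1] := usc_on_bounded (@cylA_compact R d Omega bO t1 t2) vA.
have [B2 H2] := usc_on_bounded (@cylA_compact R d Omega bO t1 t2) uA.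
exists (`|B1| + `|B2|); first exact: addr_ge0.
move=> z Az; have := H1 z Az; have := H2 z Az.
have := ler_norm B1; have := ler_norm B2; have := normr_ge0 B1; have := normr_ge0 B2.
by split; lra.
Qed.

(** The maximum point of [w] minus the affine level is in the interior of the
    time interval, because the level at the initial time exceeds [2 B]. *)
Lemma level_max (w : T * R -> R) (xs : T) (tb ts kappa sg B : R) : tb < ts -> 0 < kappa ->
  sg * (ts - tb) = 2 * B -> closure Omega xs ->
  (forall z e, 0 < e -> exists2 om : R, 0 < om & forall z', close om z' z -> w z' < w z + e) ->
  (forall z, w z <= 2 * B) -> 5 * kappa <= w (xs, ts) ->
  exists x t, [/\ tb < t, t <= ts, 3 * kappa + sg * (ts - t) <= w (x, t) &
    forall y tau, closure Omega y -> tb <= tau -> tau <= ts ->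
      w (y, tau) <= w (x, t) + sg * (t - tau)].
Proof.
move=> tts k0 sgE Ox cw wB ws.
pose D := closure Omega `*` `[tb, ts]%classic.
have cD : compact D by exact: cylA_compact.
have Ds : D (xs, ts) by split; rewrite //= in_itv /= lexx ltW.
have us : usc_on D (fun z => 0 + (w z + sg * z.2)).
  apply: usc_on_cst_add; first by move=> z _ c c0; exists 1.
  move=> z _ e e0; have e2 : 0 < e / 2 by lra.
  have [om om0 H] := cw z _ e2; have s1 : 0 < `|sg| + 1 by rewrite ltr_pwDr.
  exists (Num.min om (e / 2 / (`|sg| + 1))); first by rewrite lt_min om0 !divr_gt0.
  move=> z' _ zz'; have := H z' (close_le _ zz'); rewrite ge_min lexx => /(_ isT) h1.
  have [_] := zz'; rewrite lt_min ltr_pdivlMr // => /andP[_ h2].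
  have : sg * (z'.2 - z.2) < e / 2.
    apply: (le_lt_trans (ler_norm _)); rewrite normrM; apply: le_lt_trans h2.
    by rewrite mulrC ler_wpM2l //; lra.
  by rewrite mulrBr; lra.
have [|[x t] [/= Dx] ] := usc_on_max cD _ us; first by exists (xs, ts).
rewrite in_itv /= => /andP[h1 h2] Hmax; exists x, t.
have Hm y tau : closure Omega y -> tb <= tau -> tau <= ts ->
    w (y, tau) <= w (x, t) + sg * (t - tau).
  move=> Oy k1 k2; have := Hmax (y, tau); rewrite !add0r /= => /(_ _) H.
  have {}H : w (y, tau) + sg * tau <= w (x, t) + sg * t.
    by apply: H; split; rewrite //= in_itv /= k1.
  by rewrite mulrBr; lra.
have h5 := Hm xs ts Ox (ltW tts) (lexx ts).
have h6 : 5 * kappa + sg * (ts - t) <= w (x, t).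
  have -> : sg * (ts - t) = - (sg * (t - ts)) by ring.
  lra.
split => //; last by lra.
rewrite lt_neqAle h1 andbT; apply/eqP => tE; rewrite -tE sgE in h6.
by have := wB (x, tb); lra.
Qed.

Lemma half_lt (a : R) : 0 < a / 2 -> a / 2 < a.
Proof. lra. Qed.

Lemma near_sum (a b a' b' c : R) : `|a' - a| < c / 2 -> `|b' - b| < c / 2 ->
  a' + b' < a + b + c.
Proof. by rewrite !ltr_norml => /andP[_ h1] /andP[_ h2]; lra. Qed.

Lemma comparison xs ts : Omega xs -> t1 < ts <= t2 -> v (xs, ts) <= u (xs, ts).
Proof.
move=> Oxs /andP[tts ts2]; rewrite leNgt; apply/negP => hvu.
have t12 : t1 <= t2 by lra.
(* The excess [5 kappa] at [ts] against the level [3 kappa] there; the superlevel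
   set whose measure is controlled is that of [2 kappa]. *)
pose kappa := (v (xs, ts) - u (xs, ts)) / 5.
have k0 : 0 < kappa by rewrite /kappa; lra.
have kE : v (xs, ts) + - u (xs, ts) = 5 * kappa by rewrite /kappa mulrC divfK.
have [B B0 vuB] := upper_bound.
have vB z : A z -> v z <= B by case/vuB.
have uB z : A z -> - u z <= B by case/vuB.
pose tb := (t1 + ts) / 2.
have tb1 : t1 < tb by rewrite /tb; lra.
have tbs : tb < ts by rewrite /tb; lra.
have tb2 : tb <= t2 by lra.
have tb0 : 0 < ts - tb by rewrite subr_gt0.
pose sg := 2 * B / (ts - tb).
have sg0 : 0 <= sg by rewrite divr_ge0 ?mulr_ge0 // ltW.
have sgE : sg * (ts - tb) = 2 * B by rewrite /sg divfK // gt_eqF.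
have [rb rb0 [N3 N31 HN3]] := doubled_inequality B0 vB uB tb1 k0 ltr01.
pose c1 := 2^-1 `^ (p - 1) * kappa `^ (p - 1).
have c10 : 0 < c1 by rewrite mulr_gt0 // powR_gt0.
(* The radius of the ball comes before the smallness of the mass, which is relative
   to the measure of that ball. *)
have [r1 /andP[r10 r1b] HL] := gain_radius d (sg + 1) sp0 c10 rb0.
set C := c1 * _ in HL; have C0 : 0 <= C by rewrite mulr_ge0 ?invr_ge0 ?powR_ge0 // ltW.
set b := fine _ in HL.
have b0 : 0 < b.
  rewrite ltNge; apply/negP => h; have : C * (b / 2) <= 0 by rewrite mulr_ge0_le0 //; lra.
  by lra.
have b4 : 0 < b / 4 by rewrite divr_gt0.
have [rs rs0 Hs] := small_ball d_gt0 b4.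
pose dl := kappa * b / 8; have dl0 : 0 < dl by rewrite divr_gt0 // mulr_gt0.
have ratio a : 0 <= a -> 0 < dl / (a + 1) /\ a * (dl / (a + 1)) <= dl.
  move=> a0; have a1 : 0 < a + 1 by rewrite ltr_wpDl.
  by rewrite divr_gt0 // mulrCA ger_pMr // ler_pdivrMr // mul1r lerDl.
have [dl1 dlB] := ratio _ (mulr_ge0 (ler0n R 2) B0).
pose m := fine (mu Omega); have m0 : 0 <= m by rewrite fine_ge0.
have mT : 0 <= m * (t2 - t1) by rewrite mulr_ge0 // subr_ge0.
have [e0 eB] := ratio _ mT; set e := dl / _ in e0 eB.
have [r r0 strip] := strip_small oO bO dl1.
have [t' /andP[t'1 t'b] [N1 N11 HN1]] :=
  localize_initial bO vA uA initial vB uB tb1 tb2 r0 k0.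
have [ra ra0 [N2 N21 HN2]] := doubled_inequality B0 vB uB t'1 k0 e0.
pose N := Num.max N1 (Num.max N2 N3).
have NN1 : N1 <= N by rewrite le_max lexx.
have NN2 : N2 <= N by rewrite !le_max lexx orbT.
have NN3 : N3 <= N by rewrite !le_max lexx !orbT.
have N0 : 0 <= N by apply: le_trans NN1; apply: le_trans N11.
have cA : compact A by exact: cylA_compact.
have As : A (xs, ts) by split; [exact: subset_closure|rewrite /= in_itv /= ts2 ltW].
have nA : A !=set0 by exists (xs, ts).
have [V HV] := supconv_exists N cA nA vA; have [U HU] := supconv_exists N cA nA uA.
have [ha ha0 Ka] := HN2 N NN2 V U HV HU; have [hb hb0 Kb] := HN3 N NN3 V U HV HU.
pose rho := Num.min (Num.min ha hb) (Num.min rs r1) / 2.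
have rho0 : 0 < rho by rewrite divr_gt0 // !lt_min ha0 hb0 rs0 r10.
have : rho < Num.min (Num.min ha hb) (Num.min rs r1) by move: rho0; rewrite /rho; exact: half_lt.
rewrite !lt_min => /andP[/andP[rha rhb] /andP[rhs rh1]].
have wB z : V z + U z <= 2 * B.
  rewrite mulr_natl mulr2n; apply: lerD; [exact: (supconv_le z N0 HV vB)|].
  exact: (supconv_le z N0 HU uB).
have Hini x : deep Omega r x -> V (x, t') + U (x, t') < kappa.
  move=> Dx; have [_ [z1 A1 ->]] := HV (x, t'); have [_ [z2 A2 ->]] := HU (x, t').
  by have := HN1 N NN1 x z1 z2 Dx A1 A2; rewrite mulrDr opprD addrACA.
have ws : 5 * kappa <= V (xs, ts) + U (xs, ts).
  rewrite -kE; apply: lerD.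
    by have [h _] := HV (xs, ts); have := h _ As; rewrite sqdistxx mulr0 subr0.
  by have [h _] := HU (xs, ts); have := h _ As; rewrite sqdistxx mulr0 subr0.
have [M HM] := @cylA_bounded R d t1 t2 Omega bO.
have cw z eps : 0 < eps -> exists2 om : R, 0 < om &
    forall z', close om z' z -> V z' + U z' < V z + U z + eps.
  move=> eps0; have eps2 : 0 < eps / 2 by rewrite divr_gt0.
  have [om1 om10 H1] := supconv_cont N0 HM HV z eps2.
  have [om2 om20 H2] := supconv_cont N0 HM HU z eps2.
  exists (Num.min om1 om2); first by rewrite lt_min om10.
  move=> z' zz'; have := H1 z' (close_le _ zz'); rewrite ge_min lexx => /(_ isT) h1.
  have := H2 z' (close_le _ zz'); rewrite ge_min lexx orbT => /(_ isT) h2.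
  exact: near_sum h1 h2.
have [x [t [tt1 tt2 hx Hmax]]] := level_max tbs k0 sgE (subset_closure Oxs) cw wB ws.
have tle : t <= t2 by exact: le_trans ts2.
have [_ [z1 A1 VE]] := HV (x, t); have [_ [z2 A2 UE]] := HU (x, t).
have hx3 : 3 * kappa <= V (x, t) + U (x, t).
  by apply: le_trans hx; rewrite lerDl mulr_ge0 // subr_ge0.
have Kbt := Kb rho rho0 rhb t (ltW tt1) tle.
have Ox : Omega x.
  apply: (key_in rb0 HV HU Kbt); apply: le_trans hx3; rewrite ler_peMl ?(ltW k0) //.
  by rewrite ler1n.
have hmax y : Omega y -> V (y, t) + U (y, t) <= V (x, t) + U (x, t).
  move=> Oy; have := Hmax y t (subset_closure Oy) (ltW tt1) tt2.
  by rewrite subrr mulr0 addr0.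
have slope := time_slope N0 HV HU (sigma := sg) tt1 _ A1 A2 VE UE.
have {}slope := slope _; have G := gain N0 k0 rho0 rb0 HV HU Kbt rh1 r1b
  hx3 hmax A1 A2 VE UE.
have Kat tau : t' <= tau -> tau <= t -> doubled_at N kappa e rho ra V U tau.
  by move=> h1 h2; apply: (Ka rho) => //; exact: le_trans tle.
have t't : t' <= t by rewrite ltW // (lt_trans t'b).
have mb := mass_bound B0 vB uB N0 k0 rho0 ra0 HV HU Kat t't (ltW e0).
have mi := mass_initial B0 vB uB N0 k0 HV HU Hini strip.
have sm := superlevel_mass B0 vB uB N0 k0 ra0 HV HU (Kat t t't (lexx t)).
have m2 : fine (mu (superlevel V U (2 * kappa) t)) <= b / 4.
  rewrite -(ler_pM2l k0); apply: (le_trans sm); apply: (le_trans mb).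
  have -> : kappa * (b / 4) = dl + dl by rewrite /dl; field.
  apply: lerD; first exact: le_trans mi dlB.
  apply: le_trans eB; rewrite mulrA -/m; apply: ler_wpM2r; first exact: ltW.
  by apply: ler_wpM2l => //; apply: lerB; [|exact: ltW].
apply: (absurd_max _ G C0 (Hs rho rho0 rhs) m2 HL).
apply: slope => h h0 h1.
have tau1 : tb <= t - h by rewrite lerBrDr -lerBrDl.
have tau2 : t - h <= ts by rewrite (le_trans _ tt2) // gerBl ltW.
by have := Hmax x (t - h) (subset_closure Ox) tau1 tau2; rewrite subKr.
Qed.

End Comparison.

Unset Implicit Arguments.
Set Strict Implicit.

Theorem theorem3p2 (R : realType) (d : nat) (s p t1 t2 : R)
    (Omega : set 'rV[R]_d) (u v : 'rV[R]_d * R -> R)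
    (d_gt0 : (0 < d)%N)
    (s_gt0 : 0 < s) (s_lt1 : s < 1)
    (p_gt2 : 2 < p) (p_lt : p < 2 / (1 - s))
    (Omega_dom : bounded_smooth_domain Omega)
    (t12 : t1 < t2)
    (u_super : viscosity_supersolution s p Omega t1 t2 u)
    (v_sub : viscosity_subsolution s p Omega t1 t2 v)
    (u_lsc : USC (closure Omega `*` `[t1, t2]%classic) (fun z => - u z))
    (v_usc : USC (closure Omega `*` `[t1, t2]%classic) v)
    (uv_lateral : forall x t, boundary Omega x -> t1 < t <= t2 ->
       v (x, t) <= u (x, t))
    (uv_initial : forall x, Omega x -> v (x, t1) <= u (x, t1))
    (uv_exterior : {ae (lebesgue_rV R d \x @lebesgue_measure R)%E,
       forall z, ~ Omega z.1 -> t1 < z.2 <= t2 -> v z <= u z}) :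
  forall x t, Omega x -> t1 < t <= t2 -> v (x, t) <= u (x, t).
Proof.
have [_ oO _ bO _] := Omega_dom; move=> x t Ox tt.
have lateral y tau : boundary Omega y -> t1 < tau <= t2 -> v (y, tau) + - u (y, tau) <= 0.
  by move=> h1 h2; rewrite subr_le0; exact: uv_lateral.
have initial y : Omega y -> v (y, t1) + - u (y, t1) <= 0.
  by move=> h; rewrite subr_le0; exact: uv_initial.
exact: (comparison s_gt0 s_lt1 p_gt2 oO bO u_super v_sub (USC_usc_on u_lsc)
  (USC_usc_on v_usc) lateral uv_exterior d_gt0 initial Ox tt).
Qed.
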